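(* Let $C=V(f)\subset\mathbb{P}^2$ be a reduced conic-line arrangement of degree $d\ge 6$ over $\mathbb{C}$. Then $\tau(C)=d^2-3d+2$ if and only if $C$ is one of the following: \begin{itemize} \item ($\mathcal{C}_2$) a conic arrangement given by the union of conics belonging to a bitangent pencil; \item ($\mathcal{C}\mathcal{L}_6$) a conic-line arrangement given by the union of conics belonging to a bitangent pencil and the line passing through the two bitangency points. \end{itemize}
   Context: Work over $\mathbb{C}$ with $R=\mathbb{C}[x,y,z]$ and $\mathbb{P}^2=\mathrm{Proj}(R)$. A conic-line arrangement is a reduced plane curve $C=V(f)$ ($f\in R_d$ homogeneous of degree $d$) all of whose irreducible components are lines or smooth conics (arrangements of only lines or only conics are allowed). The Jacobian ideal of $f$ is $J_f=(\partial_x f,\partial_y f,\partial_z f)\subset R$. The global (total) Tjurina number $\tau(C)$ is the degree of the zero-dimensional scheme defined by $J_f$; equivalently $\tau(C)=\sum_{p\in \mathrm{Sing}(C)}\tau_p(C)$, where, if $g=0$ is a local affine equation of $C$ with $p$ translated to the origin, $\tau_p(C)=\dim_{\mathbb{C}}\mathbb{C}\{x,y\}/\langle \partial_xg,\partial_yg,g\rangle$. A bitangent pencil is a pencil of conics whose general member is smooth and such that any two distinct smooth members meet exactly at two fixed points $p,q$ (the bitangency points), being tangent with intersection multiplicity $2$ at each. In suitable coordinates the smooth conics used are $xz+ay^2=0$ with $a\ne0$, $p=(0:0:1)$, $q=(1:0:0)$, and the line joining $p$ and $q$ is $y=0$. A union of conics belonging to such a pencil means a union of distinct smooth conics of the pencil,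 their number being determined by the degree $d$ of $C$. *)

(* Defs.v *)
From mathcomp Require Export all_boot all_order all_algebra.
From mathcomp Require Export reals complex mpoly.

Set Implicit Arguments.
Unset Strict Implicit.
Unset Printing Implicit Defensive.

Import GRing.Theory.
Local Open Scope ring_scope.

(* The homogeneous coordinates x, y, z of P^2 are the variables 'X_0, 'X_1,
   'X_2 of {mpoly K[3]}. A point of P^2 is represented by a nonzero vector
   v : 'I_3 -> K, taken up to same_pt; a plane curve is represented by a
   nonzero form, taken up to same_curve. *)

Definition ideal_gen (A : comNzRingType) (s : seq A) (a : A) : Prop :=
  exists c : 'I_(size s) -> A, a = \sum_i c i * s`_i.

(* dim_K (V / (V :&: W)) = t, where K acts on A through iota: there are t
   elements of V whose classes form a basis of the quotient. *)
Definition quot_dim (K : fieldType) (A : comNzRingType) (iota : K -> A)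
    (V W : A -> Prop) (t : nat) : Prop :=
  exists e : 'I_t -> A,
    (forall i, V (e i)) /\
    (forall v, V v ->
       exists! c : {ffun 'I_t -> K}, W (v - \sum_i iota (c i) * e i)).

Section PlaneCurves.
Variable K : fieldType.
Implicit Types (f g h l : {mpoly K[3]}) (p q v : 'I_3 -> K).

Definition is_pt v : Prop := exists i, v i != 0.

Definition same_pt p q : Prop :=
  exists2 c : K, c != 0 & forall i, p i = c * q i.

Definition same_curve g h : Prop := exists2 c : K, c != 0 & g = c *: h.

(* The Hilbert function of K[x,y,z]/(s) takes the value t at k. *)
Definition hilbert_value (s : seq {mpoly K[3]}) (k t : nat) : Prop :=
  quot_dim (@mpolyC 3 K) (fun g => g \is k.-homog) (ideal_gen s) t.

(* For homogeneous generators s: the Hilbert polynomial of Proj (K[x,y,z]/(s))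
   is the constant t, i.e. this scheme has dimension 0 and degree t (or is
   empty, with t = 0). *)
Definition zero_dim_degree (s : seq {mpoly K[3]}) (t : nat) : Prop :=
  exists N : nat, forall k, (N <= k)%N -> hilbert_value s k t.

Definition jacobian_gens f : seq {mpoly K[3]} := [seq f^`M(i) | i : 'I_3].

Definition total_tjurina f (t : nat) : Prop :=
  zero_dim_degree (jacobian_gens f) t.

Definition reduced_poly f : Prop :=
  f != 0 /\ (forall g h, f = g ^+ 2 * h -> g \is a GRing.unit).

Definition irreducible_mpoly g : Prop :=
  [/\ g != 0, g \isn't a GRing.unit &
      forall a b, g = a * b -> a \is a GRing.unit \/ b \is a GRing.unit].

Definition is_line l : Prop := l != 0 /\ l \is 1.-homog.

Definition smooth_conic g : Prop :=
  g \is 2.-homog /\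
  (forall v, is_pt v -> g.@[v] = 0 -> exists i, g^`M(i).@[v] != 0).

(* For a reduced form f, the irreducible components of V(f) are the curves
   V(g) with g an irreducible factor of f. *)
Definition conic_line_arrangement f : Prop :=
  reduced_poly f /\
  (forall g h, f = g * h -> irreducible_mpoly g -> is_line g \/ smooth_conic g).

(* The local ring of P^2 at p, inside the fraction field of K[x,y,z]: quotients
   of forms of the same degree whose denominator does not vanish at p. *)
Definition local_ring p (x : {fraction {mpoly K[3]}}) : Prop :=
  exists (k : nat) (a u : {mpoly K[3]}),
    [/\ a \is k.-homog, u \is k.-homog, u.@[p] != 0 &
        x = tofrac a / tofrac u].

(* The stalk at p of the ideal sheaf defined by the forms s. *)
Definition local_ideal p (s : seq {mpoly K[3]})
    (x : {fraction {mpoly K[3]}}) : Prop :=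
  exists (k : nat) (a u : {mpoly K[3]}),
    [/\ a \is k.-homog, u \is k.-homog, u.@[p] != 0, ideal_gen s a &
        x = tofrac a / tofrac u].

Definition intersection_mult p g h (m : nat) : Prop :=
  quot_dim (fun c : K => tofrac (mpolyC 3 c))
    (local_ring p) (local_ideal p [:: g; h]) m.

(* Equality of the tangent lines at p of two curves smooth at p. *)
Definition same_tangent p g h : Prop :=
  forall v, \sum_i g^`M(i).@[p] * v i = 0 <-> \sum_i h^`M(i).@[p] * v i = 0.

Definition pencil_member (q1 q2 g : {mpoly K[3]}) : Prop :=
  g != 0 /\ exists a b : K, g = a *: q1 + b *: q2.

(* "The general member is smooth" is rendered by the second clause: all members
   of the pencil but finitely many are smooth. *)
Definition bitangent_pencil (q1 q2 : {mpoly K[3]}) p q : Prop :=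
  [/\ [/\ q1 \is 2.-homog, q2 \is 2.-homog &
          forall a b : K, a *: q1 + b *: q2 = 0 -> a = 0 /\ b = 0],
      exists s : seq {mpoly K[3]}, forall g, pencil_member q1 q2 g ->
        smooth_conic g \/ (exists2 h, h \in s & same_curve g h),
      [/\ is_pt p, is_pt q & ~ same_pt p q] &
      forall g h, pencil_member q1 q2 g -> pencil_member q1 q2 h ->
        smooth_conic g -> smooth_conic h -> ~ same_curve g h ->
        [/\ forall v, is_pt v ->
              (g.@[v] = 0 /\ h.@[v] = 0 <-> same_pt v p \/ same_pt v q),
            same_tangent p g h /\ intersection_mult p g h 2 &
            same_tangent q g h /\ intersection_mult q g h 2]].

(* V(f) is a union of distinct smooth conics of the pencil spanned by q1, q2. *)
Definition pencil_conic_union (q1 q2 f : {mpoly K[3]}) : Prop :=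
  exists (m : nat) (g : 'I_m -> {mpoly K[3]}) (c : K),
    [/\ forall i, pencil_member q1 q2 (g i) /\ smooth_conic (g i),
        forall i j, i != j -> ~ same_curve (g i) (g j) &
        c != 0 /\ f = c *: \prod_i g i].

Definition type_C2 f : Prop :=
  exists (q1 q2 : {mpoly K[3]}) p q,
    bitangent_pencil q1 q2 p q /\ pencil_conic_union q1 q2 f.

Definition type_CL6 f : Prop :=
  exists (q1 q2 : {mpoly K[3]}) p q l g,
    [/\ bitangent_pencil q1 q2 p q,
        pencil_conic_union q1 q2 g,
        is_line l /\ (l.@[p] = 0 /\ l.@[q] = 0) &
        f = l * g].

End PlaneCurves.

(* Main.v *)
From HB Require Import structures.
Require Import Defs.
From mathcomp Require Import zify ring.
From Stdlib Require Import Classical.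
Set Implicit Arguments.
Unset Strict Implicit.
Unset Printing Implicit Defensive.
Import Order.TTheory GRing.Theory Num.Theory.
Local Open Scope ring_scope.

(** Let [E] be the Euler field and let [rho] be a primitive homogeneous syzygy, of
degree [r], of the partial derivatives of a reduced form [f] of degree [d].
For every syzygy [s] the vector [cross rho s] is orthogonal to [rho] and [s],
hence a multiple [h * grad f] of the gradient. The forms [h] obtained in this
way make up an ideal [I], the Bourbaki ideal of [rho] ([bourbaki]). It is
isomorphic, up to a shift, to the module of syzygies modulo the multiples of
[rho], and counting dimensions gives in all large degrees
  tau + codim I + r (d - 1 - r) = (d - 1)^2
([bourbaki_dim], [codim_tjurina], [tjurina_codim]). For
tau = d^2 - 3d + 2 = (d - 1)^2 - (d - 1) this reads
  codim I + r (d - 1 - r) = d - 1.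

Two components [g], [h] of an arrangement give the field grad g x grad h, which
kills both and, corrected by a multiple of [E], yields a syzygy of degree
[d - 2] ([pair_syz]). Let [r] be the least degree of a syzygy. If
2 <= r <= d - 3, then r (d - 1 - r) >= 2 (d - 3) > d - 1 because 6 <= d. If
r = d - 2, then [I] has codimension 1; being saturated ([bourbaki_saturated])
it contains a linear form ([bourbaki_linear]), that is, there is a syzygy of
degree 2, against the minimality of [r]. So [r] is at most 1
([linear_syzygy]): a linear vector field that is not a multiple of [E] kills
[f] ([linear_field]). Moreover [I] is not the whole ring
([no_unit_bourbaki]).

Every component is an eigenform of this field, because it is prime and divides
its own derivative ([component_eigen]). If all the components are lines, two of
them share an eigenvalue, and then the lines, or all of them but one, pass
through one point. If there is a smooth conic [Q] among the components, a
multiple of [E] can be subtracted so that the field kills [Q]. It is then an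
infinitesimal isometry of [Q] and has a fixed point ([kernel_vector]). If this
point lies outside the conic, the field is a multiple of x d/dx - z d/dz in
coordinates in which [Q] is axz + by^2, and the components are among the lines x, y, z and the
conics of the bitangent pencil spanned by xz and y^2 ([torus_case]). If the
point lies on the conic, the field is nilpotent, and the components are the
tangent line at this point and conics which meet [Q] at this point only
([nilpotent_case]). In all these cases except for a union of conics of the
bitangent pencil, with or without the line y, one has I = R: a field
[theta] which preserves a factor [A] of [f] and whose determinant with [E] and
[rho] is a constant multiple of [A] shows this ([bourbaki_of_factor]), which
contradicts the value of tau.

Conversely, any bitangent pencil has the form above in suitable coordinates
([bitangent_normal_form]), x d/dx - z d/dz kills the union of its conics, with
or without the line y, and [I] is the ideal of the point (0:1:0), of codimension
1 in every degree; as r = 1, the formula gives tau = d^2 - 3d + 2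
([nearly_free_tjurina]).

Divisibility arguments of this kind need irreducible forms to be prime; this is
[factorial_mpoly], obtained by Gauss's lemma and induction on the number of
variables. *)

(** * Factorial domains and polynomial rings *)

Section UFD.
Variable A : idomainType.
Definition dvdr (a b : A) := exists c, b = a * c.
Definition prime_el (p : A) :=
  [/\ p != 0, p \isn't a GRing.unit &
      forall a b, dvdr p (a * b) -> dvdr p a \/ dvdr p b].
Definition factors (a : A) := exists2 s : seq A, (forall p, p \in s -> prime_el p) &
    exists2 u, u \is a GRing.unit & a = u * \prod_(p <- s) p.
Definition factorial_dom := forall a : A, a != 0 -> factors a.

Lemma dvdr_mull a b c : dvdr a b -> dvdr a (c * b).
Proof. by case=> e ->; exists (c * e); rewrite mulrCA. Qed.

Lemma dvdr_sum (I : Type) (r : seq I) (P : pred I) (F : I -> A) a :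
  (forall i, P i -> dvdr a (F i)) -> dvdr a (\sum_(i <- r | P i) F i).
Proof.
move=> h; apply: (big_ind (dvdr a)) => //; first by exists 0; rewrite mulr0.
by move=> x y [c ->] [e ->]; exists (c + e); rewrite mulrDr.
Qed.

Lemma dvdrD a b c : dvdr a b -> dvdr a c -> dvdr a (b + c).
Proof. by case=> x -> [y ->]; exists (x + y); rewrite mulrDr. Qed.
Lemma dvdrN a b : dvdr a b -> dvdr a (- b).
Proof. by case=> x ->; exists (- x); rewrite mulrN. Qed.
Lemma dvdrB a b c : dvdr a b -> dvdr a c -> dvdr a (b - c).
Proof. by move=> ? ?; apply: dvdrD => //; apply: dvdrN. Qed.

Lemma prime_dvd_prod p (s : seq A) : prime_el p ->
  dvdr p (\prod_(q <- s) q) -> exists2 q, q \in s & dvdr p q.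
Proof.
case=> p0 pU pP; elim: s => [|q s IH].
  rewrite big_nil => -[c /esym h]; case/negP: pU; apply/unitrP.
  by exists c; rewrite mulrC h.
rewrite big_cons => /pP [h|/IH [q' q's h]].
  by exists q; rewrite ?mem_head.
by exists q'; rewrite // inE q's orbT.
Qed.

(** A substitute for calculations in the fraction field: the denominator [a] is a
    product of primes and a unit, and these can be cancelled one at a time. *)
Lemma cancel_denominator (P : A -> Prop) : factorial_dom ->
  (forall u w, u \is a GRing.unit -> P (u * w) -> P w) ->
  (forall p w, prime_el p -> P (p * w) -> P w) ->
  forall a w, a != 0 -> P (a * w) -> P w.
Proof.
move=> fA hu hp a w /fA [s sP [u uU ->]].
rewrite -mulrA => /(hu _ _ uU).
elim: s sP => [|p s IH] sP; first by rewrite big_nil mul1r.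
rewrite big_cons -mulrA => /(hp _ _ (sP _ (mem_head _ _))); apply: IH => q qs.
by apply: sP; rewrite inE qs orbT.
Qed.
End UFD.

Section UFDfacts.
Variable A : idomainType.
Implicit Types (a b p q : A).

Lemma factors_unit a : a \is a GRing.unit -> factors a.
Proof. by move=> aU; exists [::] => //; exists a; rewrite // big_nil mulr1. Qed.
Lemma factors_prime p : prime_el p -> factors p.
Proof.
move=> pP; exists [:: p]; first by move=> q; rewrite inE => /eqP ->.
by exists 1; rewrite ?unitr1 // big_seq1 mul1r.
Qed.
Lemma factorsM a b : factors a -> factors b -> factors (a * b).
Proof.
move=> [s sP [u uU ->]] [t tP [v vU ->]]; exists (s ++ t).
  by move=> p; rewrite mem_cat => /orP[/sP|/tP].
by exists (u * v); rewrite ?unitrM ?uU // big_cat /= mulrACA.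
Qed.

Lemma prime_dvd_assoc p q : prime_el p -> prime_el q -> dvdr p q ->
  exists2 v, v \is a GRing.unit & q = p * v.
Proof.
move=> [p0 pU pP] [q0 qU qP] [v qpv]; exists v => //.
case: (qP p v); first by rewrite -qpv; exists 1; rewrite mulr1.
  case=> w pqw; apply/unitrP; exists w; suff e : v * w = 1 by rewrite mulrC e.
  by apply: (mulfI p0); rewrite mulr1 mulrA -qpv -pqw.
case=> w vqw; case/negP: pU; apply/unitrP; exists w.
suff e : p * w = 1 by rewrite mulrC e.
by apply: (mulfI q0); rewrite mulr1 [RHS]qpv vqw; ring.
Qed.
End UFDfacts.

Section Gauss.
Import Pdiv.Idomain.
Variable A : idomainType.
Hypothesis fA : factorial_dom A.
Implicit Types (f g h : {poly A}).

(** A prime that divides [f * g] divides one of the two leading coefficients;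
    removing the leading term of that factor makes the total size smaller. *)
Lemma prime_polyC (p : A) : prime_el p -> prime_el p%:P.
Proof.
move=> [p0 pU pP]; split; rewrite ?polyC_eq0 //.
  by rewrite poly_unitE coefC eqxx /= size_polyC p0.
move=> f g; have [n] := ubnP (size f + size g); elim: n f g => // n IH f g.
have [->|f0] := eqVneq f 0; first by left; exists 0; rewrite mulr0.
have [->|g0] := eqVneq g 0; first by right; exists 0; rewrite mulr0.
rewrite ltnS => len pfg.
have : dvdr p (lead_coef f * lead_coef g).
  by case: pfg => c cE; exists (lead_coef c); rewrite -lead_coefM cE lead_coefM lead_coefC.
have red (f1 : {poly A}) : f1 != 0 -> dvdr p (lead_coef f1) -> exists2 f' : {poly A}, (size f' < size f1)%N &
    exists e : {poly A}, f1 = f' + p%:P * e.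
  move=> f10 [c cE]; exists (f1 - p%:P * (c *: 'X^((size f1).-1))); last first.
    by exists (c *: 'X^((size f1).-1)); rewrite subrK.
  have sz : (0 < size f1)%N by rewrite size_poly_gt0.
  rewrite -(prednK sz) ltnS; apply/leq_sizeP => j; rewrite leq_eqVlt => /orP[/eqP <-|lt].
    by rewrite coefB coefCM coefZ coefXn prednK // eqxx mulr1 -cE /lead_coef subrr.
  rewrite coefB coefCM coefZ coefXn prednK // gtn_eqF // !mulr0 subr0 nth_default //.
  by rewrite -(prednK sz).
case/pP => [/(red _ f0) [f' lt [e fE]]|/(red _ g0) [g' lt [e gE]]].
- case: (IH f' g); first by apply: leq_trans len; rewrite ltn_add2r.
  + have -> : f' * g = f * g - p%:P * (e * g) by rewrite fE; ring.
    by apply: dvdrB => //; exists (e * g).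
  + by move=> h; left; rewrite fE; apply: dvdrD => //; exists e.
  by right.
- case: (IH f g'); first by apply: leq_trans len; rewrite ltn_add2l.
  + have -> : f * g' = f * g - p%:P * (e * f) by rewrite gE; ring.
    by apply: dvdrB => //; exists (e * f).
  + by left.
  by move=> h; right; rewrite gE; apply: dvdrD => //; exists e.
Qed.

Definition primitive_poly f := forall p : A, prime_el p -> ~ dvdr p%:P f.

(** Pseudo-division makes [f] divide a constant multiple of [w]; the primes of the
    constant do not divide [f], so that they divide the quotient. *)
Lemma primitive_dvdp f w : primitive_poly f -> f %| w -> dvdr f w.
Proof.
move=> fP /Pdiv.WeakIdomain.dvdpP [[c q] /= c0 e].
pose P x := dvdr f (x%:P * w).
have : P (c * 1) by rewrite /P mulr1 mul_polyC e; exists q; rewrite mulrC.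
suff H : forall a x, a != 0 -> P (a * x) -> P x.
  by move/(H _ _ c0); rewrite /P mul1r.
apply: cancel_denominator => // [u x uU [y]|p x pP [y yE]].
  rewrite polyCM -mulrA => e1; exists (u^-1%:P * y).
  by rewrite mulrCA -e1 [RHS]mulrA -polyCM mulVr // mul1r.
have pp := prime_polyC pP; case: (pp) => p0 _ pM.
have : dvdr p%:P (f * y) by rewrite -yE polyCM -mulrA; exists (x%:P * w).
case/pM => [/(fP _ pP)//|[y' y'E]]; exists y'; apply: (mulfI p0).
by rewrite [RHS]mulrCA -y'E -yE polyCM mulrA.
Qed.

(** Gauss's lemma: each prime of the constant divides one of the two factors. *)
Lemma split_denominator f g h (c : A) : c != 0 -> c%:P * f = g * h ->
  exists g' h' : {poly A}, [/\ f = g' * h', size g' = size g & size h' = size h].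
Proof.
move=> c0 e.
pose P x := exists g' h' : {poly A}, [/\ x%:P * f = g' * h', size g' = size g & size h' = size h].
have : P (c * 1) by exists g, h; rewrite mulr1.
suff H : forall a x, a != 0 -> P (a * x) -> P x.
  by case/(H _ _ c0) => g' [h' [e1 e2 e3]]; exists g', h'; rewrite -e1 mul1r.
apply: cancel_denominator => // [u x uU [g' [h' [e1 e2 e3]]]|p x pP [g' [h' [e1 e2 e3]]]].
  have u0 : u^-1 != 0 by rewrite invr_eq0; apply: contraTneq uU => ->; rewrite unitr0.
  exists (u^-1%:P * g'), h'; split=> //.
    by rewrite -mulrA -e1 polyCM !mulrA -polyCM mulVr // mul1r.
  by rewrite mul_polyC size_scale.
have [p0 _ pM] := prime_polyC pP.
have pA0 : p != 0 by case: pP.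
have : dvdr p%:P (g' * h') by rewrite -e1 polyCM -mulrA; exists (x%:P * f).
case/pM => -[y yE].
  exists y, h'; split=> //; last by rewrite -e2 yE mul_polyC size_scale.
  by apply: (mulfI p0); rewrite !mulrA -polyCM e1 yE.
exists g', y; split=> //; last by rewrite -e3 yE mul_polyC size_scale.
by apply: (mulfI p0); rewrite mulrA -polyCM e1 yE mulrCA.
Qed.

(** The notion [irreducible_poly] ignores constants, like [gcdp], which gives the
    dichotomy; primitivity then restores divisibility over [A]. *)
Lemma irreducible_primitive_prime f : irreducible_poly f -> primitive_poly f -> prime_el f.
Proof.
move=> fI fP; have f0 := irredp_neq0 fI; split=> //.
  by rewrite poly_unitE; case: fI => s _; rewrite gtn_eqF.
move=> a b [c cE]; have fab : f %| a * b by rewrite cE dvdp_mulr.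
have [co|nco] := boolP (coprimep f a).
  by right; apply: primitive_dvdp => //; rewrite -(Gauss_dvdpr b co).
left; apply: primitive_dvdp => //.
have := apply_irredp fI (q := gcdp f a); rewrite -coprimep_def => /(_ nco (dvdp_gcdl _ _)) /eqp_dvdl <-.
exact: dvdp_gcdr.
Qed.

(** A prime that divides [f] divides its leading coefficient. Dividing it out
    removes one prime from the factorization [s] of the latter, so this stops, at a
    primitive polynomial. *)
Lemma factors_content n f (s : seq A) (u : A) : f != 0 -> size s = n ->
  (forall p, p \in s -> prime_el p) -> u \is a GRing.unit ->
  lead_coef f = u * \prod_(p <- s) p ->
  (forall g, primitive_poly g -> size g = size f -> factors g) -> factors f.
Proof.
elim: n f s u => [|n IH] f s u f0 sz sP uU lE H.
  move/size0nil: sz lE => ->; rewrite big_nil mulr1 => lE.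
  apply: H => // p [p0 pU _] [c cE]; case/negP: pU.
  move: uU; rewrite -lE cE lead_coefM lead_coefC unitrM; by case/andP.
have [[p [pP [f' fE]]]|np] := classic (exists p, prime_el p /\ dvdr p%:P f); last first.
  by apply: H => // p pP pf; apply: np; exists p.
have [p0 pU _] := pP.
have lE' : p * lead_coef f' = u * \prod_(p <- s) p by rewrite -lE fE lead_coefM lead_coefC.
have f'0 : f' != 0 by apply: contraNneq f0; rewrite fE => ->; rewrite mulr0.
have sE : size f' = size f by rewrite fE mul_polyC size_scale.
rewrite fE; apply: factorsM; first exact/factors_prime/prime_polyC.
have [q qs pq] : exists2 q, q \in s & dvdr p q.
  apply: prime_dvd_prod => //; exists (u^-1 * lead_coef f').
  by rewrite mulrCA lE' mulKr.
have [v vU qE] := prime_dvd_assoc pP (sP _ qs) pq.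
apply: (IH f' (rem q s) (u * v)) => //.
- by rewrite size_rem // sz.
- by move=> r /mem_rem /sP.
- by rewrite unitrM uU.
- apply: (mulfI p0); rewrite lE' (perm_big _ (perm_to_rem qs)) big_cons qE /=; ring.
by move=> g gP gE; apply: H; rewrite // gE.
Qed.

Theorem factorial_poly : factorial_dom {poly A}.
Proof.
move=> f; have [n] := ubnP (size f); elim: n f => // n IH f; rewrite ltnS => len f0.
have lf0 : lead_coef f != 0 by rewrite lead_coef_eq0.
have [s sP [u uU lE]] := fA lf0.
apply: (factors_content f0 (erefl (size s)) sP uU lE) => g gP gE.
have g0 : g != 0 by rewrite -size_poly_eq0 gE size_poly_eq0.
have [g1|g1] := leqP (size g) 1.
  have [c cE] : exists c, g = c%:P by exists g`_0; apply/size1_polyC.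
  have c0 : c != 0 by rewrite -(polyC_eq0 c) -cE.
  apply: factors_unit; rewrite poly_unitE cE size_polyC c0 coefC /=.
  have [[|p t] tP [v vU cE2]] := fA c0; first by rewrite cE2 big_nil mulr1.
  case: (gP p (tP _ (mem_head _ _))); exists (v * \prod_(q <- t) q)%:P.
  by rewrite cE cE2 big_cons -polyCM; congr (_%:P); ring.
have [gI|gR] := classic (irreducible_poly g).
  exact/factors_prime/irreducible_primitive_prime.
have [q [q1 qg nq]] : exists q : {poly A}, [/\ size q != 1, q %| g & ~ (q %= g)].
  apply: NNPP => H; apply: gR; split=> // q q1 qg.
  by apply: NNPP => nq; apply: H; exists q.
have q0 : q != 0 by apply: contraTneq qg => ->; rewrite dvd0p.
have qlt : (size q < size g)%N.
  rewrite ltn_neqAle dvdp_leq // andbT; apply/negP => /eqP e.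
  by apply: nq; rewrite -dvdp_size_eqp // e.
have /Pdiv.WeakIdomain.dvdpP [[c h] /= c0 e] := qg.
have e' : c%:P * g = h * q by rewrite mul_polyC.
have [h' [q' [gE' hs qs]]] := split_denominator c0 e'.
have h0 : h != 0 by apply: contraNneq g0 => h0; move/eqP: e'; rewrite h0 mul0r mulf_eq0 polyC_eq0 (negPf c0).
have sz : size g = (size h + size q).-1.
  by rewrite gE' size_mul -?size_poly_eq0 ?hs ?qs ?size_poly_eq0.
have q1' : (1 < size q)%N by move: q1; rewrite -(size_poly_eq0 q) in q0; case: (size q) q0 => [|[]].
rewrite gE'; apply: factorsM; apply: IH.
- by rewrite hs; apply: leq_trans len; rewrite -gE sz; case: (size q) q1' => [|[|k]] // _; rewrite !addnS /= ltnS leq_addr.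
- by rewrite -size_poly_eq0 hs size_poly_eq0.
- by rewrite qs; apply: leq_trans len; rewrite -gE.
- by rewrite -size_poly_eq0 qs size_poly_eq0.
Qed.
End Gauss.

(** Being factorial is a property of the multiplicative monoid alone; hence [phi]
    is not required to be additive. *)
Lemma factorial_transfer (A B : idomainType) (phi : A -> B) (psi : B -> A) :
  {morph phi : a b / a * b} -> phi 1 = 1 -> phi 0 = 0 ->
  cancel phi psi -> cancel psi phi -> factorial_dom B -> factorial_dom A.
Proof.
move=> phiM phi1 phi0 phiK psiK fB.
have psiM : {morph psi : a b / a * b}.
  by move=> a b; rewrite -[a in LHS]psiK -[b in LHS]psiK -phiM phiK.
have psi1 : psi 1 = 1 by rewrite -phi1 phiK.
have psi0 : psi 0 = 0 by rewrite -phi0 phiK.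
have psiU b : b \is a GRing.unit -> psi b \is a GRing.unit.
  by move=> bU; apply/unitrP; exists (psi b^-1); rewrite -!psiM mulVr // mulrV.
have phiU a : a \is a GRing.unit -> phi a \is a GRing.unit.
  by move=> aU; apply/unitrP; exists (phi a^-1); rewrite -!phiM mulVr // mulrV.
have phiD a b : dvdr a b -> dvdr (phi a) (phi b).
  by case=> c ->; exists (phi c); rewrite phiM.
have psiP p : prime_el p -> prime_el (psi p).
  case=> p0 pU pP; split.
  - by apply: contraNneq p0 => e; rewrite -(psiK p) e phi0.
  - by apply: contraNN pU => /phiU; rewrite psiK.
  move=> a b /phiD; rewrite psiK phiM => /pP [] [c cE]; [left|right].
    by exists (psi c); rewrite -psiM -cE phiK.
  by exists (psi c); rewrite -psiM -cE phiK.
move=> a a0; have pa0 : phi a != 0 by apply: contraNneq a0 => e; rewrite -(phiK a) e psi0.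
have [s sP [u uU e]] := fB _ pa0.
exists (map psi s); first by move=> _ /mapP [p /sP ? ->]; apply: psiP.
exists (psi u); first exact: psiU.
by rewrite big_map -(big_morph psi psiM psi1) -psiM -e phiK.
Qed.

Section MpolyUFD.
Variable K : fieldType.

Lemma mmulti_horner n (p : {poly {mpoly K[n]}}) : mmulti p = (mpwiden p).['X_ord_max].
Proof.
rewrite horner_coef size_map_inj_poly ?mwiden0 //; last exact: inj_mwiden.
by apply: eq_bigr => i _; rewrite coef_map.
Qed.

Lemma muniX n (m : 'X_{1..n.+1}) : muni 'X_[K, m] =
  ('X_[[multinom (m (widen_ord (leqnSn n) i)) | i < n]])%:P * 'X^(m ord_max).
Proof. by rewrite muniE msuppX big_seq1 mcoeffX eqxx scale1r mul_polyC. Qed.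

Lemma mnmwidenK n (m : 'X_{1..n.+1}) :
  (mnmwiden [multinom (m (widen_ord (leqnSn n) i)) | i < n] + U_(ord_max) *+ m ord_max)%MM = m.
Proof.
apply/mnmP => i; rewrite mnmDE mulmnE mnm1E.
have [->|] := eqVneq i ord_max; first by rewrite mnmwiden_ordmax mul1n.
move=> ni; rewrite mul0n addn0; have lt : (i < n)%N.
  by have := ltn_ord i; rewrite ltnS leq_eqVlt => /orP[/eqP e|//]; case/eqP: ni; apply: val_inj.
have -> : i = widen_ord (leqnSn n) (Ordinal lt) by apply: val_inj.
by rewrite mnmwiden_widen mnmE.
Qed.

Lemma muniK n : cancel (@muni n K) (@mmulti n K).
Proof.
move=> p; rewrite [in LHS](mpolyE p) raddf_sum /= mmulti_horner [mpwiden _]raddf_sum /= horner_sum.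
rewrite [RHS]mpolyE; apply: eq_bigr => m _.
rewrite muniZ muniX -mul_polyC !rmorphM /= mpwidenC [_ ('X^ _)]rmorphXn /= mpwidenX mpwidenC.
rewrite !hornerE mwidenC mwidenX. rewrite -[LHS]/((p@_m)%:MP * _ * _).
by rewrite mul_mpolyC -scalerAl mpolyXn -mpolyXD mnmwidenK.
Qed.

Lemma mmultiK n : cancel (@mmulti n K) (@muni n K).
Proof.
move=> p; rewrite /mmulti raddf_sum /= -[RHS]coefK poly_def.
apply: eq_bigr => i _; rewrite rmorphM rmorphXn /=.
have -> : muni ('X_ord_max : {mpoly K[n.+1]}) = 'X.
  rewrite muniX mnm1E eqxx expr1 (_ : [multinom _ | _ < n] = 0%MM) ?mpolyX0 ?mul1r //.
  by apply/mnmP => j; rewrite mnmE mnm1E mnm0E eqE /= gtn_eqF.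
rewrite -mul_polyC; congr (_ * _).
rewrite [in LHS](mpolyE p`_i) [in RHS](mpolyE p`_i) (raddf_sum (@mwiden n K)) (raddf_sum (@muni n K)) (raddf_sum polyC).
apply: eq_bigr => m _; rewrite /= mwidenZ mwidenX muniZ muniX mnmwiden_ordmax expr0 mulr1.
rewrite -mul_polyC -polyCM mul_mpolyC; congr (_ *: 'X_[_])%:P.
by apply/mnmP => j; rewrite mnmE mnmwiden_widen.
Qed.

(** The last variable is split off: polynomials in [n.+1] variables are
    polynomials in one variable over the ring in [n] variables. *)
Theorem factorial_mpoly n : factorial_dom {mpoly K[n]}.
Proof.
elim: n => [|n IH].
  move=> a a0; apply: factors_unit; rewrite (nvar0_mpolyC a); apply/unitrP.
  have a1 : a@_0%MM != 0 by rewrite -(mpolyC_eq0 0) -nvar0_mpolyC.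
  by exists ((a@_0%MM)^-1)%:MP; rewrite -!mpolyCM mulVf // mulfV.
apply: (factorial_transfer (@muniM n K) (muni1 _ _) (muni0 _ _) (@muniK n) (@mmultiK n)).
exact: factorial_poly.
Qed.
End MpolyUFD.

(** * Gradients and syzygies *)

Lemma ord3P (P : 'I_3 -> Prop) : P 0 -> P 1 -> P 2 -> forall i, P i.
Proof.
move=> h0 h1 h2 [[|[|[|//]]] lt].
- by rewrite (_ : Ordinal lt = 0) //; apply: val_inj.
- by rewrite (_ : Ordinal lt = 1) //; apply: val_inj.
- by rewrite (_ : Ordinal lt = 2) //; apply: val_inj.
Qed.

Lemma sum3 (V : nmodType) (F : 'I_3 -> V) : \sum_i F i = F 0 + F 1 + F 2.
Proof.
rewrite !big_ord_recl big_ord0 addr0 addrA; congr (F _ + F _ + F _); exact: val_inj.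
Qed.

Definition vec3 (A : Type) (a b c : A) (i : 'I_3) : A :=
  if i == 0 then a else if i == 1 then b else c.

Lemma choice3 (A : Type) (P : 'I_3 -> A -> Prop) :
  (forall i, exists a, P i a) -> exists s, forall i, P i (s i).
Proof.
move=> h; have [a ha] := h 0; have [b hb] := h 1; have [c hc] := h 2.
by exists (vec3 a b c); elim/ord3P.
Qed.

Lemma exists_neq0 (V : nmodType) (F : 'I_3 -> V) :
  ~ (forall i, F i = 0) -> exists i, F i != 0.
Proof.
move=> H; apply: NNPP => no; apply: H => i; apply/eqP.
by apply: contraT => nz; case: no; exists i.
Qed.

Notation ring01 :=
  (mulr0, mul0r, mulr1, mul1r, addr0, add0r, oppr0, subr0, sub0r).

Section Cross.
Variable A : comPzRingType.
Implicit Types u v w : 'I_3 -> A.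
Definition dot u v := \sum_i u i * v i.
Definition cross u v : 'I_3 -> A :=
  fun i => u (i + 1) * v (i + 2) - u (i + 2) * v (i + 1).

Lemma dotE u v : dot u v = u 0 * v 0 + u 1 * v 1 + u 2 * v 2.
Proof. exact: sum3. Qed.

Lemma ord3_add : prod (prod (1 + 1 = 2 :> 'I_3) (1 + 2 = 0 :> 'I_3)) (prod (2 + 1 = 0 :> 'I_3)
  (2 + 2 = 1 :> 'I_3)).
Proof. by do !split; apply: val_inj. Qed.

Lemma cross0 u v : cross u v 0 = u 1 * v 2 - u 2 * v 1.
Proof. by rewrite /cross !add0r. Qed.
Lemma cross1 u v : cross u v 1 = u 2 * v 0 - u 0 * v 2.
Proof. by rewrite /cross !ord3_add. Qed.
Lemma cross2 u v : cross u v 2 = u 0 * v 1 - u 1 * v 0.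
Proof. by rewrite /cross !ord3_add. Qed.
Definition crossE := (cross0, cross1, cross2).

Lemma dot_crossl u v : dot u (cross u v) = 0.
Proof. by rewrite dotE !crossE; ring. Qed.
Lemma dot_crossr u v : dot v (cross u v) = 0.
Proof. by rewrite dotE !crossE; ring. Qed.

Lemma triple_cross u v w i : cross (cross u v) w i = dot u w * v i - dot v w * u i.
Proof. by elim/ord3P: i; rewrite !crossE !dotE; ring. Qed.

Lemma cross_eq0 u v : cross u v =1 (fun=> 0) -> forall j k, u j * v k = u k * v j.
Proof.
move=> h; have h0 := h 0; have h1 := h 1; have h2 := h 2.
move: h0 h1 h2; rewrite !crossE => /subr0_eq h0 /subr0_eq h1 /subr0_eq h2.
by elim/ord3P => //; elim/ord3P; rewrite ?h0 ?h1 ?h2.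
Qed.
End Cross.

Section Primitive.
Variable K : fieldType.
Local Notation S := {mpoly K[3]}.

Definition primitive (w : 'I_3 -> S) :=
  (exists i, w i != 0) /\ forall p, prime_el p -> exists i, ~ dvdr p (w i).

(** If [w i0] is not zero, then [w i0 * u] is the multiple [u i0 * w] of [w]. A prime
    of [w i0] fails to divide some entry of [w], so it divides the multiplier and
    can be cancelled. *)
Lemma primitive_parallel (u w : 'I_3 -> S) : primitive w -> cross u w =1 (fun=> 0) ->
  exists c, forall i, u i = c * w i.
Proof.
move=> [[i0 w0] wP] /cross_eq0 h.
pose P x := exists c, forall i, x * u i = c * w i.
have : P (w i0 * 1) by exists (u i0) => i; rewrite mulr1 mulrC h.
suff H : forall a x, a != 0 -> P (a * x) -> P x.
  by case/(H _ _ w0) => c cE; exists c => i; rewrite -cE mul1r.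
apply: cancel_denominator => [|a x aU [c cE]|p x pP [c cE]]; first exact: factorial_mpoly.
  by exists (a^-1 * c) => i; rewrite -mulrA -cE -mulrA mulKr.
have [p0 _ pM] := pP; have [i wi] := wP p pP.
case: (pM c (w i)) => [||//]; first by rewrite -cE -mulrA; exists (x * u i).
by case=> c' c'E; exists c' => j; apply: (mulfI p0); rewrite !mulrA cE c'E.
Qed.
End Primitive.

Section Euler.
Variable K : numFieldType.
Local Notation S := {mpoly K[3]}.
Implicit Types (f g h p : S).

Definition grad f : 'I_3 -> S := fun i => f^`M(i).
Definition syz f (r : 'I_3 -> S) := dot r (grad f) = 0.

Lemma field_mul rho f g :
  dot rho (grad (f * g)) = dot rho (grad f) * g + f * dot rho (grad g).
Proof. by rewrite !dotE /grad !mderivM; ring. Qed.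

Lemma field_scale rho (c : K) f : dot rho (grad (c *: f)) = c *: dot rho (grad f).
Proof. by rewrite !dotE /grad !mderivZ -!mul_mpolyC; ring. Qed.

Lemma field_const rho (c : K) : dot rho (grad c%:MP) = 0.
Proof. by rewrite dotE /grad !mderivC !mulr0 !addr0. Qed.

Lemma field_prod0 rho (s : seq S) : (forall g, g \in s -> dot rho (grad g) = 0) ->
  dot rho (grad (\prod_(g <- s) g)) = 0.
Proof.
elim: s => [|g s IH] H; first by rewrite big_nil -(mpolyC1 3) field_const.
rewrite big_cons field_mul H ?mem_head // IH ?mul0r ?mulr0 ?addr0 // => h hs.
by apply: H; rewrite inE hs orbT.
Qed.

Lemma mulX_deriv (m : 'X_{1..3}) i : 'X_i * ('X_[K,m])^`M(i) = (m i)%:R *: 'X_[m].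
Proof.
rewrite mderivX -scalerAr; have [->|mi] := eqVneq (m i) 0%N; first by rewrite !scale0r.
rewrite -mpolyXD addmC submK //; apply/mnm_lepP => j; rewrite mnm1E.
by case: eqVneq => // <-; rewrite lt0n.
Qed.

Lemma euler d f : f \is d.-homog -> dot (fun i => 'X_i) (grad f) = d%:R *: f.
Proof.
move=> /dhomogP hf; rewrite /dot /grad [in LHS](mpolyE f) [in RHS](mpolyE f) scaler_sumr.
rewrite (eq_bigr (fun i => \sum_(m <- msupp f) f@_m *: ((m i)%:R *: 'X_[m]))).
  rewrite exchange_big /= big_seq [RHS]big_seq; apply: eq_bigr => m mf.
  rewrite -scaler_sumr -scaler_suml scalerA [RHS]scalerA mulrC; congr (_ * _ *: _).
  by rewrite -natr_sum -mdegE (hf _ mf).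
move=> i _; rewrite (raddf_sum (mderiv i)) mulr_sumr; apply: eq_bigr => m _.
by rewrite /= mderivZ -scalerAr mulX_deriv.
Qed.

Lemma deriv_homog d f i : f \is d.-homog -> f^`M(i) \is (d.-1).-homog.
Proof.
move=> hf; apply/dhomogP => m; rewrite mcoeff_msupp mcoeff_deriv => h.
have : f@_(m + U_(i)) != 0 by apply: contraNneq h => ->; rewrite mul0rn.
by rewrite -mcoeff_msupp => /(dhomog_mf hf); rewrite /= mdegD mdeg1 addn1 => <-.
Qed.

Lemma deriv_eq0_const p : (forall i, p^`M(i) = 0) -> exists c, p = c%:MP.
Proof.
move=> h; exists p@_0%MM; apply/mpolyP => m; rewrite mcoeffC.
have [->|m0] := eqVneq m 0%MM; first by rewrite mulr1.
rewrite mulr0; have [i mi] : exists i, m i != 0%N.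
  apply/existsP; rewrite -negb_forall; apply: contra m0 => /forallP H.
  by apply/eqP/mnmP => i; rewrite mnm0E; apply/eqP.
have := congr1 (mcoeff (m - U_(i))%MM) (h i); rewrite mcoeff_deriv mcoeff0 submK; last first.
  by apply/mnm_lepP => j; rewrite mnm1E; case: eqVneq => // <-; rewrite lt0n.
by move/eqP; rewrite mulrn_eq0 /= => /eqP.
Qed.

Lemma msize_deriv p i : p != 0 -> (msize (p^`M(i)) < msize p)%N.
Proof.
move=> p0; rewrite (mpolySpred mdeg p0) ltnS msizeE; apply/bigmax_leqP_seq => m mi _.
move: mi; rewrite mcoeff_msupp mcoeff_deriv => h.
have : p@_(m + U_(i)) != 0 by apply: contraNneq h => ->; rewrite mul0rn.
rewrite -mcoeff_msupp => /msize_mdeg_lt; rewrite mdegD mdeg1 addn1.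
by case: (msize p).
Qed.

Lemma dvdr_msize p g : dvdr p g -> g != 0 -> (msize p <= msize g)%N.
Proof.
case=> c ->; rewrite mulf_eq0 negb_or => /andP[p0 c0]; rewrite msizeM //.
by rewrite (mpolySpred mdeg c0) addnS leq_addr.
Qed.

(** A nonzero derivative has smaller degree than [p]. *)
Lemma dvdr_deriv p : p != 0 -> p \isn't a GRing.unit -> exists i, ~ dvdr p (p^`M(i)).
Proof.
move=> p0 pU; apply: NNPP => H.
have [|c cE] := @deriv_eq0_const p.
  move=> i; apply/eqP; apply: contraT => di.
  have dv : dvdr p (p^`M(i)) by apply: NNPP => nd; apply: H; exists i.
  by have := msize_deriv i p0; rewrite ltnNge dvdr_msize.
case/negP: pU; apply/unitrP; exists (c^-1)%:MP.
have c0 : c != 0 by rewrite -(mpolyC_eq0 3) -cE.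
by rewrite cE -!mpolyCM mulVf // mulfV.
Qed.

(** A prime [p] which divides all the derivatives divides [f = p * h] by Euler's
    relation. Then it divides all the products of [h] with a derivative of [p],
    hence [h], and [f] is divisible by the square of [p]. *)
Lemma grad_primitive d f : (0 < d)%N -> f \is d.-homog -> reduced_poly f -> primitive (grad f).
Proof.
move=> d0 hf [f0 fr].
have dn0 : (d%:R : K) != 0 by rewrite pnatr_eq0 -lt0n.
split.
  apply: exists_neq0 => gf.
  case/negP: f0; have := euler hf; rewrite dotE !gf !mulr0 !addr0 => /esym/eqP.
  by rewrite scaler_eq0 (negPf dn0).
move=> p [p0 pU pP]; apply: NNPP => H.
have pd i : dvdr p (f^`M(i)) by apply: NNPP => nd; apply: H; exists i.
have [h fE] : dvdr p f.
  have := euler hf; rewrite -mul_mpolyC => e.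
  have -> : f = (d%:R^-1)%:MP * ((d%:R)%:MP * f) by rewrite mulrA -mpolyCM mulVf // mul1r.
  by rewrite -e /dot; apply: dvdr_mull; apply: dvdr_sum => i _; apply: dvdr_mull; apply: pd.
have [i ni] := dvdr_deriv p0 pU.
case: (pP (p^`M(i)) h) => [|//|[h' h'E]].
  have -> : p^`M(i) * h = f^`M(i) - p * h^`M(i) by rewrite fE mderivM addrK.
  by apply: dvdrB => //; exists (h^`M(i)).
by case/negP: pU; apply: (fr p h'); rewrite fE h'E expr2 mulrA.
Qed.

(** Both [r] and [s] are orthogonal to the gradient, so that [cross r s] is parallel
    to it, and the gradient is primitive. *)
Lemma syz_cross d f r s : (0 < d)%N -> f \is d.-homog -> reduced_poly f ->
  syz f r -> syz f s -> exists h, forall i, cross r s i = h * f^`M(i).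
Proof.
move=> d0 hf fr hr hs; apply: (primitive_parallel (grad_primitive d0 hf fr)) => i.
by rewrite triple_cross hr hs !mul0r subrr.
Qed.

(** Homogeneous components let every identity that is linear in an unknown form be
    restricted to one degree. *)
Lemma pihomogM d k g h : g \is d.-homog -> pihomog mdeg (k + d) (h * g) = pihomog mdeg k h * g.
Proof.
move=> hg; rewrite [in LHS](mpolyE h) [in RHS](mpolyE h) mulr_suml !raddf_sum mulr_suml /=.
apply: eq_bigr => m _; rewrite -scalerAl !linearZ /= -scalerAl; congr (_ *: _).
have hX : 'X_[K,m] * g \is (mdeg m + d).-homog by apply: dhomogM => //; rewrite dhomogX.
rewrite pihomogX; case: eqP => [<-|/eqP ne]; first by rewrite pihomog_dE.
by rewrite (pihomog_ne0 _ hX) ?eqn_add2r // mul0r.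
Qed.
End Euler.

(** * The Bourbaki ideal and the Hilbert function of the Jacobian ideal *)

Section JacobianSyzygies.
Variable K : numFieldType.
Local Notation S := {mpoly K[3]}.
Local Notation V k := (dhomog 3 K k).
Local Notation T k := {ffun 'I_3 -> dhomog 3 K k}.

Lemma linear_hom (aT rT : vectType K) (f : aT -> rT) : linear f ->
  exists F : 'Hom(aT, rT), forall x, F x = f x.
Proof.
move=> lf; pose f' : {linear aT -> rT} :=
  HB.pack_for {linear aT -> rT} f (GRing.isLinear.Build K aT rT _ f lf).
by exists (linfun f') => x; rewrite lfunE.
Qed.

Lemma to_homog k (p : S) : p \is k.-homog -> exists v : V k, (v : S) = p.
Proof. by move=> h; exists (DHomog h). Qed.

Lemma dim_homog k : \dim {: V k} = 'C(k + 2, k).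
Proof. by rewrite dimvf. Qed.

Lemma dim_triple k : \dim {: T k} = (3 * 'C(k + 2, k))%N.
Proof. by rewrite dimvf /dim /= card_ord. Qed.

Lemma indhomogE k (p : S) : p \is k.-homog -> (indhomog k p : S) = p.
Proof. by move=> h; rewrite /indhomog insubdK. Qed.

(** Representatives of a basis of the quotient span a complement of [J]. *)
Lemma hilbert_dim gens n t (J : {vspace V n}) :
    (forall h : V n, h \in J <-> ideal_gen gens (h : S)) ->
  (hilbert_value gens n t <-> (\dim J + t = 'C(n + 2, n))%N).
Proof.
move=> JP; have aux (u : 'I_t -> V n) (v : V n) (c : 'I_t -> K) :
    ideal_gen gens ((v : S) - \sum_i mpolyC 3 (c i) * (u i : S)) <-> v - \sum_i c i *: u i \in J.
  suff -> : (v : S) - \sum_i mpolyC 3 (c i) * (u i : S) = (v - \sum_i c i *: u i : V n).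
    by split => /JP.
  rewrite (raddfB (@mpoly_of_dhomog 3 K n)) (raddf_sum (@mpoly_of_dhomog 3 K n)) /=. congr (_ - _); apply: eq_bigr => k _.
  by rewrite mul_mpolyC.
split=> [[e [eV eU]]|].
  pose E := [tuple (DHomog (eV i)) | i < t].
  have EE (i : 'I_t) : E`_i = DHomog (eV i) by rewrite -tnth_nth tnth_mktuple.
  have {}eU (v : V n) : exists! c : {ffun 'I_t -> K}, v - \sum_i c i *: E`_i \in J.
    have [c [c1 c2]] := eU v (dhomog_is_dhomog v).
    have aux' (c' : {ffun 'I_t -> K}) :
      ideal_gen gens ((v : S) - \sum_i mpolyC 3 (c' i) * e i) <-> v - \sum_i c' i *: E`_i \in J.
      rewrite -(aux (fun i => E`_i)); under [in X in _ <-> X]eq_bigr do rewrite EE.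
      by [].
    by exists c; split=> [|c' /aux' /c2 //]; apply/aux'.
  have uniq0 (k : 'I_t -> K) : \sum_i k i *: E`_i \in J -> forall i, k i = 0.
    move=> kJ i; have [c [_ c2]] := eU 0.
    have e0 : c = [ffun=> 0].
      by apply: c2; rewrite sub0r rpredN big1 ?mem0v // => l _; rewrite ffunE scale0r.
    have : c = [ffun l => k l].
      by apply: c2; rewrite sub0r rpredN; under eq_bigr do rewrite ffunE.
    by rewrite e0 => /ffunP /(_ i); rewrite !ffunE.
  have fE : free E.
    by apply/freeP => k k0; apply: uniq0; rewrite k0 mem0v.
  have dj : (J :&: <<E>> = 0)%VS.
    apply/eqP; rewrite -subv0; apply/subvP => v /memv_capP [vJ vE].
    rewrite memv0 (coord_span vE) big1 // => i _.
    by rewrite (uniq0 (coord E ^~ v)) ?scale0r // -coord_span.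
  have <- : \dim <<E>> = t by rewrite (eqP fE) size_tuple.
  rewrite -dimv_disjoint_sum // -dim_homog; congr (\dim _).
  apply/vspaceP => v; rewrite memvf; have [c [c1 _]] := eU v.
  rewrite -(subrK (\sum_i c i *: E`_i) v) memv_add // rpred_sum // => i _.
  by rewrite rpredZ // memv_span // mem_nth // size_tuple.
rewrite -dim_homog => dt.
have {dt} tE : t = \dim (J^C)%VS by rewrite dimv_compl -dt addKn.
subst t; pose E := vbasis (J^C)%VS.
exists (fun i => (E`_i : S)); split=> [i|v vn]; first exact: dhomog_is_dhomog.
have aux' (c : {ffun 'I__ -> K}) := aux (fun i => E`_i) (DHomog vn) c.
have : DHomog vn \in (J + J^C)%VS by rewrite addv_complf memvf.
case/memv_addP => v1 v1J [v2 v2J vE].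
exists [ffun i => coord E i v2]; split.
  apply/(aux' [ffun i => coord E i v2]); rewrite vE.
  under eq_bigr do rewrite ffunE.
  by rewrite -(coord_vbasis v2J) addrK.
move=> c /(aux' c); rewrite vE => cJ; apply/ffunP => i; rewrite ffunE.
have : v2 - \sum_i c i *: E`_i \in (J :&: J^C)%VS.
  apply/memv_capP; split; first by move: cJ; rewrite -addrA rpredDl.
  rewrite rpredB // rpred_sum // => j _; rewrite rpredZ // vbasis_mem // mem_nth //.
  by rewrite size_tuple.
rewrite capv_compl memv0 subr_eq0 => /eqP ->.
by rewrite coord_sum_free // (basis_free (vbasisP _)).
Qed.

Lemma jacobian_idealP (f h : S) : ideal_gen (jacobian_gens f) h <->
  exists c, h = dot c (grad f).
Proof.
have E : jacobian_gens f = [:: f^`M(0); f^`M(1); f^`M(2)].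
  rewrite /jacobian_gens /image_mem !enum_ordSl /= (size0nil (size_enum_ord 0)) /=.
  by congr [:: _^`M(_); _^`M(_); _^`M(_)]; apply: val_inj.
rewrite /ideal_gen E; split=> [[c ->]|[c ->]]; exists c; rewrite sum3 dotE //.
Qed.

(** The map from syzygies [s] to forms [h] has the multiples of [r] as its kernel
    when [r] is primitive. Its image is the Bourbaki ideal of [r]. *)
Definition bourbaki (f : S) (r : 'I_3 -> S) (h : S) :=
  exists2 s, syz f s & forall i, cross r s i = h * f^`M(i).

Definition vec k (t : T k) : 'I_3 -> S := fun i => (t i : S).

Lemma to_triple k (u : 'I_3 -> S) : (forall i, u i \is k.-homog) ->
  exists t : T k, forall i, vec t i = u i.
Proof. by move=> hu; exists [ffun i => DHomog (hu i)] => i; rewrite /vec ffunE. Qed.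

Lemma vec_inj k (s t : T k) : vec s =1 vec t -> s = t.
Proof. by move=> h; apply/ffunP => i; apply: val_inj; apply: h. Qed.

Lemma vec_homog k (t : T k) i : vec t i \is k.-homog.
Proof. exact: dhomog_is_dhomog. Qed.

Lemma vecP k c (s t : T k) i : vec (c *: s + t) i = c *: vec s i + vec t i.
Proof. by rewrite /vec !ffunE. Qed.

Lemma form_hom (aT : vectType K) n (F : aT -> S) :
    (forall c u v, F (c *: u + v) = c *: F u + F v) -> (forall u, F u \is n.-homog) ->
  exists H : 'Hom(aT, V n), forall u, (H u : S) = F u.
Proof.
move=> lF hF; have lin : linear (fun u => indhomog n (F u)).
  by move=> c u v; apply: val_inj; rewrite [LHS]indhomogE //= !indhomogE // lF.
by have [H HE] := linear_hom lin; exists H => u; rewrite HE indhomogE.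
Qed.

Lemma triple_hom (aT : vectType K) n (F : aT -> 'I_3 -> S) :
    (forall c u v i, F (c *: u + v) i = c *: F u i + F v i) -> (forall u i, F u i \is n.-homog) ->
  exists H : 'Hom(aT, T n), forall u i, vec (H u) i = F u i.
Proof.
move=> lF hF; have E u i : (indhomog n (F u i) : S) = F u i by rewrite indhomogE.
have lin : linear (fun u => [ffun i => indhomog n (F u i)]).
  by move=> c u v; apply: vec_inj => i; rewrite vecP /vec !ffunE !E lF.
by have [H HE] := linear_hom lin; exists H => u i; rewrite HE /vec ffunE E.
Qed.

(** Two exact sequences are compared in degree [j]: the syzygies are the kernel of
    the map from triples of forms onto the Jacobian ideal, and [cross rho] maps them
    onto the Bourbaki ideal with kernel the multiples of [rho]. The space [U] is
    the part of the Bourbaki ideal in the corresponding degree. *)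
Lemma bourbaki_dim d f r (rho : 'I_3 -> S) j : (0 < d)%N -> f \is d.-homog ->
  reduced_poly f -> primitive rho -> (forall i, rho i \is r.-homog) -> syz f rho ->
  (r <= j)%N -> (d.-1 <= j + r)%N ->
  exists U : {vspace V (j + r - d.-1)},
    (forall h, h \in U <-> bourbaki f rho h) /\
    (forall t, hilbert_value (jacobian_gens f) (j + d.-1) t <->
      3 * 'C(j + 2, j) + t = 'C(j - r + 2, j - r) + \dim U + 'C(j + d.-1 + 2, j + d.-1))%N.
Proof.
move=> d0 hf fr rP rh rs rj dj.
have gh i : grad f i \is (d.-1).-homog by apply: deriv_homog.
have dotl (w : 'I_3 -> S) c u v : dot (fun i => c *: u i + v i) w = c *: dot u w + dot v w.
  by rewrite !dotE -!mul_mpolyC; ring.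
have eqdot (u v w : 'I_3 -> S) : u =1 v -> dot u w = dot v w.
  by move=> h; rewrite !dotE !h.
have dot_homog (u : 'I_3 -> S) : (forall i, u i \is j.-homog) -> dot u (grad f) \is (j + d.-1).-homog.
  by move=> hu; apply: rpred_sum => i _; apply: dhomogM.
(* The image of [L] is the Jacobian ideal and its kernel consists of the syzygies. *)
have [L LE] : exists L : 'Hom(T j, V (j + d.-1)), forall t, (L t : S) = dot (vec t) (grad f).
  apply: form_hom => [c u v|u]; last by apply: dot_homog; apply: vec_homog.
  by rewrite -dotl; apply: eqdot => i; rewrite vecP.
(* [C] is the vector product with [rho]; [M] and [G] embed forms as multiples of
[rho] and of the gradient. *)
have [C CE] : exists C : 'Hom(T j, T (j + r)), forall t i, vec (C t) i = cross rho (vec t) i.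
  apply: triple_hom => [c u v i|u i]; first by rewrite /cross !vecP -!mul_mpolyC; ring.
  by rewrite addnC rpredB // dhomogM // vec_homog.
have [M ME] : exists M : 'Hom(V (j - r), T j), forall h i, vec (M h) i = (h : S) * rho i.
  apply: triple_hom => [c u v i|h i]; first by rewrite /= mulrDl scalerAl.
  by rewrite -{2}(subnK rj) dhomogM // dhomog_is_dhomog.
set k := (j + r - d.-1)%N.
have kE : (k + d.-1 = j + r)%N by rewrite subnK.
have [G GE] : exists G : 'Hom(V k, T (j + r)), forall h i, vec (G h) i = (h : S) * f^`M(i).
  apply: triple_hom => [c u v i|h i]; first by rewrite /= mulrDl scalerAl.
  by rewrite -kE dhomogM // ?dhomog_is_dhomog // (gh i).
have kerL t : t \in lker L <-> syz f (vec t).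
  rewrite memv_ker /syz -LE; split=> [/eqP -> //|e]; exact/eqP/val_inj.
have [[i0 ri0] _] := rP.
have kerM : lker M == 0%VS.
  apply/lker0P => u v e; apply: val_inj; apply: (mulIf ri0).
  by rewrite -[LHS]ME e ME.
have [[i1 gi1] _] := grad_primitive d0 hf fr.
have kerG : lker G == 0%VS.
  apply/lker0P => u v e; apply: val_inj; apply: (mulIf gi1).
  by rewrite -[LHS]GE e GE.
have kerC : (lker L :&: lker C)%VS = limg M.
  apply/vspaceP => t; apply/memv_capP/memv_imgP => [[_]|[c _ ->]].
    rewrite memv_ker => /eqP Ct0.
    have [|c cE] := @primitive_parallel _ (vec t) rho rP.
      move=> i; have := CE t i; rewrite Ct0 [X in X = _]/vec ffunE => e.
      have -> : cross (vec t) rho i = - cross rho (vec t) i by rewrite /cross; ring.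
      by rewrite -e oppr0.
    have [c' c'E] := to_homog (pihomogP mdeg (j - r) c).
    exists c'; rewrite ?memvf //; apply: vec_inj => i; rewrite ME c'E.
    by rewrite -(pihomogM (j - r) c (rh i)) subnK // -cE pihomog_dE // vec_homog.
  split; last first.
    rewrite memv_ker; apply/eqP; apply: vec_inj => i; rewrite CE [RHS]/vec ffunE /=.
    by elim/ord3P: i; rewrite !crossE !ME; ring.
  apply/kerL; rewrite /syz dotE !ME -!mulrA -!mulrDr -dotE.
  by rewrite [dot _ _]rs mulr0.
have imC : (C @: lker L <= limg G)%VS.
  apply/subvP => _ /memv_imgP [t /kerL ts ->].
  have [h hE] := syz_cross d0 hf fr rs ts.
  have [h' h'E] := to_homog (pihomogP mdeg k h).
  apply/memv_imgP; exists h'; rewrite ?memvf //; apply: vec_inj => i.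
  rewrite GE h'E -(pihomogM k h (gh i)) kE /grad -hE CE pihomog_dE //.
  by rewrite addnC rpredB // dhomogM // vec_homog.
exists (G @^-1: (C @: lker L))%VS; split=> [h|t].
  rewrite -memv_preim; split.
    move=> /memv_imgP [t /kerL ts e]; exists (vec t) => // i.
    by rewrite -CE -e GE.
  move=> [s ss sE]; have [t tE] := to_triple (fun i => pihomogP mdeg j (s i)).
  apply/memv_imgP; exists t.
    apply/kerL; rewrite /syz (eqdot _ _ _ tE) /dot.
    rewrite (eq_bigr (fun i => pihomog mdeg (j + d.-1) (s i * grad f i))).
      by rewrite -raddf_sum -/(dot s (grad f)) [dot _ _]ss raddf0.
    by move=> i _; rewrite pihomogM.
  apply: vec_inj => i; rewrite GE CE.
  have hk : (h : S) * f^`M(i) \is (j + r).-homog.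
    by rewrite -kE dhomogM // ?dhomog_is_dhomog // (gh i).
  have pr a b : pihomog mdeg (j + r) (rho a * s b) = rho a * pihomog mdeg j (s b).
    by rewrite mulrC pihomogM // mulrC.
  by rewrite -(pihomog_dE hk) -sE /cross !tE raddfB /= !pr.
have dimU : \dim (G @^-1: (C @: lker L)) = \dim (C @: lker L)%VS.
  by rewrite -(lpreimK imC) limg_dim_eq ?lpreimK // (eqP kerG) capv0.
have dM : \dim (limg M) = 'C(j - r + 2, j - r).
  by rewrite limg_dim_eq ?dim_homog // (eqP kerM) capv0.
have d1 := limg_ker_dim C (lker L); rewrite kerC dM -dimU in d1.
have d2 := limg_ker_dim L fullv; rewrite capfv dim_triple in d2.
rewrite (@hilbert_dim _ _ t (limg L)).
  move: d1 d2; move: (\dim (limg L)) (\dim (lker L)) (\dim (G @^-1: _)) => a b c.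
  by move: ('C(j + 2, j)) ('C(_, j - r)) ('C(_, j + d.-1)) => *; split; lia.
move=> h; rewrite jacobian_idealP; split.
  by move=> /memv_imgP [s _ ->]; exists (vec s); rewrite LE.
move=> [c cE]; have [s sE] := to_triple (fun i => pihomogP mdeg j (c i)).
apply/memv_imgP; exists s; rewrite ?memvf //; apply: val_inj; rewrite /= LE.
rewrite (eqdot _ _ _ sE) -(pihomog_dE (dhomog_is_dhomog h)).
have -> : pihomog mdeg (j + d.-1) h = pihomog mdeg (j + d.-1) (dot c (grad f)) by congr pihomog.
rewrite /dot (raddf_sum (pihomog mdeg (j + d.-1))).
by apply: eq_bigr => i _; rewrite /= pihomogM.
Qed.

(** * The Tjurina number and the codimension of the Bourbaki ideal *)

Lemma bin_plane k : ('C(k + 2, k) * 2 = (k + 1) * (k + 2))%N.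
Proof.
have -> : 'C(k + 2, k) = 'C(k + 2, 2) by rewrite -{2}(addnK 2 k) bin_sub // leq_addl.
by rewrite bin2 muln2 even_halfK ?oddM !addn2 /= ?negbK ?andbN // addn1 mulnC.
Qed.

Implicit Types (f g h p q : S) (rho : 'I_3 -> S).

Record syz_data d f r rho : Prop := SyzData {
  sd_pos : (0 < d)%N; sd_hom : f \is d.-homog; sd_red : reduced_poly f;
  sd_primitive : primitive rho; sd_rhom : forall i, rho i \is r.-homog; sd_syz : syz f rho }.

(** The number (d - 1)^2 - r (d - 1 - r) is what the Hilbert functions of the
    polynomial ring contribute; the codimension of the Bourbaki ideal is the
    defect. *)
Lemma bourbaki_codim d f r rho j : syz_data d f r rho ->
  (r <= d.-1)%N -> (d.-1 <= j)%N ->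
  exists U : {vspace V (j + r - d.-1)},
    [/\ forall v : V _, v \in U <-> bourbaki f rho (v : S),
        (\dim U <= 'C(j + r - d.-1 + 2, j + r - d.-1))%N &
    forall t, hilbert_value (jacobian_gens f) (j + d.-1) t <->
      (t + ('C(j + r - d.-1 + 2, j + r - d.-1) - \dim U) + r * (d.-1 - r) = d.-1 ^ 2)%N].
Proof.
move=> [d0 hf fr rP rh rs] rd dj.
have rj : (r <= j)%N by apply: leq_trans dj.
have dj' : (d.-1 <= j + r)%N by apply: leq_trans dj (leq_addr _ _).
have [U [UP UH]] := bourbaki_dim d0 hf fr rP rh rs rj dj'.
have leU : (\dim U <= 'C(j + r - d.-1 + 2, j + r - d.-1))%N.
  by rewrite -(dim_homog) dimvS ?subvf.
exists U; split=> // t; rewrite UH.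
move: (\dim U) leU => u {UP UH U}.
move: (bin_plane j) (bin_plane (j - r)) (bin_plane (j + d.-1)) (bin_plane (j + r - d.-1)).
have [e ->] : exists e, j = (e + d.-1)%N by exists (j - d.-1)%N; rewrite subnK.
have [c dE] : exists c, d.-1 = (c + r)%N by exists (d.-1 - r)%N; rewrite subnK.
rewrite dE.
have -> : (e + (c + r) + r - (c + r) = e + r)%N by lia.
have -> : (e + (c + r) - r = e + c)%N by lia.
have -> : (c + r - r = c)%N by lia.
move: ('C(_, e + r)) ('C(_, e + c)) ('C(_, e + (c + r))) ('C(_, e + (c + r) + (c + r))).
move=> a b a' b'; rewrite -mulnn => H2 H3 H4 H5 H1.
have H : (2 * (b + a + b') = 2 * (3 * a' + c * c + c * r + r * r))%N by lia.
split=> E; lia.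
Qed.

Lemma codim_tjurina d f r rho t : syz_data d f r rho -> (r <= d.-1)%N ->
  (forall k, exists U : {vspace V k}, (forall v : V _, v \in U <-> bourbaki f rho (v : S)) /\
     (t + ('C(k + 2, k) - \dim U) + r * (d.-1 - r) = d.-1 ^ 2)%N) ->
  total_tjurina f t.
Proof.
move=> sd rd H; exists (d.-1 + d.-1)%N => n nN.
have dn : (d.-1 <= n)%N by apply: leq_trans nN; rewrite leq_addr.
have dj : (d.-1 <= n - d.-1)%N by rewrite leq_subRL.
have [U [UP leU UH]] := bourbaki_codim sd rd dj.
rewrite -(subnK dn); apply/UH.
have [U' [UP' <-]] := H (n - d.-1 + r - d.-1)%N.
suff -> : U = U' by [].
by apply/vspaceP => h; apply/idP/idP => [/UP/UP'|/UP'/UP].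
Qed.

Lemma tjurina_codim d f r rho t : syz_data d f r rho -> (r <= d.-1)%N -> total_tjurina f t ->
  exists N, forall k, (N <= k)%N -> exists U : {vspace V k},
    (forall v : V _, v \in U <-> bourbaki f rho (v : S)) /\
     (t + ('C(k + 2, k) - \dim U) + r * (d.-1 - r) = d.-1 ^ 2)%N /\
     (\dim U <= 'C(k + 2, k))%N.
Proof.
move=> sd rd [N0 H]; exists (N0 + d.-1)%N => k kN.
have dj : (d.-1 <= k + (d.-1 - r) - (d.-1 - r) + (d.-1 - r))%N by lia.
have dj' : (d.-1 <= k + (d.-1 - r))%N by lia.
have [U [UP leU UH]] := bourbaki_codim sd rd dj'.
have E : (k + (d.-1 - r) + r - d.-1 = k)%N by lia.
move: U UP leU UH; rewrite E => U UP leU UH.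
exists U; split=> //; split=> //; apply/UH/H; lia.
Qed.

Lemma bourbakiM f rho g h : bourbaki f rho h -> bourbaki f rho (g * h).
Proof.
move=> [s ss sE]; exists (fun i => g * s i).
  by move: ss; rewrite /syz !dotE -!mulrA -!mulrDr => ->; rewrite mulr0.
by move=> i; rewrite -mulrA -sE /cross; ring.
Qed.

Lemma bourbakiD f rho g h : bourbaki f rho g -> bourbaki f rho h -> bourbaki f rho (g + h).
Proof.
move=> [s ss sE] [t tt tE]; exists (fun i => s i + t i).
  have : dot s (grad f) + dot t (grad f) = 0 by rewrite ss tt addr0.
  by rewrite /syz !dotE => <-; ring.
by move=> i; rewrite mulrDl -sE -tE /cross; ring.
Qed.

Lemma bourbakiZ f rho (c : K) h : bourbaki f rho h -> bourbaki f rho (c *: h).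
Proof. by rewrite -mul_mpolyC; apply: bourbakiM. Qed.

Lemma tjurina_bourbaki1 d f r rho t : syz_data d f r rho -> (r <= d.-1)%N ->
  total_tjurina f t -> bourbaki f rho 1 -> (t + r * (d.-1 - r) = d.-1 ^ 2)%N.
Proof.
move=> sd rd /(tjurina_codim sd rd) [N /(_ N (leqnn N)) [U [UP [<- _]]]] b1.
have -> : U = fullv.
  by apply/vspaceP => h; rewrite memvf; apply/UP; rewrite -[h : S]mulr1; apply: bourbakiM.
by rewrite dim_homog subnn addn0.
Qed.

Lemma dim_vanishing k (P : 'I_3 -> K) (U : {vspace V k}) : is_pt P ->
  (forall h : V k, h \in U <-> (h : S).@[P] = 0) -> ('C(k + 2, k) - \dim U = 1)%N.
Proof.
move=> [i Pi] UP.
have lin : linear (fun h : V k => ((h : S).@[P] : K^o)) by move=> c u v; rewrite /= mevalD mevalZ.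
have [H HE] := linear_hom lin.
have -> : U = lker H.
  apply/vspaceP => h; rewrite memv_ker HE; apply/idP/idP => [/UP ->|/eqP ?] //; exact/UP.
have := limg_ker_dim H fullv; rewrite capfv dim_homog => <-.
rewrite addnC addnK; apply/eqP; rewrite eqn_leq; apply/andP; split.
  by apply: leq_trans (dimvS (subvf _)) _; rewrite dimvf.
rewrite lt0n dimv_eq0; apply/eqP => e.
have [v vE] : exists v : V k, (v : S) = 'X_i ^+ k.
  apply: to_homog; have X1 : ('X_i : S) \is 1.-homog by rewrite dhomogX; apply/eqP/mdeg1.
  by have := dhomogMn k X1; rewrite mul1n.
have : H v \in (limg H) by rewrite memv_img // memvf.
rewrite e memv0 HE vE rmorphXn /= mevalXU expf_eq0 (negPf Pi) andbF //.
Qed.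

Definition free_of e i (p : S) := forall m, p@_m != 0 -> (m i < e)%N.

Lemma mcoeff_Xn_mul e i p (m : 'X_{1..3}) : (m i < e)%N -> ('X_i ^+ e * p)@_m = 0.
Proof.
move=> lt; apply: memN_msupp_eq0; apply: contraTN lt.
rewrite mpolyXn mulrC (perm_mem (msuppMX _ _)) => /mapP [m' _ ->].
by rewrite mnmDE mulmnE mnm1E eqxx mul1n -leqNgt leq_addr.
Qed.

Lemma mcoeff_Xn_shift e i p (m : 'X_{1..3}) : ('X_i ^+ e * p)@_(m + U_(i) *+ e)%MM = p@_m.
Proof. by rewrite mpolyXn mulrC addmC mcoeffMX. Qed.

Lemma split_free e i p : exists p1 p2,
  [/\ p = p1 + 'X_i ^+ e * p2, free_of e i p1 & forall m, p1@_m != 0 -> p1@_m = p@_m].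
Proof.
pose p1 := \sum_(m <- msupp p | (m i < e)%N) p@_m *: 'X_[m].
pose p2 := \sum_(m <- msupp p | ~~ (m i < e)%N) p@_m *: 'X_[m - U_(i) *+ e].
have c1 m : p1@_m = if (m i < e)%N then p@_m else 0.
  rewrite /p1 raddf_sum /=.
  have [mp|mp] := boolP (m \in msupp p); last first.
    rewrite (memN_msupp_eq0 mp) if_same big_seq_cond big1 // => m' /andP[m'p _].
    by rewrite mcoeffZ mcoeffX; case: eqP m'p mp => [-> ->|] //; rewrite mulr0.
  rewrite big_mkcond (bigD1_seq m) //= mcoeffZ mcoeffX eqxx mulr1 big1 ?addr0 //.
  move=> m' ne; case: ifP => // _.
  by rewrite mcoeffZ mcoeffX (negPf ne) mulr0.
exists p1, p2; split.
- rewrite [LHS]mpolyE (bigID (fun m : 'X_{1..3} => (m i < e)%N)) /=; congr (_ + _).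
  rewrite mulr_sumr; apply: eq_bigr => m; rewrite -leqNgt => le.
  rewrite -scalerAr mpolyXn -mpolyXD addmC submK //.
  by apply/mnm_lepP => l; rewrite mulmnE mnm1E; case: eqVneq => [<-|]; rewrite ?mul1n.
- by move=> m; rewrite c1; case: ifP => //; rewrite eqxx.
by move=> m; rewrite c1; case: ifP => //; rewrite eqxx.
Qed.

(** The powers of two different variables are coprime: no monomial of the part of
    [p] free of the power of 'X_i can occur on the right. *)
Lemma dvd_Xn e i j p q : i != j -> 'X_j ^+ e * p = 'X_i ^+ e * q -> exists p', p = 'X_i ^+ e * p'.
Proof.
move=> ij E; have [p1 [p2 [pE fp _]]] := split_free e i p.
exists p2; rewrite pE -[RHS]add0r; congr (_ + _); apply/mpolyP => m; rewrite mcoeff0.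
apply/eqP; apply: contraT => pm; have lt := fp _ pm.
have E1 : 'X_j ^+ e * p1 = 'X_i ^+ e * (q - 'X_j ^+ e * p2).
  by rewrite mulrBr -E pE; ring.
have := congr1 (mcoeff (m + U_(j) *+ e)%MM) E1; rewrite mcoeff_Xn_shift mcoeff_Xn_mul.
  by move=> e0; rewrite e0 eqxx in pm.
by rewrite mnmDE mulmnE mnm1E eq_sym (negPf ij) mul0n addn0.
Qed.

(** Exactness of the Koszul complex of the powers of the variables: a monomial of
    [c1] divisible by neither 'X_0 ^+ e nor 'X_1 ^+ e would survive in the
    left-hand side. *)
Lemma koszul_Xn e c1 c2 c3 : 'X_2 ^+ e * c1 = 'X_1 ^+ e * c2 - 'X_0 ^+ e * c3 ->
  exists a b : S, c1 = 'X_1 ^+ e * a - 'X_0 ^+ e * b.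
Proof.
move=> E; have [p1 [p2 [pE fp _]]] := split_free e 0 c1.
have [a1 [a2 [aE fa sub]]] := split_free e 1 p1.
exists a2, (- p2); rewrite pE aE.
suff -> : a1 = 0 by ring.
apply/mpolyP => m; rewrite mcoeff0; apply/eqP; apply: contraT => am.
have E1 : 'X_2 ^+ e * a1 = 'X_1 ^+ e * (c2 - 'X_2 ^+ e * a2)
        + 'X_0 ^+ e * (- c3 - 'X_2 ^+ e * p2).
  transitivity ('X_2 ^+ e * c1 - 'X_2 ^+ e * ('X_1 ^+ e * a2 + 'X_0 ^+ e * p2)).
    by rewrite pE aE; ring.
  by rewrite E; ring.
have := congr1 (mcoeff (m + U_(2) *+ e)%MM) E1.
rewrite mcoeff_Xn_shift mcoeffD !mcoeff_Xn_mul ?addr0.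
- by move=> e0; rewrite e0 eqxx in am.
- by rewrite mnmDE mulmnE mnm1E mul0n addn0; apply: fp; rewrite -sub.
by rewrite mnmDE mulmnE mnm1E mul0n addn0; apply: fa.
Qed.

(** Syzygies [u], [v], [w] over x^e h, y^e h, z^e h are compatible up to multiples
    c1, c2, c3 of [rho], which satisfy a Koszul relation. Correcting [u] by a
    multiple of [rho] makes it divisible by x^e, and the quotient lies over [h]. *)
Lemma bourbaki_saturated f rho h e : primitive rho ->
  (forall i, bourbaki f rho ('X_i ^+ e * h)) -> bourbaki f rho h.
Proof.
move=> rP H; have [u su uE] := H 0; have [v sv vE] := H 1; have [w sw wE] := H 2.
pose x : S := 'X_0 ^+ e; pose y : S := 'X_1 ^+ e; pose z : S := 'X_2 ^+ e.
have X0 (i : 'I_3) : 'X_i ^+ e != 0 :> S.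
  by rewrite expf_neq0 // -msize_poly_eq0 msizeX.
have par (a b : S) s t : (forall i, cross rho s i = a * h * f^`M(i)) ->
    (forall i, cross rho t i = b * h * f^`M(i)) ->
    exists c, forall i, b * s i - a * t i = c * rho i.
  move=> sE tE; apply: (primitive_parallel rP) => i.
  transitivity (a * cross rho t i - b * cross rho s i); first by rewrite /cross; ring.
  by rewrite sE tE; ring.
have [c1 E1] := par x y u v uE vE.
have [c2 E2] := par x z u w uE wE.
have [c3 E3] := par y z v w vE wE.
have [[i0 r0] _] := rP.
have E : z * c1 = y * c2 - x * c3.
  by apply: (mulIf r0); rewrite mulrBl -!mulrA -E1 -E2 -E3; ring.
have [a [b abE]] := koszul_Xn E.
have D i : exists s, u i - a * rho i = x * s.
  apply: (@dvd_Xn e 0 1 _ (v i - b * rho i)) => //.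
  rewrite -/x -/y; have := E1 i; rewrite abE -/x -/y => e1.
  by apply/eqP; rewrite -subr_eq0; apply/eqP; rewrite -[RHS](subrr (y * u i - x * v i)) {2}e1; ring.
have [s sE] := choice3 D.
have crE i : cross rho s i = h * f^`M(i).
  apply: (mulfI (X0 0)); rewrite -/x mulrA -uE.
  transitivity (cross rho (fun j => x * s j) i); first by rewrite /cross; ring.
  by rewrite /cross -!sE; ring.
have [h0|h0] := eqVneq h 0.
  exists (fun=> 0); first by rewrite /syz dotE !mul0r !addr0.
  by move=> i; rewrite /cross h0 !mulr0 mul0r subrr.
exists s => //; apply: (mulfI h0); rewrite mulr0 -[RHS](dot_crossr rho s) !dotE !crE /grad; ring.
Qed.

(** * The components of an arrangement and syzygies of low degree *)

Definition has_syz f k := exists rho,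
  [/\ forall i, rho i \is k.-homog, syz f rho & exists i, rho i != 0].

Lemma ex_min (P : nat -> Prop) n : P n -> exists m, [/\ (m <= n)%N, P m & forall k, (k < m)%N -> ~ P k].
Proof.
elim/ltn_ind: n => n IH Pn.
have [[k kn Pk]|no] := classic (exists2 k, (k < n)%N & P k).
  by have [m [mk Pm H]] := IH _ kn Pk; exists m; split=> //; apply: leq_trans mk (ltnW kn).
by exists n; split=> // k kn Pk; apply: no; exists k.
Qed.

Lemma homog_part_syz d f rho k : f \is d.-homog -> syz f rho ->
  syz f (fun i => pihomog mdeg k (rho i)).
Proof.
move=> hf rs; rewrite /syz /dot.
rewrite (eq_bigr (fun i => pihomog mdeg (k + d.-1) (rho i * grad f i))).
  by rewrite -raddf_sum -/(dot rho (grad f)) [dot _ _]rs raddf0.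
by move=> i _; rewrite pihomogM // deriv_homog.
Qed.

Lemma pihomog_lead p : p != 0 -> pihomog mdeg (msize p).-1 p != 0.
Proof.
move=> p0; have lp := mlead_deg p0; rewrite -lp /=.
have H : (pihomog mdeg (mdeg (mlead p)) p)@_(mlead p) = p@_(mlead p).
  rewrite pihomogE raddf_sum /= big_mkcond (bigD1_seq (mlead p)) ?mlead_supp //=.
  rewrite eqxx mcoeffZ mcoeffX eqxx mulr1 big1 ?addr0 // => m ne; case: ifP => // _.
  by rewrite mcoeffZ mcoeffX (negPf ne) mulr0.
by apply: contraTneq (mlead_supp p0) => e; rewrite mcoeff_msupp -H e mcoeff0 eqxx.
Qed.

Lemma homog_msize k p : p \is k.-homog -> p != 0 -> msize p = k.+1.
Proof.
by move=> hp p0; rewrite -(mlead_deg p0) -[in RHS](dhomog_mf hp (mlead_supp p0)).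
Qed.

Lemma nonunit_msize p : p != 0 -> p \isn't a GRing.unit -> (1 < msize p)%N.
Proof.
move=> p0 pU; rewrite ltnNge; apply: contra pU => /msize1_polyC pE.
have c0 : p@_0%MM != 0 by rewrite -(mpolyC_eq0 3) -pE.
by rewrite pE; apply/unitrP; exists ((p@_0%MM)^-1)%:MP; rewrite -!mpolyCM mulVf // mulfV.
Qed.

(** Dividing out a common prime factor would lower the degree; a homogeneous
    component of the quotient is again a syzygy. *)
Lemma min_syz_primitive d f k rho : f \is d.-homog -> (forall i, rho i \is k.-homog) ->
  syz f rho -> (exists i, rho i != 0) -> (forall l, (l < k)%N -> ~ has_syz f l) -> primitive rho.
Proof.
move=> hf hr rs [i0 r0] kmin; split; first by exists i0.
move=> p [p0 pU pP]; apply: NNPP => H.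
have pd i : exists s, rho i = p * s by apply: NNPP => nd; apply: H; exists i.
have [s sE] := choice3 pd.
have ss : syz f s.
  by apply: (mulfI p0); rewrite mulr0 -[RHS]rs !dotE !sE; ring.
have s0 : s i0 != 0 by apply: contraNneq r0; rewrite sE => ->; rewrite mulr0.
have e : msize (rho i0) = k.+1 by apply: homog_msize.
rewrite sE msizeM // in e; have p1 := nonunit_msize p0 pU.
have s1 : (0 < msize (s i0))%N by rewrite lt0n msize_poly_eq0.
apply: (kmin (msize (s i0)).-1); first by move: e p1 s1; move: (msize p) (msize (s i0)) => x y; lia.
exists (fun i => pihomog mdeg (msize (s i0)).-1 (s i)); split.
- by move=> i; apply: pihomogP.
- exact: homog_part_syz hf ss.
by exists i0; apply: pihomog_lead.
Qed.

Lemma prime_assoc p u : prime_el p -> u \is a GRing.unit -> prime_el (p * u).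
Proof.
move=> [p0 pU pP] uU; have u0 : u != 0 by apply: contraTneq uU => ->; rewrite unitr0.
have D a : dvdr p a -> dvdr (p * u) a.
  by case=> c ->; exists (u^-1 * c); rewrite mulrA mulrK.
split; first by rewrite mulf_neq0.
  by rewrite unitrM negb_and pU.
move=> a b [c cE]; case: (pP a b) => [|/D|/D]; try by [left|right].
by rewrite cE -mulrA; exists (u * c).
Qed.

Lemma irreducible_prime g : irreducible_mpoly g -> prime_el g.
Proof.
move=> [g0 gU gI]; have [s sP [u uU gE]] := factorial_mpoly g0.
case: s sP gE => [|p s] sP gE; first by rewrite gE big_nil mulr1 uU in gU.
have pP := sP _ (mem_head _ _); rewrite gE big_cons mulrCA.
apply: prime_assoc => //; rewrite big_cons mulrCA in gE.
by case: (gI _ _ gE) => // pU; case: pP; rewrite pU.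
Qed.

Lemma prime_irreducible p : prime_el p -> irreducible_mpoly p.
Proof.
move=> [p0 pU pP]; split=> // a b pE.
have [c cE] : dvdr p (a * b) by exists 1; rewrite mulr1 pE.
have H a' b' : p = a' * b' -> dvdr p a' -> b' \is a GRing.unit.
  move=> e [x xE]; apply/unitrP; exists x; suff e1 : b' * x = 1 by rewrite mulrC e1.
  by apply: (mulfI p0); rewrite mulr1 [RHS]e [in RHS]xE; ring.
case: (pP a b); first by exists 1; rewrite mulr1 pE.
  by move/(H _ _ pE); right.
have pE2 : p = b * a by rewrite mulrC.
by move/(H _ _ pE2); left.
Qed.

(** The components of [f]. Rearrangements of [s] express that no entry divides an
    entry at another position. *)
Definition decomp f (c : K) (s : seq S) :=
  [/\ c != 0, f = c *: \prod_(g <- s) g,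
      forall g, g \in s -> prime_el g /\ (is_line g \/ smooth_conic g) &
      forall g t, perm_eq s (g :: t) -> forall h, h \in t -> ~ dvdr g h].

Lemma arrangement_factors f : conic_line_arrangement f -> exists (s : seq S) c, decomp f c s.
Proof.
move=> [[f0 fr] fC]; have [s sP [u uU fE]] := factorial_mpoly f0.
have [c c0 uE] : exists2 c, c != 0 & u = c%:MP.
  exists u@_0%MM; last by case/andP: uU => /eqP.
  by apply: contraTneq uU => e; apply/negP => /andP[_]; rewrite e unitr0.
exists s, c; split=> //.
- by rewrite fE uE mul_mpolyC.
- move=> g gs; split; first exact: sP.
  apply: (fC g (u * \prod_(p <- rem g s) p)); last exact/prime_irreducible/sP.
  by rewrite fE (perm_big _ (perm_to_rem gs)) big_cons mulrCA.
move=> g t st h ht [x xE].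
have [g0 gU _] : prime_el g by apply: sP; rewrite (perm_mem st) mem_head.
case/negP: gU; apply: (fr g (u * x * \prod_(p <- rem h t) p)).
rewrite fE (perm_big _ st) big_cons (perm_big _ (perm_to_rem ht)) big_cons /= xE; ring.
Qed.

Lemma component_deg g : is_line g \/ smooth_conic g ->
  exists m, [/\ (0 < m)%N, (m <= 2)%N & g \is m.-homog].
Proof. by case=> [[_ h]|[h _]]; [exists 1%N|exists 2%N]. Qed.

Lemma prod_homog (s : seq S) : (forall g, g \in s -> is_line g \/ smooth_conic g) ->
  exists2 n, (n <= 2 * size s)%N & \prod_(g <- s) g \is n.-homog.
Proof.
elim: s => [|g s IH] H; first by exists 0%N => //; rewrite big_nil dhomog1.
have [|n ns hn] := IH; first by move=> h hs; apply: H; rewrite inE hs orbT.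
have [m [_ m2 hm]] := component_deg (H g (mem_head _ _)).
by exists (m + n)%N; [rewrite /=; lia | rewrite big_cons dhomogM].
Qed.

(** Euler's relation for [g] and [h] turns parallel gradients into
    n h dg = m g dh, and [g] does not divide all its own derivatives. *)
Lemma grad_parallel_dvd m n g h : (0 < m)%N -> (0 < n)%N -> g \is m.-homog -> h \is n.-homog ->
  prime_el g -> cross (grad g) (grad h) =1 (fun=> 0) -> dvdr g h.
Proof.
move=> m0 n0 hg hh [g0 gU gP] /cross_eq0 cE.
have [i ni] := dvdr_deriv g0 gU.
case: (gP (g^`M(i)) h) => //.
have e : g^`M(i) * (n%:R *: h) = m%:R *: g * h^`M(i).
  rewrite -(euler hg) -(euler hh) !dotE /grad !mulrDr !mulrDl.
  by congr (_ + _ + _); rewrite mulrCA -mulrA; congr (_ * _); rewrite [LHS](cE i) mulrC.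
have nn0 : (n%:R : K) != 0 by rewrite pnatr_eq0 -lt0n.
exists (n%:R^-1 *: (m%:R *: h^`M(i))).
apply: (scalerI nn0); rewrite scalerAr e -[in RHS]scalerAr scalerA mulfV // scale1r.
by rewrite -scalerAr scalerAl.
Qed.

(** The field [rho] kills [g] and [h], and a multiple of the Euler field compensates
    for its action on [k]. If the sum vanished, applying it to [g] would show
    rho(k) = 0 and then rho = 0, so that the gradients would be parallel. *)
Lemma pair_syz d f g h k m n : (0 < m)%N -> (0 < n)%N -> (m + n < d)%N ->
  f \is d.-homog -> f = g * h * k -> k != 0 ->
  g \is m.-homog -> h \is n.-homog -> k \is (d - m - n).-homog -> prime_el g -> ~ dvdr g h ->
  has_syz f (d - 2).
Proof.
move=> m0 n0 mnd hf fE k0 hg hh hk gP ngh.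
pose rho := cross (grad g) (grad h); pose e := dot rho (grad k).
have gg := euler hg; have rg : dot rho (grad g) = 0.
  by rewrite -(dot_crossl (grad g) (grad h)) !dotE /rho; ring.
have rh : dot rho (grad h) = 0.
  by rewrite -(dot_crossr (grad g) (grad h)) !dotE /rho; ring.
have hrho i : rho i \is (m.-1 + n.-1).-homog.
  by rewrite rpredB // ?dhomogM ?deriv_homog // addnC dhomogM ?deriv_homog.
have he : e \is (m.-1 + n.-1 + (d - m - n).-1).-homog.
  by apply: rpred_sum => i _; rewrite dhomogM ?deriv_homog.
exists (fun i => d%:R *: (k * rho i) - e * 'X_i); split.
- move=> i; apply: rpredB.
    have -> : (d - 2 = (d - m - n) + (m.-1 + n.-1))%N by lia.
    by apply/dhomogZ/dhomogM.
  have -> : (d - 2 = (m.-1 + n.-1 + (d - m - n).-1) + 1)%N by lia.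
  by apply: dhomogM => //; rewrite dhomogX; apply/eqP/mdeg1.
- have rf : dot rho (grad f) = g * h * e.
    transitivity (g * h * dot rho (grad k) + k * h * dot rho (grad g) + k * g * dot rho (grad h)).
      by rewrite !dotE /grad fE !mderivM; ring.
    by rewrite rg rh !mulr0 !addr0.
  transitivity (d%:R *: (k * dot rho (grad f)) - e * dot (fun i => 'X_i) (grad f)).
    by rewrite !dotE -!mul_mpolyC; ring.
  by rewrite rf (euler hf) fE -!mul_mpolyC; ring.
apply: exists_neq0 => z.
have g0 : g != 0 by case: gP.
have e0 : e = 0.
  have E : e * (m%:R *: g) = d%:R *: (k * dot rho (grad g)).
    rewrite -gg; apply/esym/eqP; rewrite -subr_eq0; apply/eqP.
    transitivity (dot (fun i => d%:R *: (k * rho i) - e * 'X_i) (grad g)).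
      by rewrite !dotE -!mul_mpolyC; ring.
    by rewrite dotE !z !mul0r !addr0.
  move/eqP: E; rewrite rg mulr0 scaler0 mulf_eq0 scaler_eq0 (negPf g0) orbF pnatr_eq0.
  by rewrite -leqn0 leqNgt m0 orbF => /eqP.
apply: ngh; apply: (grad_parallel_dvd m0 n0 hg hh gP) => i.
have := z i; rewrite e0 mul0r subr0 => /eqP; rewrite scaler_eq0 mulf_eq0 (negPf k0) pnatr_eq0 /=.
by rewrite -leqn0 leqNgt (leq_ltn_trans _ mnd) //= => /eqP.
Qed.

(** * Existence of a linear syzygy *)

Lemma min_syz d f : (6 <= d)%N -> f \is d.-homog -> conic_line_arrangement f ->
  exists r rho, [/\ (r <= d - 2)%N, syz_data d f r rho & forall l, (l < r)%N -> ~ has_syz f l].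
Proof.
move=> d6 hf fC; have [fr _] := fC; have f0 : f != 0 by case: fr.
have [s [c [c0 fE sP sD]]] := arrangement_factors fC.
have d0 : (0 < d)%N by lia.
have [n ns hn] : exists2 n, (n <= 2 * size s)%N & \prod_(g <- s) g \is n.-homog.
  by apply: prod_homog => g /sP [].
have nd : n = d by apply: (dhomog_uniq (mf := mdeg) f0) => //; rewrite fE; apply: dhomogZ.
have : has_syz f (d - 2).
  case: s fE sP sD ns hn => [|g [|h s]] fE sP sD ns hn; try by move: ns => /=; lia.
  have [gP gL] := sP g (mem_head _ _).
  have [|hP hL] := sP h; first by rewrite !inE eqxx orbT.
  have [m [m0 m2 hg]] := component_deg gL; have [m' [m'0 m'2 hh]] := component_deg hL.
  have [k _ hk] : exists2 k, (k <= 2 * size s)%N & \prod_(g <- s) g \is k.-homog.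
    by apply: prod_homog => x xs; case: (sP x) => //; rewrite !inE xs !orbT.
  have f_eq : f = g * h * (c *: \prod_(g <- s) g).
    by rewrite fE !big_cons -scalerAr mulrA.
  have k0 : c *: \prod_(g <- s) g != 0.
    by apply: contraNneq f0; rewrite f_eq => ->; rewrite mulr0.
  have kE : (m + m' + k = d)%N.
    by apply: (dhomog_uniq (mf := mdeg) f0) => //; rewrite f_eq !dhomogM //; apply: dhomogZ.
  apply: (pair_syz m0 m'0 _ hf f_eq k0 hg hh) => //; first by lia.
    by apply: dhomogZ; rewrite (_ : d - m - m' = k)%N //; lia.
  by apply: (sD g (h :: s) (perm_refl _)); rewrite mem_head.
case/ex_min => r [rd [rho [hr rs rn]] rmin].
exists r, rho; split=> //; split=> //; exact: (min_syz_primitive hf hr rs rn rmin).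
Qed.

Lemma codim1_comb (vT : vectType K) (U : {vspace vT}) (u v : vT) :
  (\dim {:vT} <= (\dim U).+1)%N -> u \notin U -> exists c, v - c *: u \in U.
Proof.
move=> dU uU; have : v \in (U + <[u]>)%VS.
  suff -> : (U + <[u]>)%VS = fullv by rewrite memvf.
  apply/eqP; rewrite -(dimv_leqif_eq (subvf _)) eqn_leq dimvS ?subvf //=.
  apply: leq_trans dU _; rewrite ltn_neqAle dimvS ?addvSl // andbT.
  rewrite (dimv_leqif_eq (addvSl _ _)).
  apply: contraNneq uU => ->; apply: (subvP (addvSr U _)); exact: memv_line.
case/memv_addP => w wU [_ /vlineP [c ->] ->].
by exists c; rewrite addrK.
Qed.

(** A form [q0] of degree [e] outside the ideal generates all the forms of this
    degree modulo the ideal. One degree higher, x q0 and y q0 are dependent modulo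
    the ideal, so some combination [m] of x and y multiplies [q0], and thus all
    the forms of degree [e], into the ideal. Saturation then applies. *)
Lemma bourbaki_linear f rho e (U1 : {vspace V e}) (U2 : {vspace V e.+1}) :
  primitive rho ->
  (forall v : V _, v \in U1 <-> bourbaki f rho (v : S)) ->
  (forall v : V _, v \in U2 <-> bourbaki f rho (v : S)) ->
  (\dim {:V e} <= (\dim U1).+1)%N -> (\dim {:V e.+1} <= (\dim U2).+1)%N ->
  exists m : S, [/\ m != 0, m \is 1.-homog & bourbaki f rho m].
Proof.
move=> rP U1P U2P d1 d2.
have X1 i : ('X_i : S) \is 1.-homog by rewrite dhomogX; apply/eqP/mdeg1.
have X0 i : ('X_i : S) != 0 by rewrite -msize_poly_eq0 msizeX.
have Xe i : ('X_i : S) ^+ e \is e.-homog by have := dhomogMn e (X1 i); rewrite mul1n.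
suff [m [m0 m1 mP]] : exists m : S, [/\ m != 0, m \is 1.-homog &
    forall q : V e, bourbaki f rho (m * q)].
  exists m; split=> //; apply: (bourbaki_saturated (e := e) rP) => i.
  by have [v vE] := to_homog (Xe i); rewrite -vE mulrC.
have [[q0 q0U]|noq] := classic (exists q : V e, q \notin U1); last first.
  exists 'X_0; split=> // q; apply: bourbakiM; apply/U1P; apply: contraT => nq.
  by case: noq; exists q.
have he (m : S) (q : V e) : m \is 1.-homog -> exists v : V e.+1, (v : S) = m * q.
  by move=> hm; apply: to_homog; exact: (dhomogM hm (dhomog_is_dhomog q)).
have step (m : S) : m != 0 -> m \is 1.-homog -> bourbaki f rho (m * q0) ->
    exists m : S, [/\ m != 0, m \is 1.-homog & forall q : V e, bourbaki f rho (m * q)].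
  move=> m0 m1 mq; exists m; split=> // q.
  have [c] := codim1_comb q d1 q0U; move/U1P => /= /(bourbakiM m) h.
  have -> : m * (q : S) = m * ((q : S) - c *: (q0 : S)) + c *: (m * q0).
    by rewrite -!mul_mpolyC; ring.
  by apply: bourbakiD => //; apply: bourbakiZ.
have [v0 v0E] := he 'X_0 q0 (X1 0); have [v1 v1E] := he 'X_1 q0 (X1 1).
have [v0U|v0U] := boolP (v0 \in U2).
  by apply: (step 'X_0) => //; rewrite -v0E; apply/U2P.
have [c /U2P /= h] := codim1_comb v1 d2 v0U.
apply: (step ('X_1 - c *: 'X_0)).
- apply/eqP => /(congr1 (mcoeff U_(1))); rewrite mcoeffB mcoeffZ !mcoeffXU mcoeff0 /= mulr0 subr0.
  exact/eqP/oner_neq0.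
- by rewrite rpredB // dhomogZ.
by rewrite mulrBl -scalerAl -v0E -v1E.
Qed.

(** For the least degree [r] of a syzygy, the formula of the Tjurina number is
    codim I + r (d - 1 - r) = d - 1, and it leaves only r <= 1 and r = d - 2. In
    the second case codim I = 1, and a linear form in [I] comes from a syzygy of
    degree 2, smaller than [r]. *)
Theorem linear_syzygy d f : (6 <= d)%N -> f \is d.-homog -> conic_line_arrangement f ->
  total_tjurina f (d ^ 2 - 3 * d + 2)%N -> exists r rho, (r <= 1)%N /\ syz_data d f r rho.
Proof.
move=> d6 hf fC tau; have [r [rho [rd sd rmin]]] := min_syz d6 hf fC.
exists r, rho; split=> //; rewrite leqNgt; apply/negP => r2.
have rd' : (r <= d.-1)%N by lia.
have [N H] := tjurina_codim sd rd' tau.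
have [D dE] : exists D, d = D.+1 by exists d.-1; lia.
have D5 : (5 <= D)%N by lia.
have tE : (d ^ 2 - 3 * d + 2 + D = D * D)%N.
  have DD : (D * 5 <= D * D)%N by rewrite leq_mul2l D5 orbT.
  rewrite dE -mulnn mulSn mulnS; move: DD; move: (D * D)%N => DD; lia.
have [U1 [U1P [e1 le1]]] := H N.+1 (leqnSn _).
have [U2 [U2P [e2 le2]]] := H N.+2 (leqW (leqnSn _)).
have eD (x : nat) : (d ^ 2 - 3 * d + 2 + x + r * (d.-1 - r) = d.-1 ^ 2)%N -> (x + r * (D - r) = D)%N.
  rewrite dE /= -[(D ^ 2)%N]mulnn -tE -dE.
  by move: (d ^ 2 - 3 * d + 2)%N (r * (D - r))%N => y z; lia.
move/eD: e1 => e1; move/eD: e2 => e2 {eD H}.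
have [rlt|rge] := ltnP r (D - 1).
  (* With D = d - 1, r = a + 2 and D - r = b + 2, the product (a + 2) (b + 2) is at
  most D = a + b + 4 only for a = b = 0, that is, for d = 5. *)
  have [a rE] : exists a, (r = a + 2)%N by exists (r - 2)%N; lia.
  have [b DE] : exists b, (D = b + a + 4)%N by exists (D - a - 4)%N; lia.
  have rD : (D - r = b + 2)%N by lia.
  by move: e1; rewrite rD rE mulnDl !mulnDr; move: (a * b)%N; lia.
have rE : r = (D - 1)%N by lia.
have rD : (D - r = 1)%N by lia.
rewrite rD muln1 in e1 e2.
have c1 : ('C(N.+1 + 2, N.+1) - \dim U1 = 1)%N by move: e1; lia.
have c2 : ('C(N.+2 + 2, N.+2) - \dim U2 = 1)%N by move: e2; lia.
have [||m [m0 m1 [s ss sE]]] := bourbaki_linear (sd_primitive sd) U1P U2P.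
- by rewrite dim_homog; lia.
- by rewrite dim_homog; lia.
apply: (rmin 2%N); first by lia.
exists (fun i => pihomog mdeg 2 (s i)); split=> [i||].
- exact: pihomogP.
- exact: homog_part_syz hf ss.
apply: exists_neq0 => z.
have [[i gi] _] := grad_primitive (sd_pos sd) hf (sd_red sd).
have pr a b : pihomog mdeg (2 + r) (rho a * s b) = rho a * pihomog mdeg 2 (s b).
  by rewrite [rho a * s b]mulrC (pihomogM 2 (s b) (sd_rhom sd a)) mulrC.
have : m * grad f i != 0 by rewrite mulf_neq0.
have hm : m * grad f i \is (2 + r).-homog.
  have -> : (2 + r = 1 + d.-1)%N by rewrite rE dE /=; lia.
  by rewrite dhomogM // deriv_homog.
by rewrite -(pihomog_dE hm) /grad -sE /cross raddfB /= !pr !z !mulr0 subrr eqxx.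
Qed.
End JacobianSyzygies.

(** * Linear changes of coordinates *)

Section Coordinates.
Variable K : numFieldType.
Local Notation S := {mpoly K[3]}.
Implicit Types (f g h p q : S) (M N : 'M[K]_3) (v : 'I_3 -> K).

Lemma mpoly_gen_ind (P : S -> Prop) : (forall c, P c%:MP) -> (forall i, P 'X_i) ->
  (forall f g, P f -> P g -> P (f + g)) -> (forall f g, P f -> P g -> P (f * g)) ->
  forall f, P f.
Proof.
move=> PC PX PD PM f; rewrite (mpolyE f); apply: (big_ind P) => [||m _].
- by rewrite -(mpolyC0 3); apply: PC.
- exact: PD.
rewrite -mul_mpolyC mpolyXE_id; apply: (PM) => //.
apply: (big_ind P) => [||i _]; [by rewrite -(mpolyC1 3) | exact: PM |].
elim: (m i) => [|k IH]; first by rewrite expr0 -(mpolyC1 3).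
by rewrite exprS; apply: PM.
Qed.

Lemma mderivX1 (i j : 'I_3) : ('X_i : S)^`M(j) = ((i == j)%:R)%:MP.
Proof.
rewrite mderivX mnm1E; case: eqVneq => [->|_]; last by rewrite scale0r mpolyC0.
have -> : (U_(j) - U_(j) = 0 :> 'X_{1..3})%MM by rewrite -{1}[U_(j)%MM]add0m addmK.
by rewrite scale1r mpolyX0 mpolyC1.
Qed.

Lemma homogX1 (i : 'I_3) : ('X_i : S) \is 1.-homog.
Proof. by rewrite dhomogX; apply/eqP/mdeg1. Qed.

Definition lform M i : S := \sum_j M i j *: 'X_j.
Lemma mcoeff_lform M i j : (lform M i)@_(U_(j)) = M i j.
Proof.
rewrite /lform raddf_sum /= (bigD1 j) //= mcoeffZ mcoeffXU eqxx mulr1 big1 ?addr0 // => k kj.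
by rewrite mcoeffZ mcoeffXU (negPf kj) mulr0.
Qed.

Lemma deriv_lform M i j : (lform M i)^`M(j) = (M i j)%:MP.
Proof.
rewrite /lform raddf_sum /= (bigD1 j) //= mderivZ mderivX1 eqxx mpolyC1 -mul_mpolyC mulr1.
by rewrite big1 ?addr0 // => k kj; rewrite mderivZ mderivX1 (negPf kj) mpolyC0 scaler0.
Qed.

Definition sub M f : S := f \mPo [tuple lform M i | i < 3].
Definition mulv M v : 'I_3 -> K := fun i => \sum_j M i j * v j.

HB.instance Definition _ M := GRing.RMorphism.copy (sub M) (comp_mpoly [tuple lform M i | i < 3]).
HB.instance Definition _ M := GRing.Linear.copy (sub M) (comp_mpoly [tuple lform M i | i < 3]).

Lemma subC M c : sub M c%:MP = c%:MP.
Proof. exact: comp_mpolyC. Qed.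
Lemma subX M i : sub M 'X_i = lform M i.
Proof. by rewrite /sub comp_mpolyXU -tnth_nth tnth_mktuple. Qed.
Lemma subD M f g : sub M (f + g) = sub M f + sub M g.
Proof. exact: rmorphD. Qed.
Lemma subM M f g : sub M (f * g) = sub M f * sub M g.
Proof. exact: rmorphM. Qed.
Lemma subZ M c f : sub M (c *: f) = c *: sub M f.
Proof. exact: linearZ. Qed.
Lemma subB M f g : sub M (f - g) = sub M f - sub M g.
Proof. exact: rmorphB. Qed.
Lemma sub_prod M (s : seq S) : sub M (\prod_(g <- s) g) = \prod_(g <- map (sub M) s) g.
Proof. by rewrite rmorph_prod big_map. Qed.

Lemma sub_lform M N i : sub N (lform M i) = lform (M *m N) i.
Proof.
rewrite /lform raddf_sum /=.
under eq_bigr => j _ do rewrite subZ subX /lform scaler_sumr.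
rewrite exchange_big /=; apply: eq_bigr => k _; rewrite mxE scaler_suml.
by apply: eq_bigr => j _; rewrite scalerA.
Qed.

Lemma sub_comp M N f : sub N (sub M f) = sub (M *m N) f.
Proof.
elim/mpoly_gen_ind: f => [c|i|f g Hf Hg|f g Hf Hg]; first by rewrite !subC.
- by rewrite !subX sub_lform.
- by rewrite !subD Hf Hg.
by rewrite !subM Hf Hg.
Qed.

Lemma sub1 f : sub 1%:M f = f.
Proof.
elim/mpoly_gen_ind: f => [c|i|f g Hf Hg|f g Hf Hg]; first by rewrite !subC.
- rewrite subX /lform (bigD1 i) //= big1 ?addr0 => [|j ij]; rewrite mxE ?eqxx ?scale1r //.
  by rewrite eq_sym (negPf ij) scale0r.
- by rewrite !subD Hf Hg.
by rewrite !subM Hf Hg.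
Qed.

Lemma subK M N f : M *m N = 1%:M -> sub N (sub M f) = f.
Proof. by move=> E; rewrite sub_comp E sub1. Qed.

Lemma lform_homog M i : lform M i \is 1.-homog.
Proof. by apply: rpred_sum => j _; rewrite dhomogZ // homogX1. Qed.

Lemma sub_homog M k f : f \is k.-homog -> sub M f \is k.-homog.
Proof.
move=> /dhomogP hf; rewrite [f in sub M f]mpolyE raddf_sum big_seq.
apply: rpred_sum => m mf /=; rewrite subZ dhomogZ // mpolyXE_id rmorph_prod /=.
rewrite -(hf m mf) /= mdegE.
have D (a : 'I_3 -> S) (b : 'I_3 -> nat) : (forall i, a i \is (b i).-homog) ->
    \prod_i a i \is (\sum_i b i)%N.-homog.
  by move=> H; elim/big_ind2: _ => [|x1 x2 y1 y2|i _]; [exact: dhomog1|exact: dhomogM|exact: H].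
apply: D => i; rewrite rmorphXn /= subX.
by have := dhomogMn (m i) (lform_homog M i); rewrite mul1n.
Qed.

Lemma meval_sub M f v : (sub M f).@[v] = f.@[mulv M v].
Proof.
elim/mpoly_gen_ind: f => [c|i|f g Hf Hg|f g Hf Hg]; first by rewrite !subC !mevalC.
- rewrite subX mevalXU /lform raddf_sum; apply: eq_bigr => j _.
  by rewrite /= mevalZ mevalXU.
- by rewrite !subD !mevalD Hf Hg.
by rewrite !subM !mevalM Hf Hg.
Qed.

Lemma deriv_sub M f j : (sub M f)^`M(j) = \sum_i M i j *: sub M (f^`M(i)).
Proof.
elim/mpoly_gen_ind: f => [c|i|f g Hf Hg|f g Hf Hg].
- by rewrite subC mderivC big1 // => i _; rewrite mderivC raddf0 scaler0.
- rewrite subX deriv_lform (bigD1 i) //= mderivX1 eqxx mpolyC1 rmorph1 -mul_mpolyC mulr1.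
  by rewrite big1 ?addr0 // => k ki; rewrite mderivX1 eq_sym (negPf ki) mpolyC0 raddf0 scaler0.
- by rewrite subD mderivD Hf Hg -big_split; apply: eq_bigr => i _; rewrite /= mderivD subD scalerDr.
rewrite subM mderivM Hf Hg mulr_suml mulr_sumr -big_split /=; apply: eq_bigr => i _.
by rewrite mderivM subD !subM scalerDr scalerAl scalerAr.
Qed.

Lemma mulvA M N v : mulv M (mulv N v) =1 mulv (M *m N) v.
Proof.
move=> i; rewrite /mulv; under eq_bigr => j _ do rewrite mulr_sumr.
rewrite exchange_big /=; apply: eq_bigr => k _; rewrite mxE mulr_suml.
by apply: eq_bigr => j _; rewrite mulrA.
Qed.

Lemma mulv1 v : mulv 1%:M v =1 v.
Proof.
move=> i; rewrite /mulv (bigD1 i) //= big1 ?addr0 => [|j ij]; rewrite mxE ?eqxx ?mul1r //.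
by rewrite eq_sym (negPf ij) mul0r.
Qed.

Lemma mulv_eq M v w : v =1 w -> mulv M v =1 mulv M w.
Proof. by move=> h i; apply: eq_bigr => j _; rewrite h. Qed.

Lemma mulvK M N v : M *m N = 1%:M -> mulv M (mulv N v) =1 v.
Proof. by move=> E i; rewrite mulvA E mulv1. Qed.

Section Invertible.
Variables (M N : 'M[K]_3).
Hypotheses (MN : M *m N = 1%:M).
Let NM : N *m M = 1%:M. Proof. exact: mulmx1C. Qed.

Lemma is_pt_mulv v : is_pt v -> is_pt (mulv M v).
Proof.
move=> [i vi]; apply: exists_neq0 => z; case/eqP: vi.
have := mulvK v NM i; rewrite {1}/mulv big1 => [->|j _] //.
by rewrite z mulr0.
Qed.

Lemma sub_eq0 f : (sub M f == 0) = (f == 0).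
Proof.
apply/eqP/eqP => [e|->]; last by rewrite raddf0.
by rewrite -(subK f MN) e raddf0.
Qed.

Lemma sub_unit f : sub M f \is a GRing.unit -> f \is a GRing.unit.
Proof. by move=> h; rewrite -(subK f MN); apply: rmorph_unit. Qed.

(** The chain rule [deriv_sub], solved for the derivatives of [f] by means of the
    inverse matrix. *)
Lemma sub_deriv f i : sub M (f^`M(i)) = \sum_j N j i *: (sub M f)^`M(j).
Proof.
under eq_bigr => j _ do rewrite deriv_sub scaler_sumr.
rewrite exchange_big; transitivity (\sum_k (M *m N) k i *: sub M (f^`M(k))).
  rewrite MN (bigD1 i) //= mxE eqxx scale1r big1 ?addr0 // => k ki.
  by rewrite mxE (negPf ki) scale0r.
apply: eq_bigr => k _; rewrite mxE scaler_suml; apply: eq_bigr => j _.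
by rewrite scalerA mulrC.
Qed.

Lemma sub_jacobian f w : ideal_gen (jacobian_gens f) w ->
  ideal_gen (jacobian_gens (sub M f)) (sub M w).
Proof.
move=> /jacobian_idealP [c ->]; apply/jacobian_idealP.
exists (fun j => \sum_i N j i *: sub M (c i)).
rewrite /dot raddf_sum /=; under [RHS]eq_bigr => j _ do rewrite mulr_suml.
rewrite exchange_big /=; apply: eq_bigr => i _; rewrite subM /grad sub_deriv mulr_sumr.
by apply: eq_bigr => j _; rewrite -scalerAr -scalerAl.
Qed.

Lemma sub_is_line f : is_line f -> is_line (sub M f).
Proof. by move=> [f0 hf]; split; [rewrite sub_eq0 | apply: sub_homog]. Qed.

Lemma sub_smooth f : smooth_conic f -> smooth_conic (sub M f).
Proof.
move=> [hf fs]; split; first exact: sub_homog.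
move=> v vp; rewrite meval_sub => /(fs _ (is_pt_mulv vp)) [i ni].
apply: exists_neq0 => z; case/eqP: ni.
rewrite -meval_sub sub_deriv raddf_sum big1 // => j _.
by rewrite /= mevalZ z mulr0.
Qed.
End Invertible.

Section Invertible2.
Variables (M N : 'M[K]_3).
Hypotheses (MN : M *m N = 1%:M).
Let NM : N *m M = 1%:M. Proof. exact: mulmx1C. Qed.

Lemma sub_hilbert f k t : hilbert_value (jacobian_gens f) k t ->
  hilbert_value (jacobian_gens (sub M f)) k t.
Proof.
move=> [e [eh eP]]; exists (fun i => sub M (e i)); split=> [i|v hv].
  exact: sub_homog.
have [c [c1 c2]] := eP _ (sub_homog N hv).
have E (c' : {ffun 'I_t -> K}) :
    sub M (sub N v - \sum_i (c' i)%:MP * e i) = v - \sum_i (c' i)%:MP * sub M (e i).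
  rewrite raddfB /= (subK _ NM) (raddf_sum (sub M)) /=; congr (_ - _); apply: eq_bigr => i _.
  by rewrite /= subM subC.
exists c; split.
  by rewrite -E; apply: (sub_jacobian MN).
move=> c' h; apply: c2; have := sub_jacobian NM h.
by rewrite -E !(subK _ MN).
Qed.

Lemma sub_tjurina f t : total_tjurina f t -> total_tjurina (sub M f) t.
Proof. by move=> [n H]; exists n => k /H; apply: sub_hilbert. Qed.

Lemma sub_reduced f : reduced_poly f -> reduced_poly (sub M f).
Proof.
move=> [f0 fr]; split; first by rewrite (sub_eq0 MN).
move=> g h e; apply: (sub_unit NM); apply: (fr _ (sub N h)).
by rewrite -(subK f MN) e subM rmorphXn.
Qed.

Lemma sub_irreducible f : irreducible_mpoly f -> irreducible_mpoly (sub M f).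
Proof.
move=> [f0 fU fI]; split; first by rewrite (sub_eq0 MN).
  by apply: contra fU; apply: (sub_unit MN).
move=> a b e; case: (fI (sub N a) (sub N b)) => [|/(sub_unit NM)|/(sub_unit NM)]; try by [left|right].
by rewrite -subM -e (subK _ MN).
Qed.
End Invertible2.

End Coordinates.

Arguments homogX1 {K} i.
Arguments mderivX1 {K} i j.
Global Opaque sub.

(** * The conics axz + by^2 *)

Section Bitangent.
Variable K : numFieldType.
Local Notation S := {mpoly K[3]}.
Implicit Types (f g h : S) (M N : 'M[K]_3) (v p : 'I_3 -> K) (a b : K).

(** The conics of the bitangent pencil with bitangency points [ept 0] and
    [ept 2], which are joined by the line y = 0. *)
Definition pen a b : S := a *: ('X_0 * 'X_2) + b *: 'X_1 ^+ 2.
Lemma penE a b : pen a b = a *: ('X_0 * 'X_2) + b *: 'X_1 ^+ 2.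
Proof. by []. Qed.
Definition ept (i : 'I_3) : 'I_3 -> K := fun j => (i == j)%:R.

Lemma eptE i j : ept i j = (i == j)%:R. Proof. by []. Qed.

Lemma pen_homog a b : pen a b \is 2.-homog.
Proof.
apply: rpredD; apply: dhomogZ; first exact: (dhomogM (homogX1 0) (homogX1 2)).
exact: (dhomogMn 2 (homogX1 1)).
Qed.

Lemma meval_pen a b v : (pen a b).@[v] = a * (v 0 * v 2) + b * v 1 ^+ 2.
Proof. by rewrite mevalD !mevalZ mevalM rmorphXn /= !mevalXU. Qed.

Lemma deriv_pen a b : ((pen a b)^`M(0) = a *: 'X_2) *
  ((pen a b)^`M(1) = (b *+ 2) *: 'X_1) * ((pen a b)^`M(2) = a *: 'X_0).
Proof.
rewrite /pen !mderivD !mderivZ expr2 !mderivM !mderivX1 /= !mpolyC0 !mpolyC1 !(mulr0, mul0r, addr0, add0r, mul1r, mulr1, scaler0).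
by do 2!split=> //; rewrite scalerDr mulr2n scalerDl.
Qed.

Lemma pen_smooth a b : a != 0 -> b != 0 -> smooth_conic (pen a b).
Proof.
move=> a0 b0; split; first exact: pen_homog.
move=> v [i vi] _; apply: exists_neq0 => z.
have := z 0; have := z 1; have := z 2; rewrite !deriv_pen !mevalZ !mevalXU.
move=> /eqP; rewrite mulf_eq0 (negPf a0) /= => /eqP v0.
move=> /eqP; rewrite mulf_eq0 mulrn_eq0 (negPf b0) /= => /eqP v1.
move=> /eqP; rewrite mulf_eq0 (negPf a0) /= => /eqP v2.
by move: vi; elim/ord3P: i; rewrite ?v0 ?v1 ?v2 eqxx.
Qed.

Lemma smooth_pen a b : smooth_conic (pen a b) -> a != 0 /\ b != 0.
Proof.
have ep i : is_pt (ept i) by exists i; rewrite /ept eqxx oner_neq0.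
move=> [_ sm]; split; apply/eqP => z.
  case: (sm (ept 0) (ep 0)) => [|i]; first by rewrite meval_pen /ept /= !(mulr0, mul0r) expr0n mulr0 addr0.
  by case/eqP; elim/ord3P: i; rewrite deriv_pen mevalZ mevalXU /ept /= ?z !(mulr0, mul0r).
case: (sm (ept 1) (ep 1)) => [|i]; first by rewrite meval_pen /ept /= z !(mulr0, mul0r) addr0.
by case/eqP; elim/ord3P: i; rewrite deriv_pen mevalZ mevalXU /ept /= ?z ?mul0rn !(mulr0, mul0r).
Qed.

Lemma meval_ept n i (F : S) : F \is n.-homog -> F.@[ept i] = F@_(U_(i) *+ n).
Proof.
move=> /dhomogP hF; rewrite [in RHS](mpolyE F) [in LHS](mpolyE F) !raddf_sum /= big_seq [RHS]big_seq.
apply: eq_bigr => m /hF /= dm; rewrite mevalZ mcoeffZ mcoeffX mevalX; congr (_ * _).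
have [->|ne] := eqVneq m (U_(i) *+ n)%MM.
  rewrite big1 // => j _; rewrite mulmnE mnm1E /ept.
  by case: eqVneq; rewrite ?expr1n // mul0n expr0.
have [j /andP[ji mj]] : exists j, (j != i) && (m j != 0%N).
  apply/existsP; apply: contraR ne; rewrite negb_exists => /forallP H.
  have mj0 j : j != i -> m j = 0%N.
    by move=> ji; have := H j; rewrite ji /= negbK => /eqP.
  apply/eqP/mnmP => j; rewrite mulmnE mnm1E.
  have [<-|ji] := eqVneq i j; last by rewrite mj0 // eq_sym.
  by rewrite mul1n -dm mdegE (bigD1 i) //= big1 ?addn0.
by rewrite (bigD1 j) //= /ept eq_sym (negPf ji) expr0n (negPf mj) mul0r.
Qed.

(** The only monomial of degree [n] outside the ideal (x, z) is y^n. *)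
Lemma vanish_ept1 n (h : S) : h \is n.-homog -> h.@[ept 1] = 0 ->
  exists s t, h = 'X_0 * s + 'X_2 * t.
Proof.
move=> hh h0; have [p1 [p2 [pE fp sub1]]] := split_free 1 0 h.
have [a1 [a2 [aE fa sub2]]] := split_free 1 2 p1.
exists p2, a2; rewrite pE aE !expr1; suff -> : a1 = 0 by ring.
apply/mpolyP => m; rewrite mcoeff0; apply/eqP; apply: contraT => am.
have m1 := fa _ am; have ap := sub2 _ am; have pm : p1@_m != 0 by rewrite -ap.
have m2 := fp _ pm; have pF := sub1 _ pm; have Fm : h@_m != 0 by rewrite -pF.
have dm : mdeg m = n by apply: (dhomog_mf hh); rewrite mcoeff_msupp.
move: dm h0; rewrite mdegE sum3 (meval_ept 1 hh) => dm.
suff -> : (U_(1%R) *+ n)%MM = m by move=> e; rewrite e eqxx in Fm.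
by apply/mnmP; elim/ord3P; rewrite mulmnE mnm1E /=; lia.
Qed.

(** The only monomials of degree [n] outside the ideal (z, y^2) are x^n and
    x^(n-1) y, whose coefficients are the value and the y-derivative at
    [ept 0]. *)
Lemma tangent_span n (F : S) : F \is n.-homog -> F.@[ept 0] = 0 -> F^`M(1).@[ept 0] = 0 ->
  exists s t, F = 'X_2 * s + 'X_1 ^+ 2 * t.
Proof.
move=> hF F0 F1; have [p1 [p2 [pE fp sub1]]] := split_free 1 2 F.
have [a1 [a2 [aE fa sub2]]] := split_free 2 1 p1.
exists p2, a2; rewrite pE aE expr1; suff -> : a1 = 0 by ring.
apply/mpolyP => m; rewrite mcoeff0; apply/eqP; apply: contraT => am.
have m1 := fa _ am; have ap := sub2 _ am; have pm : p1@_m != 0 by rewrite -ap.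
have m2 := fp _ pm; have pF := sub1 _ pm; have Fm : F@_m != 0 by rewrite -pF.
have dm : mdeg m = n by apply: (dhomog_mf hF); rewrite mcoeff_msupp.
move: dm; rewrite mdegE sum3 => dm.
move: F1; rewrite (meval_ept 0 (deriv_homog 1 hF)) mcoeff_deriv.
move: F0; rewrite (meval_ept 0 hF) => F0 F1.
case m1E: (m 1) m1 dm => [|[|//]] _ dm.
  suff mE : m = (U_(0%R) *+ n)%MM by rewrite mE F0 eqxx in Fm.
  by apply/mnmP; elim/ord3P; rewrite mulmnE mnm1E /=; lia.
suff mE : m = (U_(0%R) *+ n.-1 + U_(1%R))%MM.
  by move: F1; rewrite -mE => /eqP; rewrite mulrn_eq0 (negPf Fm).
by apply/mnmP; elim/ord3P; rewrite mnmDE mulmnE !mnm1E /=; lia.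
Qed.

Lemma ideal2P (g h w : S) : ideal_gen [:: g; h] w <-> exists c e, w = c * g + e * h.
Proof.
split=> [[c ->]|[c [e ->]]].
  by exists (c 0), (c 1); rewrite big_ord_recl big_ord1; congr (_ * _ + c _ * _); apply: val_inj.
exists (fun i => if i == 0 then c else e); rewrite big_ord_recl big_ord1 //.
Qed.
End Bitangent.

Global Opaque pen.

(** * Intersection multiplicity at a bitangency point *)

Lemma common_denominator (F : fieldType) (A X Y U x y : F) : X != 0 -> U != 0 ->
  A / U - (x * 1 + y * (Y / X)) = (A * X - x * (U * X) - y * (U * Y)) / (U * X).
Proof. by move=> X0 U0; field; rewrite X0 U0. Qed.

Section Pencil.
Variable K : numFieldType.
Local Notation S := {mpoly K[3]}.
Implicit Types (f g h : S) (M N : 'M[K]_3) (v p : 'I_3 -> K) (a b : K).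
Local Notation pen := (@pen K).
Local Notation ept := (@ept K).

(** Two different conics of the pencil generate (xz, y^2), hence (z, y^2) near
    [ept 0]. By [tangent_span] membership in this ideal is the vanishing of a value
    and of a y-derivative, so that 1 and y/x represent a basis of the quotient. An
    arbitrary embedding [tau] in a field stands for the fraction field, which makes
    the proof independent of its construction. *)
Lemma pencil_mult_embedding (L : fieldType) (tau : {rmorphism S -> L}) M N p a b a' b' :
  injective tau -> M *m N = 1%:M -> mulv M p =1 ept 0 ->
  a * b' - a' * b != 0 ->
  quot_dim (fun c : K => tau (mpolyC 3 c))
    (fun x => exists (k : nat) (a u : S),
       [/\ a \is k.-homog, u \is k.-homog, u.@[p] != 0 & x = tau a / tau u])
    (fun x => exists (k : nat) (A u : S),
       [/\ A \is k.-homog, u \is k.-homog, u.@[p] != 0,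
        ideal_gen [:: sub M (pen a b); sub M (pen a' b')] A & x = tau A / tau u]) 2.
Proof.
move=> tau_inj MN pE det.
have tau_eq0 f : (tau f == 0) = (f == 0) by rewrite -(rmorph0 tau) (inj_eq tau_inj).
have tauM : {morph tau : x y / x * y} by exact: rmorphM.
have tauB : {morph tau : x y / x - y} by exact: rmorphB.
have NM := mulmx1C MN.
(* The value and the y-derivative at [p], in the coordinates given by [N]. *)
pose v0 (F : S) : K := (sub N F).@[ept 0].
pose v1 (F : S) : K := ((sub N F)^`M(1)).@[ept 0].
have v0p F : v0 F = F.@[p].
  rewrite /v0 meval_sub; apply: meval_eq => i.
  by rewrite -(mulvK p NM i); apply: mulv_eq => j; rewrite pE.
have v0B F G : v0 (F - G) = v0 F - v0 G by rewrite /v0 subB mevalB.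
have v1B F G : v1 (F - G) = v1 F - v1 G by rewrite /v1 subB mderivB mevalB.
have v0Z c F : v0 (c *: F) = c * v0 F by rewrite /v0 subZ mevalZ.
have v1Z c F : v1 (c *: F) = c * v1 F by rewrite /v1 subZ mderivZ mevalZ.
have v0D F1 F2 : v0 (F1 + F2) = v0 F1 + v0 F2 by rewrite /v0 subD mevalD.
have v1D F1 F2 : v1 (F1 + F2) = v1 F1 + v1 F2 by rewrite /v1 subD mderivD mevalD.
have p0 x y : v0 (sub M (pen x y)) = 0.
  by rewrite /v0 (subK _ MN) meval_pen /ept /= expr0n !mulr0 addr0.
have p1 x y : v1 (sub M (pen x y)) = 0.
  by rewrite /v1 (subK _ MN) deriv_pen mevalZ mevalXU /ept mulr0.
have tspan n (F : S) : F \is n.-homog -> v0 F = 0 -> v1 F = 0 ->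
    exists s t, sub N F = 'X_2 * s + 'X_1 ^+ 2 * t.
  by move=> hF; apply: (tangent_span (sub_homog N hF)).
have v0M F G : v0 (F * G) = v0 F * v0 G by rewrite /v0 subM mevalM.
have v1M F G : v1 (F * G) = v1 F * v0 G + v0 F * v1 G.
  by rewrite /v1 /v0 subM mderivM mevalD !mevalM.
pose X := sub M ('X_0 : S); pose Y := sub M ('X_1 : S).
have X0 : v0 X = 1 by rewrite /v0 /X (subK _ MN) mevalXU /ept.
have X1 : v1 X = 0 by rewrite /v1 /X (subK _ MN) mderivX1 mevalC.
have Y0 : v0 Y = 0 by rewrite /v0 /Y (subK _ MN) mevalXU /ept.
have Y1 : v1 Y = 1 by rewrite /v1 /Y (subK _ MN) mderivX1 mevalC.
have hX : X \is 1.-homog by apply/sub_homog/homogX1.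
have hY : Y \is 1.-homog by apply/sub_homog/homogX1.
have Xn0 : X != 0 by rewrite (sub_eq0 MN) -msize_poly_eq0 msizeX.
have Xp : X.@[p] = 1 by rewrite -v0p.
clearbody v0 v1; have idl F : ideal_gen [:: sub M (pen a b); sub M (pen a' b')] F -> v0 F = 0 /\ v1 F = 0.
  case/ideal2P => c [e ->].
  by rewrite v0D v1D !v1M !v0M !p0 !p1 !mulr0 !addr0.
have XE : X = sub M 'X_0 by [].
have idr n F : F \is n.-homog -> v0 F = 0 -> v1 F = 0 ->
    ideal_gen [:: sub M (pen a b); sub M (pen a' b')] (X * F).
  move=> hF F0 F1; have [s [t E]] := tspan _ _ hF F0 F1.
  have FE : X * F = sub M ('X_0 * 'X_2) * sub M s + sub M ('X_1 ^+ 2) * sub M ('X_0 * t).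
    by rewrite -(subK F NM) E XE -!subM -subD; congr (sub M _); ring.
  pose D := a * b' - a' * b.
  have xzE : 'X_0 * 'X_2 = D^-1 *: (b' *: pen a b - b *: pen a' b').
    apply: (scalerI det); rewrite scalerA mulfV // scale1r !penE !scalerDr !scalerA opprD.
    rewrite addrACA -!scalerBl (mulrC b' b) subrr scale0r addr0 mulrC (mulrC b a') //.
  have yyE : 'X_1 ^+ 2 = D^-1 *: (a *: pen a' b' - a' *: pen a b).
    apply: (scalerI det); rewrite scalerA mulfV // scale1r !penE !scalerDr !scalerA opprD.
    rewrite addrACA -!scalerBl (mulrC a' a) subrr scale0r add0r //.
  apply/ideal2P; exists (D^-1 *: (b' *: sub M s - a' *: sub M ('X_0 * t))).
  exists (D^-1 *: (a *: sub M ('X_0 * t) - b *: sub M s)).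
  rewrite FE xzE yyE !subZ !subB !subZ.
  by move: (sub M (pen a b)) (sub M (pen a' b')) (sub M s) (sub M _) => *; rewrite -!mul_mpolyC; ring.
clearbody X Y.
pose e (i : 'I_2) : L := if i == 0 then 1 else tau Y / tau X.
pose B A U (c0 c1 : K) := A * X - c0 *: (U * X) - c1 *: (U * Y).
have hB k A U c0 c1 : A \is k.-homog -> U \is k.-homog -> B A U c0 c1 \is (k + 1).-homog.
  by move=> hA hU; rewrite /B !rpredB // ?dhomogZ // dhomogM.
have B0 A U c0 c1 : v0 (B A U c0 c1) = v0 A - c0 * v0 U.
  by rewrite /B !v0B !v0Z !v0M X0 Y0; ring.
have B1 A U c0 c1 : v1 (B A U c0 c1) = v1 A - c0 * v1 U - c1 * v0 U.
  by rewrite /B !v1B !v1Z !v1M X0 Y0 X1 Y1; ring.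
have nz (F : S) : F.@[p] != 0 -> tau F != 0.
  by rewrite tau_eq0; apply: contraNneq => ->; rewrite meval0.
have tX : tau X != 0 by rewrite tau_eq0.
have BE (A U : S) (c : {ffun 'I_2 -> K}) : U.@[p] != 0 ->
    tau A / tau U - \sum_i tau (mpolyC 3 (c i)) * e i
      = tau (B A U (c 0) (c 1)) / tau (U * X).
  move=> /nz Un; rewrite big_ord_recl big_ord1 /e /=.
  rewrite (_ : lift _ _ = 1); last exact: val_inj.
  rewrite /B -!mul_mpolyC !tauB !tauM.
  exact: common_denominator.
exists e; split.
  move=> i; rewrite /e; case: ifP => _.
    exists 0%N, 1, 1; rewrite meval1 oner_neq0 dhomog1 rmorph1 divr1; split=> //.
  by exists 1%N, Y, X; split=> //; rewrite -v0p X0 oner_neq0.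
move=> _ [k [A [U [hA hU Up ->]]]].
have U0 : v0 U != 0 by rewrite v0p.
exists [ffun i => if i == 0 then v0 A / v0 U else (v1 A - v0 A / v0 U * v1 U) / v0 U]; split.
  rewrite BE // !ffunE /=.
  set F := B _ _ _ _.
  have hF := hB k A U (v0 A / v0 U) ((v1 A - v0 A / v0 U * v1 U) / v0 U) hA hU.
  exists (1 + (k + 1))%N, (X * F), (X * (U * X)); split.
  - exact: dhomogM.
  - by apply: dhomogM => //; apply: dhomogM.
  - by rewrite -v0p !v0M X0 mul1r mulr1.
  - apply: (idr _ _ hF); first by rewrite B0; field.
    by rewrite B1; field.
  by rewrite !tauM -mulf_div divff // mul1r.
move=> c [k' [b0 [w [hb hw wp bI E]]]]; rewrite BE // in E.
have UX : tau (U * X) != 0 by rewrite tauM mulf_neq0 // nz.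
have E' : B A U (c 0) (c 1) * w = b0 * (U * X).
  by apply: tau_inj; rewrite [LHS]tauM [RHS]tauM; apply/eqP; rewrite -(eqr_div _ _ UX (nz _ wp)) E.
have [b00 b01] := idl _ bI.
have w0 : v0 w != 0 by rewrite v0p.
have c0E : v0 A - c 0 * v0 U = 0.
  apply: (mulIf w0); rewrite mul0r -(B0 A U (c 0) (c 1)) -v0M E' v0M b00 mul0r //.
have c1E : v1 A - c 0 * v1 U - c 1 * v0 U = 0.
  have := congr1 v1 E'; rewrite !v1M b00 b01 !mul0r addr0 B0 c0E mul0r addr0 => h.
  by apply: (mulIf w0); rewrite mul0r -B1.
have c0' : c 0 = v0 A / v0 U by apply: (mulIf U0); rewrite divfK //; apply/esym/subr0_eq.
apply/ffunP => i; rewrite ffunE; case: ifP => [/eqP -> //|i1].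
have -> : i = 1 by case: i i1 => [[|[|//]] lt] //= _; apply: val_inj.
by rewrite -c0'; apply: (mulIf U0); rewrite divfK //; apply: subr0_eq.
Qed.

Lemma pencil_mult M N p a b a' b' : M *m N = 1%:M -> mulv M p =1 ept 0 ->
  a * b' - a' * b != 0 ->
  intersection_mult p (sub M (pen a b)) (sub M (pen a' b')) 2.
Proof.
move=> MN pE det.
have inj : injective (@tofrac S) by move=> f g /eqP; rewrite tofrac_eq => /eqP.
exact: (@pencil_mult_embedding {fraction S} (@tofrac S) M N p a b a' b' inj MN pE det).
Qed.

(** * The standard bitangent pencil *)

(** The exchange of x and z: a symmetry of the pencil which carries one bitangency
    point to the other. *)
Definition flip : 'M[K]_3 := \matrix_(i, j) (j == 2 - i)%:R.

Lemma flip_lform i : lform flip i = 'X_(2 - i).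
Proof.
rewrite /lform (bigD1 (2 - i)) //= mxE eqxx scale1r big1 ?addr0 // => j ne.
by rewrite mxE (negPf ne) scale0r.
Qed.

Lemma flip_mulv v i : mulv flip v i = v (2 - i).
Proof.
rewrite /mulv (bigD1 (2 - i)) //= mxE eqxx mul1r big1 ?addr0 // => j ne.
by rewrite mxE (negPf ne) mul0r.
Qed.

Lemma flipK : flip *m flip = 1%:M.
Proof.
apply/matrixP => i j; rewrite !mxE (bigD1 (2 - i)) //= big1 ?addr0 => [|k ne].
  by rewrite !mxE eqxx mul1r opprB addrC subrK eq_sym.
by rewrite mxE (negPf ne) mul0r.
Qed.

Lemma flip_pen a b : sub flip (pen a b) = pen a b.
Proof.
rewrite !penE subD !subZ subM rmorphXn /= !subX !flip_lform.
have -> : 2 - 0 = 2 :> 'I_3 by apply: val_inj.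
have -> : 2 - 2 = 0 :> 'I_3 by apply: val_inj.
have -> : 2 - 1 = 1 :> 'I_3 by apply: val_inj.
by rewrite mulrC.
Qed.

Lemma tangent_sub M F p v : \sum_j (sub M F)^`M(j).@[p] * v j =
  \sum_i F^`M(i).@[mulv M p] * mulv M v i.
Proof.
under eq_bigr => j _ do rewrite deriv_sub raddf_sum mulr_suml.
rewrite exchange_big; apply: eq_bigr => i _; rewrite mulr_sumr.
by apply: eq_bigr => j _; rewrite /= mevalZ meval_sub; ring.
Qed.

Lemma pen_tangent0 a b w : \sum_i (pen a b)^`M(i).@[ept 0] * w i = a * w 2.
Proof.
rewrite sum3 !deriv_pen !mevalZ !mevalXU /ept /=.
by rewrite !ring01.
Qed.

Lemma pencil_tangent M N p a b a' b' : M *m N = 1%:M -> mulv M p =1 ept 0 ->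
  a != 0 -> a' != 0 -> same_tangent p (sub M (pen a b)) (sub M (pen a' b')).
Proof.
move=> MN pE a0 a'0 v.
have E x y : \sum_j (sub M (pen x y))^`M(j).@[p] * v j = x * mulv M v 2.
  rewrite tangent_sub -(pen_tangent0 x y); apply: eq_bigr => i _.
  by rewrite (meval_eq _ pE).
have iff0 s1 s2 t : s1 = a * t -> s2 = a' * t -> s1 = 0 <-> s2 = 0.
  by move=> -> ->; split=> /eqP; rewrite mulf_eq0 ?(negPf a0) ?(negPf a'0) => /eqP ->; exact: mulr0.
exact: (iff0 _ _ _ (E a b) (E a' b')).
Qed.

Lemma mulv_ept N i j : mulv N (ept i) j = N j i.
Proof.
rewrite /mulv (bigD1 i) //= /ept eqxx mulr1 big1 ?addr0 // => k ne.
by rewrite eq_sym (negPf ne) mulr0.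
Qed.

Lemma mulvZ M c v i : mulv M (fun j => c * v j) i = c * mulv M v i.
Proof. by rewrite /mulv mulr_sumr; apply: eq_bigr => j _; rewrite mulrCA. Qed.

Lemma pen_same a b a' b' M : a' != 0 -> a != 0 -> a * b' - a' * b = 0 ->
  same_curve (sub M (pen a b)) (sub M (pen a' b')).
Proof.
move=> a'0 a0 e; exists (a / a'); first by rewrite mulf_neq0 ?invr_eq0.
rewrite -subZ !penE scalerDr !scalerA divfK //; congr (sub M (_ + _ *: _)).
by apply: (mulIf a'0); rewrite mulrAC divfK // mulrC -[LHS]addr0 -e; ring.
Qed.

Lemma pencil_memberP M g : pencil_member (sub M ('X_0 * 'X_2)) (sub M ('X_1 ^+ 2)) g <->
  g != 0 /\ exists a b, g = sub M (pen a b).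
Proof.
by split=> -[g0 [a [b e]]]; split=> //; exists a, b; rewrite e penE subD !subZ.
Qed.

Lemma pen_inj a b : pen a b = 0 -> a = 0 /\ b = 0.
Proof.
move=> e; have b0 : b = 0.
  have := congr1 (fun F : S => F.@[ept 1]) e; rewrite /= meval_pen meval0 /ept /= !mulr0 add0r.
  by rewrite expr1n mulr1.
have := congr1 (fun F : S => F.@[fun _ => 1]) e.
by rewrite /= meval_pen meval0 b0 mul0r addr0 !mulr1.
Qed.

Lemma bitangent_standard M N : M *m N = 1%:M ->
  bitangent_pencil (sub M ('X_0 * 'X_2)) (sub M ('X_1 ^+ 2))
    (mulv N (ept 0)) (mulv N (ept 2)).
Proof.
move=> MN; have NM := mulmx1C MN.
have ptE i : is_pt (ept i) by exists i; rewrite /ept eqxx oner_neq0.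
split.
- split.
  + have -> : 'X_0 * 'X_2 = pen 1 0 by rewrite !penE scale1r scale0r addr0.
    exact/sub_homog/pen_homog.
  + have -> : 'X_1 ^+ 2 = pen 0 1 by rewrite !penE scale1r scale0r add0r.
    exact/sub_homog/pen_homog.
  move=> a b; rewrite -!subZ -subD => /eqP; rewrite (sub_eq0 MN) => /eqP; exact: pen_inj.
- exists [:: sub M ('X_0 * 'X_2); sub M ('X_1 ^+ 2)] => g /pencil_memberP [g0 [a [b gE]]].
  move: g0; rewrite gE => g0; have [a0|a0] := eqVneq a 0.
    right; exists (sub M ('X_1 ^+ 2)); first by rewrite !inE eqxx orbT.
    have b0 : b != 0 by apply: contraNneq g0 => b0; rewrite a0 b0 !penE !scale0r addr0 raddf0.
    by exists b => //; rewrite !penE a0 scale0r add0r subZ.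
  have [b0|b0] := eqVneq b 0.
    right; exists (sub M ('X_0 * 'X_2)); first by rewrite !inE eqxx.
    by exists a => //; rewrite !penE b0 scale0r addr0 subZ.
  by left; apply: (sub_smooth MN); apply: pen_smooth.
- split; try exact: (is_pt_mulv NM).
  case=> c _ H; have := mulvK (ept 0) MN 0; rewrite (mulv_eq M H) mulvZ (mulvK _ MN) /ept /= mulr0.
  by move/eqP; rewrite eq_sym oner_eq0.
move=> g h /pencil_memberP [_ [a [b ->]]] /pencil_memberP [_ [a' [b' ->]]].
move=> /(sub_smooth NM); rewrite (subK _ MN) => /smooth_pen [a0 b0].
move=> /(sub_smooth NM); rewrite (subK _ MN) => /smooth_pen [a'0 b'0] ns.
have det : a * b' - a' * b != 0 by apply/eqP => /(pen_same M a'0 a0).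
split.
- move=> v vp; rewrite !meval_sub !meval_pen; set w := mulv M v.
  have wp : is_pt w by apply: (is_pt_mulv MN).
  have vE : v =1 mulv N w by move=> i; rewrite (mulvK _ NM).
  split=> [[e1 e2]|].
    have w1 : w 1 = 0.
      have : (a * b' - a' * b) * w 1 ^+ 2 = 0.
        transitivity (a * (a' * (w 0 * w 2) + b' * w 1 ^+ 2) - a' * (a * (w 0 * w 2) + b * w 1 ^+ 2)).
          by ring.
        by rewrite e1 e2 !mulr0 subrr.
      by move/eqP; rewrite mulf_eq0 (negPf det) expf_eq0 => /eqP.
    have /eqP : w 0 * w 2 = 0.
      by move: e1; rewrite w1 expr0n mulr0 addr0 => /eqP; rewrite mulf_eq0 (negPf a0) => /eqP.
    have wE i c : (forall j, w j = c * ept i j) -> same_pt v (mulv N (ept i)).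
      move=> wj; exists c; last by move=> j; rewrite vE -mulvZ; apply: mulv_eq.
      by case: wp => j; rewrite wj; apply: contraNneq => ->; rewrite mul0r.
    rewrite mulf_eq0 => /orP[] /eqP z; [right; apply: (wE _ (w 2))|left; apply: (wE _ (w 0))].
      by elim/ord3P; rewrite /ept /= ?z ?w1 ?mulr0 ?mulr1.
    by elim/ord3P; rewrite /ept /= ?z ?w1 ?mulr0 ?mulr1.
  have H i c : i != 1 -> (forall j, v j = c * mulv N (ept i) j) -> w 0 * w 2 = 0 /\ w 1 = 0.
    move=> i1 vj; have wj j : w j = c * ept i j.
      by rewrite /w (mulv_eq M vj) mulvZ (mulvK _ MN).
    by move: i1; elim/ord3P: i vj wj => // vj wj _; rewrite !wj /ept /= !(mulr0, mul0r).
  case=> -[c _ vj].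
    by have [-> ->] := H 0 c isT vj; rewrite expr0n /= !mulr0 !addr0.
  by have [-> ->] := H 2 c isT vj; rewrite expr0n /= !mulr0 !addr0.
- have pE : mulv M (mulv N (ept 0)) =1 ept 0 by exact: mulvK.
  split; [exact: (@pencil_tangent M N _ a b a' b' MN pE a0 a'0) | exact: (pencil_mult MN pE det)].
(* The second bitangency point is reduced to the first one by exchanging x and z. *)
have FN : (flip *m M) *m (N *m flip) = 1%:M.
  by rewrite mulmxA -(mulmxA flip) MN mulmx1 flipK.
have pE : mulv (flip *m M) (mulv N (ept 2)) =1 ept 0.
  move=> i; rewrite -mulvA flip_mulv (mulvK _ MN) /ept; congr (nat_of_bool _)%:R.
  by elim/ord3P: i.
have E x y : sub M (pen x y) = sub (flip *m M) (pen x y) by rewrite -sub_comp flip_pen.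
by rewrite !E; split; [exact: (@pencil_tangent _ _ _ a b a' b' FN pE a0 a'0) | exact: (pencil_mult FN pE det)].
Qed.

Lemma pencil_union_of_seq M (s : seq S) (c : K) : c != 0 ->
  (forall g, g \in s -> (exists a b, g = sub M (pen a b)) /\ smooth_conic g) ->
  (forall g t, perm_eq s (g :: t) -> forall h, h \in t -> ~ same_curve g h) ->
  pencil_conic_union (sub M ('X_0 * 'X_2)) (sub M ('X_1 ^+ 2)) (c *: \prod_(g <- s) g).
Proof.
move=> c0 sP sD; exists (size s), (fun i => s`_i), c; split.
- move=> i; have := sP s`_i; rewrite mem_nth // => /(_ isT) [ab sm]; split=> //.
  apply/pencil_memberP; split=> //; apply: contraTneq isT => e.
  case: sm => _ /(_ (fun=> 1)) []; last by move=> j; rewrite e mderiv0 meval0 eqxx.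
    by exists 0; rewrite oner_neq0.
  by rewrite e meval0.
- move=> i j ij.
  have si : s`_i \in s by rewrite mem_nth.
  have P : perm_eq s (s`_i :: (take i s ++ drop i.+1 s)).
    by rewrite -[X in perm_eq X _](cat_take_drop i) (drop_nth 0) // -cat_rcons -cats1 -catA perm_catCA.
  apply: (sD _ _ P); rewrite mem_cat; have : (i != j :> nat) by [].
  rewrite neq_ltn => /orP[ltij|ltji]; apply/orP.
    right; have -> : s`_j = (drop i.+1 s)`_(j - i.+1) by rewrite nth_drop subnKC.
    by rewrite mem_nth // size_drop ltn_sub2r // (leq_ltn_trans ltij).
  left; rewrite -(nth_take 0 ltji); apply: mem_nth.
  by rewrite size_take; case: ifP.
by split=> //; rewrite (big_nth 0) big_mkord.
Qed.
End Pencil.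

(** * Curves whose Bourbaki ideal is trivial or the ideal of a point *)

Section LogFields.
Variable K : numFieldType.
Local Notation S := {mpoly K[3]}.
Implicit Types (f g h F G H P : S) (M N : 'M[K]_3) (a b c : K).
Local Notation pen := (@pen K).
Local Notation ept := (@ept K).
Local Notation E := (fun i : 'I_3 => 'X_i : S).
Local Notation x := ('X_0 : S).
Local Notation y := ('X_1 : S).
Local Notation z := ('X_2 : S).

(** If [theta] preserves [A], then [H * theta] multiplies [F = A * H] by a form [Q],
    and [d * H * theta - Q * E] is a syzygy [s]. The Euler component of
    [cross rho s] is [d * g * F] by the last hypothesis, and [h * (d * F)] for the
    form [h] to which [s] corresponds; hence [h = g]. *)
Lemma bourbaki_of_factor d F rho (theta : 'I_3 -> S) (A H q g : S) :
  (0 < d)%N -> F \is d.-homog -> reduced_poly F -> syz F rho -> F = A * H ->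
  dot theta (grad A) = q * A -> dot E (cross rho theta) = g * A -> bourbaki F rho g.
Proof.
move=> d0 hF Fr rs FE tA dA; have dn0 : (d%:R : K) != 0 by rewrite pnatr_eq0 -lt0n.
pose Q := q * H + dot theta (grad H).
pose s i := (d%:R)%:MP * (H * theta i) - Q * 'X_i.
have tF : dot (fun i => H * theta i) (grad F) = Q * F.
  transitivity (H * H * dot theta (grad A) + H * A * dot theta (grad H)).
    by rewrite !dotE /grad FE !mderivM; ring.
  by rewrite tA /Q FE; ring.
have ss : syz F s.
  transitivity ((d%:R)%:MP * dot (fun i => H * theta i) (grad F) - Q * dot E (grad F)).
    by rewrite /s !dotE; ring.
  by rewrite tF (euler hF) -mul_mpolyC; ring.
have [h hE] := syz_cross d0 hF Fr rs ss.
have e1 : dot E (cross rho s) = (d%:R)%:MP * g * F.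
  transitivity ((d%:R)%:MP * (H * dot E (cross rho theta))).
    by rewrite /s !dotE !crossE; ring.
  by rewrite dA FE; ring.
have e2 : dot E (cross rho s) = h * ((d%:R)%:MP * F).
  by rewrite mul_mpolyC -(euler hF) !dotE !hE /grad; ring.
have hg : h = g.
  have [F0 _] := Fr; have c0 : (d%:R)%:MP * F != 0 :> S by rewrite mulf_neq0 // mpolyC_eq0.
  by apply: (mulIf c0); rewrite -e2 e1; ring.
by exists s => // i; rewrite hE hg.
Qed.

Lemma bourbaki_unit F rho c : c != 0 -> bourbaki F rho (c%:MP) -> bourbaki F rho 1.
Proof.
move=> c0 h; have -> : 1 = (c^-1)%:MP * c%:MP :> S by rewrite -mpolyCM mulVf.
exact: bourbakiM.
Qed.

Lemma primitive_of_entries (w : 'I_3 -> S) (i j k l : 'I_3) a b : k != l -> a != 0 -> b != 0 ->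
  w i = a *: 'X_k -> w j = b *: 'X_l -> primitive w.
Proof.
move=> kl a0 b0 wi wj; split.
  by exists i; rewrite wi scaler_eq0 negb_or a0 -msize_poly_eq0 msizeX.
move=> p [p0 pU pP]; apply: NNPP => NH.
have D m c n : c != 0 -> w m = c *: 'X_n -> exists u, 'X_n = p * u.
  move=> c0 e; have [u uE] : dvdr p (w m) by apply: NNPP => nd; apply: NH; exists m.
  by exists (c^-1 *: u); rewrite -scalerAr -uE e scalerA mulVf // scale1r.
have [u uE] := D i a k a0 wi; have [v vE] := D j b l b0 wj.
have [|t tE] := @dvd_Xn _ 1 k l u v kl.
  by rewrite !expr1 uE vE; ring.
case/negP: pU; apply/unitrP; exists t.
have Xn0 : 'X_k != 0 :> S by rewrite -msize_poly_eq0 msizeX.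
suff e : p * t = 1 by rewrite mulrC e.
by apply: (mulfI Xn0); rewrite mulr1 [RHS]uE tE expr1; ring.
Qed.

Lemma vec3_homog n (a b c : S) : a \is n.-homog -> b \is n.-homog -> c \is n.-homog ->
  forall i, vec3 a b c i \is n.-homog.
Proof. by move=> ha hb hc; elim/ord3P. Qed.

Definition extremal d f :=
  [/\ (6 <= d)%N, f \is d.-homog, reduced_poly f & total_tjurina f (d ^ 2 - 3 * d + 2)%N].

Lemma extremal_sub M N d f : M *m N = 1%:M -> extremal d f -> extremal d (sub M f).
Proof.
move=> MN [d6 hf fr tau]; split=> //; first exact: sub_homog.
  exact: (sub_reduced MN).
exact: (sub_tjurina MN).
Qed.

(** If I = R, the codimension formula makes tau equal to (d - 1)^2 or to
    (d - 1)^2 - (d - 2), according to [r], which is too large. *)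
Lemma no_unit_bourbaki d F rho r : extremal d F -> (r <= 1)%N -> syz_data d F r rho ->
  ~ bourbaki F rho 1.
Proof.
move=> [d6 _ _ tau] r1 sd b1; have rd : (r <= d.-1)%N by lia.
have := tjurina_bourbaki1 sd rd tau b1.
have [D dE] : exists D, d = D.+1 by exists d.-1; lia.
rewrite dE /= -!mulnn mulSn mulnS.
have : (D * 5 <= D * D)%N by rewrite leq_mul2l; lia.
case: r r1 {sd rd} => [|[|//]] _; rewrite ?mul0n ?mul1n; move: (D * D)%N => DD; lia.
Qed.

(** Excludes concurrent lines. For a form free of z the field d/dz is a syzygy, and
    [theta] = F_y d/dx - F_x d/dy kills [F]; their determinant with [E] is the
    Euler derivative of [F]. *)
Lemma no_cone d F : extremal d F -> F^`M(2) != 0.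
Proof.
move=> ex; have [d6 hF Fr _] := ex; apply/eqP => F2.
pose rho := vec3 (0 : S) 0 1.
have rs : syz F rho by rewrite /syz dotE /grad /rho /vec3 /= F2; ring.
have d0 : (0 < d)%N by lia.
have dn0 : (d%:R : K) != 0 by rewrite pnatr_eq0 -lt0n.
apply: (no_unit_bourbaki ex (leq0n 1) (rho := rho)).
  split=> //; last by apply: vec3_homog; rewrite ?dhomog0 ?dhomog1.
  split; first by exists 2; rewrite /rho /vec3 /= oner_neq0.
  move=> p [p0 pU _]; exists 2; rewrite /rho /vec3 /= => -[u uE].
  by case/negP: pU; apply/unitrP; exists u; rewrite mulrC -uE.
apply: (bourbaki_unit dn0).
apply: (bourbaki_of_factor (theta := vec3 (F^`M(1)) (- F^`M(0)) 0) (A := F) (H := 1) (q := 0) d0 hF Fr rs).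
- by rewrite mulr1.
- by rewrite dotE /grad /vec3 /=; ring.
rewrite mul_mpolyC -(euler hF) !dotE !crossE /rho /vec3 /= /grad F2; ring.
Qed.

(** Excludes lines all but one of which are concurrent. Here E - d z d/dz is a
    syzygy, and the Hamiltonian field of [G] kills [G] and z. *)
Lemma no_near_cone d F G : extremal d F -> F = z * G -> G^`M(2) != 0.
Proof.
move=> ex FE; have [d6 hF Fr _] := ex; apply/eqP => G2.
have d0 : (0 < d)%N by lia.
have dn0 : (d%:R : K) != 0 by rewrite pnatr_eq0 -lt0n.
have d1n0 : (d%:R - 1 : K) != 0.
  by rewrite -[1]/(1%:R) -natrB // pnatr_eq0 subn_eq0; lia.
pose rho := vec3 x y ((1 - d%:R) *: z).
have F2 : F^`M(2) = G by rewrite FE mderivM G2 mderivX1 /= mpolyC1; ring.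
have rs : syz F rho.
  transitivity (dot E (grad F) - d%:R *: (z * F^`M(2))).
    by rewrite !dotE /rho /vec3 /= /grad -!mul_mpolyC mpolyCB mpolyC1; ring.
  by rewrite (euler hF) F2 -FE subrr.
apply: (no_unit_bourbaki ex (leqnn 1) (rho := rho)).
  split=> //; last by apply: vec3_homog; rewrite ?dhomogZ ?homogX1.
  by apply: (@primitive_of_entries _ 0 1 0 1 1 1); rewrite ?oner_neq0 ?scale1r.
have c0 : - (d%:R * (d%:R - 1)) != 0 :> K by rewrite oppr_eq0 mulf_neq0.
apply: (bourbaki_unit c0).
have G0 : dot E (grad G) = (d%:R - 1)%:MP * G.
  have z0 : z != 0 by rewrite -msize_poly_eq0 msizeX.
  apply: (mulfI z0); have := euler hF; rewrite !dotE /grad F2 FE !mderivM !mderivX1 /= !mpolyC0 G2.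
  rewrite -mul_mpolyC mpolyCB mpolyC1 => e.
  transitivity (x * (0 * G + z * G^`M(0)) + y * (0 * G + z * G^`M(1)) + z * G - z * G); first by ring.
  by rewrite e; ring.
apply: (bourbaki_of_factor (theta := vec3 (G^`M(1)) (- G^`M(0)) 0) (A := F) (H := 1) (q := 0) d0 hF Fr rs).
- by rewrite mulr1.
- by rewrite dotE /grad /vec3 /= FE !mderivM !mderivX1 /= !mpolyC0; ring.
transitivity (- (d%:R)%:MP * z * dot E (grad G)).
  by rewrite !dotE !crossE /rho /vec3 /= /grad G2 -!mul_mpolyC mpolyCB mpolyC1; ring.
by rewrite G0 FE mpolyCN mpolyCM; ring.
Qed.

(** The field x d/dx - z d/dz. It kills xz and y, hence all the conics [pen a b]. *)
Definition torus : 'I_3 -> S := vec3 x 0 (- z).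

Lemma torus_syz d F c : (0 < d)%N -> F \is d.-homog -> reduced_poly F ->
  dot torus (grad F) = c *: F ->
  exists e : K, syz_data d F 1 (vec3 ((1 - e) *: x) ((- e) *: y) ((- 1 - e) *: z)).
Proof.
move=> d0 hF Fr tF; have dn0 : (d%:R : K) != 0 by rewrite pnatr_eq0 -lt0n.
pose e := c / d%:R; exists e; split=> //.
- have [e0|e0] := eqVneq e 0.
    apply: (@primitive_of_entries _ 0 2 0 2 1 (-1)); rewrite ?oppr_eq0 ?oner_neq0 //.
      by rewrite /vec3 /= e0 subr0.
    by rewrite /vec3 /= e0 subr0.
  have [e1|e1] := eqVneq (1 - e) 0.
    apply: (@primitive_of_entries _ 1 2 1 2 (- e) (-1 - e)); rewrite ?oppr_eq0 //.
    move/subr0_eq: e1 => <-; rewrite -opprD oppr_eq0 -mulr2n pnatr_eq0 //.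
  by apply: (@primitive_of_entries _ 0 1 0 1 (1 - e) (- e)); rewrite ?oppr_eq0.
- by apply: vec3_homog; apply: dhomogZ; apply: homogX1.
transitivity (dot torus (grad F) - e *: dot E (grad F)).
  by rewrite !dotE /torus /vec3 /= -!mul_mpolyC !(mpolyCB, mpolyCN) mpolyC1; ring.
by rewrite tF (euler hF) scalerA divfK // subrr.
Qed.

Lemma mpolyC_mul2 c : (c *+ 2)%:MP = 2 * c%:MP :> S.
Proof. by rewrite mpolyCMn mulr_natl. Qed.

Lemma mpolyC_half c : c%:MP = 2 * (c / 2)%:MP :> S.
Proof. by rewrite -(mpolyC_nat 3) -mpolyCM mulrC divfK // pnatr_eq0. Qed.

(** The line x = 0 is tangent to the conics of the pencil at [ept 2]. The field
    (a/2) x d/dy - b y d/dz kills both x and axz + by^2, and its determinant with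
    [E] and [torus] is their product. *)
Lemma no_tangent_x d F c a b H : extremal d F -> dot torus (grad F) = c *: F ->
  F = x * pen a b * H -> False.
Proof.
move=> ex tF FE; have [d6 hF Fr _] := ex; have d0 : (0 < d)%N by lia.
have [e sd] := torus_syz d0 hF Fr tF.
apply: (no_unit_bourbaki ex (leqnn 1) sd).
apply: (bourbaki_of_factor (theta := vec3 0 ((a / 2) *: x) (- (b *: y))) (q := 0) d0 hF Fr (sd_syz sd) FE).
  rewrite dotE /vec3 /= /grad !mderivM !mderivX1 !deriv_pen /= !mpolyC0 -!mul_mpolyC.
  by rewrite mpolyC_mul2 (mpolyC_half a); ring.
rewrite dotE !crossE /vec3 /= penE -!mul_mpolyC !(mpolyCB, mpolyCN) mpolyC1 (mpolyC_half a); ring.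
Qed.

(** Follows from [no_tangent_x] by exchanging x and z, which changes the sign of
    [torus]. *)
Lemma no_tangent_z d F c a b H : extremal d F -> dot torus (grad F) = c *: F ->
  F = z * pen a b * H -> False.
Proof.
move=> ex tF FE; have [d6 hF Fr _] := ex; have fK := flipK K.
apply: (@no_tangent_x d (sub (flip K) F) (- c) a b (sub (flip K) H)).
- exact: (extremal_sub fK).
- have /(congr1 (sub (flip K))) := tF.
  rewrite subZ !dotE !subD !subM /torus /vec3 /= raddfN raddf0 /= !subX !flip_lform.
  have f0 : 2 - 0 = 2 :> 'I_3 by apply: val_inj.
  have f2 : 2 - 2 = 0 :> 'I_3 by apply: val_inj.
  have f1 : 2 - 1 = 1 :> 'I_3 by apply: val_inj.
  rewrite f0 f2 /grad => e; rewrite scaleNr -e !deriv_sub !sum3 !mxE f0 f1 f2 /=.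
  rewrite !scale0r !scale1r; ring.
rewrite FE !subM flip_pen subX flip_lform; congr ('X__ * _ * _); exact: val_inj.
Qed.

Lemma nilpotent_data d F a b : (0 < d)%N -> F \is d.-homog -> reduced_poly F -> a != 0 -> b != 0 ->
  syz F (vec3 ((b *+ 2) *: y) ((- a) *: z) 0) ->
  syz_data d F 1 (vec3 ((b *+ 2) *: y) ((- a) *: z) 0).
Proof.
move=> d0 hF Fr a0 b0 rs; split=> //.
  by apply: (@primitive_of_entries _ 0 1 1 2 (b *+ 2) (- a)); rewrite ?oppr_eq0 ?mulrn_eq0.
by apply: vec3_homog; rewrite ?dhomog0 ?dhomogZ // homogX1.
Qed.

(** If no coefficient vanishes, this conic meets [pen a b] only in (1:0:0), with
    multiplicity 4. *)
Definition hyperpen a b (ai bi : K) : S := ai *: pen a b + bi *: z ^+ 2.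

Lemma deriv_hyperpen a b ai bi : ((hyperpen a b ai bi)^`M(0) = ai *: (a *: z)) *
  ((hyperpen a b ai bi)^`M(1) = ai *: ((b *+ 2) *: y)) *
  ((hyperpen a b ai bi)^`M(2) = ai *: (a *: x) + (bi *+ 2) *: z).
Proof.
rewrite /hyperpen !mderivD !mderivZ !deriv_pen expr2 !mderivM !mderivX1 /= !mpolyC0 !mpolyC1.
rewrite !(mul0r, mulr0, mul1r, mulr1, addr0, scaler0).
by split; [split | rewrite scalerDl scalerDr].
Qed.

(** The coefficients of the fields used below: [h] is half of [a], and [k] makes these
    fields kill the conic [hyperpen a b a1 b1]. *)
Lemma hyperpen_constants a a1 b1 : a != 0 -> a1 != 0 -> exists h k : K,
  [/\ b1%:MP = - (h%:MP * a1%:MP * k%:MP) :> S, a%:MP = 2 * h%:MP :> S,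
      a1%:MP * (- (2 / a1))%:MP = - 2 :> S & a1%:MP != 0 :> S].
Proof.
move=> a0 a10; pose h := a / 2; exists h, (- (b1 / (h * a1))).
have h0 : h != 0 by rewrite mulf_neq0 // invr_eq0 pnatr_eq0.
split; [|exact: mpolyC_half| |by rewrite mpolyC_eq0].
  by rewrite -!mpolyCM -mpolyCN; congr (_%:MP); rewrite mulrN opprK mulrC divfK // mulf_neq0.
by rewrite -mpolyCM mulrN mulrC divfK // mpolyCN mpolyC_nat.
Qed.

Lemma no_hyperosculating_line d F a b a1 b1 H : extremal d F -> a != 0 -> b != 0 -> a1 != 0 ->
  syz F (vec3 ((b *+ 2) *: y) ((- a) *: z) 0) -> F = z * hyperpen a b a1 b1 * H -> False.
Proof.
move=> ex a0 b0 a10 rs FE; have [d6 hF Fr _] := ex; have d0 : (0 < d)%N by lia.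
have sd := nilpotent_data d0 hF Fr a0 b0 rs.
apply: (no_unit_bourbaki ex (leqnn 1) sd).
have c0 : - (2 / a1) != 0 by rewrite oppr_eq0 mulf_neq0 ?invr_eq0 ?pnatr_eq0.
apply: (bourbaki_unit c0).
have [h [k [b1E aE cE a1C]]] := hyperpen_constants b1 a0 a10.
(* The field [theta] maps z to itself and kills the conic, by the choice of [k]. *)
apply: (bourbaki_of_factor (theta := vec3 (k *: z - x) 0 z) (q := 1) d0 hF Fr rs FE).
  rewrite dotE /vec3 /= /grad !mderivM !mderivX1 !deriv_hyperpen /= !mpolyC0 !mpolyC1.
  by rewrite /hyperpen penE -!mul_mpolyC !mpolyC_mul2 aE b1E; ring.
apply: (mulfI a1C); rewrite [RHS]mulrA cE.
rewrite dotE !crossE /vec3 /= /hyperpen penE -!mul_mpolyC !mpolyC_mul2 !mpolyCN aE b1E; ring.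
Qed.

Lemma no_hyperosculating_conics d F a b a1 b1 a2 b2 H : extremal d F -> a != 0 -> b != 0 -> a1 != 0 ->
  syz F (vec3 ((b *+ 2) *: y) ((- a) *: z) 0) ->
  F = hyperpen a b a1 b1 * hyperpen a b a2 b2 * H -> False.
Proof.
move=> ex a0 b0 a10 rs FE; have [d6 hF Fr _] := ex; have d0 : (0 < d)%N by lia.
have sd := nilpotent_data d0 hF Fr a0 b0 rs.
apply: (no_unit_bourbaki ex (leqnn 1) sd).
have c0 : - (2 / a1) != 0 by rewrite oppr_eq0 mulf_neq0 ?invr_eq0 ?pnatr_eq0.
apply: (bourbaki_unit c0).
have [h [k [b1E aE cE a1C]]] := hyperpen_constants b1 a0 a10.
pose P2 := hyperpen a b a2 b2.
(* The field [th] satisfies th(z) = P2 and th(axz + by^2) = a k z P2; this and the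
choice of [k] imply that it kills the first conic. *)
pose th := vec3 (k *: P2 - (a * a2) *: x ^+ 2 - b2 *: (x * z)) (- ((h * a2) *: (x * y))) P2.
pose q : S := (2 * b2%:MP + a%:MP * a2%:MP * k%:MP) * z.
apply: (bourbaki_of_factor (theta := th) (q := q) d0 hF Fr rs FE).
  rewrite dotE /th /q /vec3 /= /grad !mderivM /P2 !deriv_hyperpen /= /hyperpen !penE.
  by rewrite -!mul_mpolyC !mpolyC_mul2 !mpolyCM aE b1E; ring.
apply: (mulfI a1C); rewrite [RHS]mulrA cE.
rewrite dotE !crossE /th /vec3 /P2 /= /hyperpen !penE -!mul_mpolyC !mpolyC_mul2 !mpolyCN !mpolyCM aE b1E; ring.
Qed.

(** The fields (a/2) x d/dy - b y d/dz and - b y d/dx + (a/2) z d/dy kill the conic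
    and show that x and z lie in the Bourbaki ideal of [torus]. The ideal vanishes
    at (0:1:0), because the second entry of a vector product with [torus] does and
    the y-derivative of [F] does not. It is thus the ideal of this point. *)
Lemma nearly_free_tjurina d F a b H : (3 <= d)%N -> F \is d.-homog -> reduced_poly F ->
  dot torus (grad F) = 0 -> F = pen a b * H -> F.@[ept 1] != 0 ->
  total_tjurina F (d ^ 2 - 3 * d + 2)%N.
Proof.
move=> d3 hF Fr rs FE F1; have d0 : (0 < d)%N by lia.
have sd : syz_data d F 1 torus.
  split=> //.
    apply: (@primitive_of_entries _ 0 2 0 2 1 (-1)); rewrite ?oppr_eq0 ?oner_neq0 //.
      by rewrite /torus /vec3 /= scale1r.
    by rewrite /torus /vec3 /= scaleN1r.
  by apply: vec3_homog; rewrite ?dhomog0 ?rpredN ?homogX1.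
have Ix : bourbaki F torus x.
  apply: (bourbaki_of_factor (theta := vec3 0 ((a / 2) *: x) (- (b *: y))) (q := 0) d0 hF Fr rs FE).
    rewrite dotE /vec3 /= /grad !deriv_pen -!mul_mpolyC.
    by rewrite mpolyC_mul2 (mpolyC_half a); ring.
  rewrite dotE !crossE /torus /vec3 /= penE -!mul_mpolyC (mpolyC_half a); ring.
have Iz : bourbaki F torus z.
  apply: (bourbaki_of_factor (theta := vec3 (- (b *: y)) ((a / 2) *: z) 0) (q := 0) d0 hF Fr rs FE).
    rewrite dotE /vec3 /= /grad !deriv_pen -!mul_mpolyC.
    by rewrite mpolyC_mul2 (mpolyC_half a); ring.
  rewrite dotE !crossE /torus /vec3 /= penE -!mul_mpolyC (mpolyC_half a); ring.
have I1 h : bourbaki F torus h -> h.@[ept 1] = 0.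
  case=> s ss sE; have e := sE 1; rewrite crossE /torus /vec3 /= in e.
  have d1 : F^`M(1).@[ept 1] != 0.
    have := congr1 (fun G : S => G.@[ept 1]) (euler hF).
    rewrite /= dotE /grad !mevalD !mevalM !mevalXU mevalZ /ept /= !mul0r mul1r addr0 add0r => ->.
    by rewrite mulf_neq0 // pnatr_eq0 -lt0n.
  apply: (mulIf d1); rewrite mul0r -mevalM -e mevalB !mevalM mevalN !mevalXU /ept /=; ring.
apply: (codim_tjurina sd); first by lia.
move=> k.
have lin : linear (fun h : dhomog 3 K k => ((h : S).@[ept 1] : K^o)).
  by move=> c u v; rewrite /= mevalD mevalZ.
have [L LE] := linear_hom lin; exists (lker L).
have LP (h : dhomog 3 K k) : h \in lker L <-> (h : S).@[ept 1] = 0.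
  by rewrite memv_ker LE; split=> /eqP.
split.
  move=> h; rewrite LP; split=> [h0|]; last exact: I1.
  have [s [t ->]] := vanish_ept1 (dhomog_is_dhomog h) h0.
  by apply: bourbakiD; rewrite mulrC; apply: bourbakiM.
rewrite (dim_vanishing _ LP); last by exists 1; rewrite /ept eqxx oner_neq0.
have [D dE] : exists D, d = D.+1 by exists d.-1; lia.
rewrite dE /= -!mulnn mulSn mulnS.
have : (D * 2 <= D * D)%N by rewrite leq_mul2l; lia.
rewrite mul1n; move: (D * D)%N => DD; lia.
Qed.
End LogFields.

(** * Conics as quadratic forms, and the normal form of a bitangent pencil *)

Section TangentFields.
Variable K : numFieldType.
Local Notation S := {mpoly K[3]}.
Implicit Types (f g h F G H L P Q : S) (M N A : 'M[K]_3) (a b c e : K) (p q r u v w : 'I_3 -> K).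
Local Notation pen := (@pen K).
Local Notation ept := (@ept K).
Local Notation x := ('X_0 : S).
Local Notation y := ('X_1 : S).
Local Notation z := ('X_2 : S).

Lemma linear_formE (L : S) : L \is 1.-homog -> L = \sum_j L@_(U_(j)) *: 'X_j.
Proof.
move=> hL; apply/mpolyP => m; rewrite raddf_sum /=.
under eq_bigr => j _ do rewrite mcoeffZ mcoeffX.
have [/eqP /mdeg1P [i /eqP ->]|dm] := eqVneq (mdeg m) 1%N.
  rewrite (bigD1 i) //= eqxx mulr1 big1 ?addr0 // => j ji.
  by rewrite eq_mnm1 (negPf ji) mulr0.
rewrite (dhomog_nemf_coeff hL dm) big1 // => j _.
by case: eqP => [e|]; rewrite ?mulr0 //; move: dm; rewrite -e mdeg1.
Qed.

Definition hess Q : 'M[K]_3 := \matrix_(i, j) (Q^`M(i))@_(U_(j)).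

Lemma grad_hess Q i : Q \is 2.-homog -> Q^`M(i) = lform (hess Q) i.
Proof.
move=> hQ; rewrite [LHS]linear_formE; last exact: (deriv_homog i hQ).
by apply: eq_bigr => j _; rewrite mxE.
Qed.

Lemma hess_sym Q i j : hess Q i j = hess Q j i.
Proof.
rewrite !mxE !mcoeff_deriv !mnm1E addmC; congr (_ *+ _).
by rewrite eq_sym.
Qed.

Lemma meval_lform M i v : (lform M i).@[v] = mulv M v i.
Proof. by rewrite /lform raddf_sum; apply: eq_bigr => j _; rewrite /= mevalZ mevalXU. Qed.

Lemma meval_deriv2 Q i v : Q \is 2.-homog -> Q^`M(i).@[v] = mulv (hess Q) v i.
Proof. by move=> hQ; rewrite grad_hess // meval_lform. Qed.

Definition polar Q u v : K := dot u (mulv (hess Q) v).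

Lemma mulv3 M v i : mulv M v i = M i 0 * v 0 + M i 1 * v 1 + M i 2 * v 2.
Proof. exact: sum3. Qed.

Lemma polar_sym Q u v : polar Q u v = polar Q v u.
Proof.
rewrite /polar !dotE !mulv3 (hess_sym Q 1 0) (hess_sym Q 2 0) (hess_sym Q 2 1); ring.
Qed.

Lemma polar_quad Q v : Q \is 2.-homog -> polar Q v v = 2 * Q.@[v].
Proof.
move=> hQ; have := congr1 (fun G : S => G.@[v]) (euler hQ).
rewrite /= mevalZ => <-; rewrite /polar !dotE /grad !mevalD !mevalM !mevalXU.
by rewrite !meval_deriv2.
Qed.

Lemma hess_sub N Q i j : Q \is 2.-homog ->
  hess (sub N Q) i j = polar Q (fun k => N k i) (fun k => N k j).
Proof.
move=> hQ; rewrite mxE deriv_sub raddf_sum /= /polar /dot; apply: eq_bigr => k _.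
by rewrite mcoeffZ grad_hess // sub_lform mcoeff_lform mxE.
Qed.

Lemma two_neq0 : (2 : K) != 0. Proof. by rewrite pnatr_eq0. Qed.

Lemma quad_hess Q : Q \is 2.-homog -> 2 *: Q = \sum_i \sum_j hess Q i j *: ('X_i * 'X_j).
Proof.
move=> hQ; rewrite -(euler hQ) /dot; apply: eq_bigr => i _.
rewrite /grad grad_hess // /lform mulr_sumr; apply: eq_bigr => j _.
by rewrite -scalerAr.
Qed.

Lemma pen_of_hess Q : Q \is 2.-homog -> hess Q 0 0 = 0 -> hess Q 2 2 = 0 ->
  hess Q 0 1 = 0 -> hess Q 1 2 = 0 -> Q = pen (hess Q 0 2) (hess Q 1 1 / 2).
Proof.
move=> hQ h00 h22 h01 h12; apply: (scalerI two_neq0); rewrite quad_hess // !sum3.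
rewrite (hess_sym Q 1 0) (hess_sym Q 2 0) (hess_sym Q 2 1) h00 h22 h01 h12 !scale0r.
rewrite penE scalerDr !scalerA (mulrC 2 (_ / _)) divfK ?two_neq0 //.
by rewrite -!mul_mpolyC !mpolyCM mpolyC_nat; ring.
Qed.

(** By Euler's relation, a vector killed by the Hessian is a singular point of the
    conic. *)
Lemma smooth_nondeg Q v : smooth_conic Q -> is_pt v -> exists i, mulv (hess Q) v i != 0.
Proof.
move=> [hQ sm] vp; apply: exists_neq0 => zz.
have Qv : Q.@[v] = 0.
  by apply: (mulfI two_neq0); rewrite mulr0 -polar_quad // /polar dotE !zz !mulr0 !addr0.
by have [k] := sm _ vp Qv; rewrite meval_deriv2 // zz eqxx.
Qed.

Lemma same_pt_cross p q : is_pt p -> is_pt q -> cross p q =1 (fun=> 0) -> same_pt p q.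
Proof.
move=> [j pj] [k qk] /cross_eq0 e.
have pE i : p i = p k / q k * q i.
  by apply: (mulIf qk); rewrite e; field.
exists (p k / q k) => //; apply: contraNneq pj => z0.
by rewrite pE z0 mul0r.
Qed.

(** Cramer's rule: the inverse of a matrix with given columns has vector products
    of the columns as its rows. *)
Lemma dual_frame p r q : dot q (cross p r) != 0 -> exists M N : 'M[K]_3,
  [/\ M *m N = 1%:M, forall j, N j 0 = p j, forall j, N j 1 = r j & forall j, N j 2 = q j].
Proof.
move=> D0; set D := dot q (cross p r) in D0.
exists (\matrix_(i, j) (vec3 (cross r q j) (cross q p j) (cross p r j) i / D)).
exists (\matrix_(i, j) vec3 (p i) (r i) (q i) j).
split; try by move=> j; rewrite mxE.
apply/matrixP => i j; rewrite !mxE sum3 !mxE.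
apply: (mulIf D0).
transitivity (vec3 (cross r q 0) (cross q p 0) (cross p r 0) i * vec3 (p 0) (r 0) (q 0) j
  + vec3 (cross r q 1) (cross q p 1) (cross p r 1) i * vec3 (p 1) (r 1) (q 1) j
  + vec3 (cross r q 2) (cross q p 2) (cross p r 2) i * vec3 (p 2) (r 2) (q 2) j).
  by field.
by elim/ord3P: i; elim/ord3P: j; rewrite /vec3 /= /D !dotE !crossE; ring.
Qed.

(** The frame consists of [p], [q] and the pole of the line joining them, the vector
    product of the gradients [P] and [R] at [p] and [q]. It is a frame unless
    [polar Q p q] vanishes. In that case [P] and [R] are both parallel to
    [cross p q], so that a combination of [p] and [q] is killed by the Hessian. *)
Lemma conic_frame Q p q : smooth_conic Q -> is_pt p -> is_pt q -> ~ same_pt p q ->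
  Q.@[p] = 0 -> Q.@[q] = 0 -> exists M N : 'M[K]_3,
  [/\ M *m N = 1%:M, mulv N (ept 0) =1 p, mulv N (ept 2) =1 q,
      polar Q p (mulv N (ept 1)) = 0 & polar Q q (mulv N (ept 1)) = 0].
Proof.
move=> sm pp qp npq Qp Qq; have [hQ _] := sm.
pose P := mulv (hess Q) p; pose R := mulv (hess Q) q.
have pP : dot p P = 0 by rewrite -/(polar Q p p) polar_quad // Qp mulr0.
have qR : dot q R = 0 by rewrite -/(polar Q q q) polar_quad // Qq mulr0.
have pR : dot p R = dot q P by rewrite -/(polar Q p q) polar_sym.
have b0 : dot q P != 0.
  apply/eqP => b0; have [k wk] : exists k, cross p q k != 0.
    by apply: exists_neq0 => z; apply: npq; apply: same_pt_cross.
  have wP : cross (cross p q) P =1 (fun=> 0).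
    by move=> i; rewrite triple_cross pP b0 !mul0r subrr.
  have wR : cross (cross p q) R =1 (fun=> 0).
    by move=> i; rewrite triple_cross pR qR b0 !mul0r subrr.
  have eP := cross_eq0 wP; have eR := cross_eq0 wR.
  pose n i := R k * p i - P k * q i.
  have Bn i : mulv (hess Q) n i = 0.
    have -> : mulv (hess Q) n i = R k * P i - P k * R i.
      by rewrite /n /P /R !mulv3; ring.
    apply: (mulfI wk); rewrite mulr0.
    transitivity (R k * (cross p q k * P i) - P k * (cross p q k * R i)); first by ring.
    by rewrite (eP k i) (eR k i); ring.
  have n0 i : n i = 0.
    apply/eqP; apply: contraT => ni; have [|j] := smooth_nondeg sm (v := n); first by exists i.
    by rewrite Bn eqxx.
  have [Rk|Rk] := eqVneq (R k) 0.
    have [Pk|Pk] := eqVneq (P k) 0.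
      have [j] := smooth_nondeg sm pp; case/eqP.
      by apply: (mulfI wk); rewrite mulr0 -/(P) eP Pk mulr0.
    have [j qj] := qp; case/eqP: qj; apply: (mulfI Pk).
    by have := n0 j; rewrite /n Rk mul0r sub0r mulr0 => /eqP; rewrite oppr_eq0 => /eqP.
  apply: npq; have pE i : p i = P k / R k * q i.
    by apply: (mulfI Rk); have /subr0_eq -> := n0 i; field.
  exists (P k / R k) => //; case: pp => j; rewrite pE; apply: contraNneq => ->.
  by rewrite mul0r.
have D0 : dot q (cross p (cross P R)) != 0.
  have -> : dot q (cross p (cross P R)) = dot p R * dot q P - dot p P * dot q R.
    by rewrite !dotE !crossE; ring.
  by rewrite pP pR mul0r subr0 mulf_neq0.
have [M [N [MN Np Nr Nq]]] := dual_frame D0.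
have rE i : mulv N (ept 1) i = cross P R i by rewrite mulv_ept Nr.
exists M, N; split=> //.
- by move=> i; rewrite mulv_ept Np.
- by move=> i; rewrite mulv_ept Nq.
- rewrite polar_sym /polar -/P -(dot_crossl P R) [RHS]dotE dotE !rE; ring.
rewrite polar_sym /polar -/R -(dot_crossr P R) [RHS]dotE dotE !rE; ring.
Qed.

Lemma eq_polar Q u u' v v' : u =1 u' -> v =1 v' -> polar Q u v = polar Q u' v'.
Proof. by move=> e1 e2; rewrite /polar !dotE !mulv3 !e1 !e2. Qed.

Lemma conic_frame_pen N G : G \is 2.-homog ->
  G.@[mulv N (ept 0)] = 0 -> G.@[mulv N (ept 2)] = 0 ->
  polar G (mulv N (ept 0)) (mulv N (ept 1)) = 0 -> polar G (mulv N (ept 2)) (mulv N (ept 1)) = 0 ->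
  exists a b, sub N G = pen a b.
Proof.
move=> hG G0 G2 G01 G21; eexists; eexists; apply: pen_of_hess; first exact: sub_homog.
- by rewrite hess_sub // -[RHS](mulr0 2) -G0 -polar_quad //; apply: eq_polar => k; rewrite mulv_ept.
- by rewrite hess_sub // -[RHS](mulr0 2) -G2 -polar_quad //; apply: eq_polar => k; rewrite mulv_ept.
- by rewrite hess_sub // -[RHS]G01; apply: eq_polar => k; rewrite mulv_ept.
by rewrite hess_sub // polar_sym -[RHS]G21; apply: eq_polar => k; rewrite mulv_ept.
Qed.

(** Different parameters give different curves, so that each curve of [s] excludes
    at most one parameter. *)
Lemma pencil_avoid (q1 q2 : S) (s : seq S) (ts : seq K) :
  (forall a b, a *: q1 + b *: q2 = 0 -> a = 0 /\ b = 0) -> uniq ts -> (size s < size ts)%N ->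
  exists2 t, t \in ts & forall h, h \in s -> ~ same_curve (q1 + t *: q2) h.
Proof.
move=> ind; elim: s ts => [|h s IH] ts uts sz.
  by case: ts uts sz => [//|t ts] _ _; exists t; rewrite ?mem_head.
have [[t0 t0s hs]|no] := classic (exists2 t, t \in ts & same_curve (q1 + t *: q2) h).
  have [||t tt tP] := IH (rem t0 ts); first by rewrite rem_uniq.
    by rewrite size_rem // -ltnS; apply: (leq_trans sz); case: (ts) t0s.
  exists t; first exact: mem_rem tt.
  move=> h'; rewrite inE => /orP[/eqP -> |]; last exact: tP.
  case: hs => c c0 e0 [c' c'0 e1].
  have : (c' - c) *: q1 + (c' * t0 - c * t) *: q2 = 0.
    have : c' *: (q1 + t0 *: q2) - c *: (q1 + t *: q2) = 0.
      by rewrite e0 e1 !scalerA mulrC subrr.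
    by move=> <-; rewrite -!mul_mpolyC !(mpolyCB, mpolyCM); ring.
  case/ind => /subr0_eq cc /subr0_eq; rewrite cc => /(mulfI c0) t0t.
  by move: tt; rewrite t0t mem_rem_uniq // inE eqxx.
have [|t tt tP] := IH ts uts; first by apply: ltnW.
exists t => // h'; rewrite inE => /orP[/eqP -> hh|]; last exact: tP.
by apply: no; exists t.
Qed.

Lemma pen_comb a b a' b' c e : c *: pen a b + e *: pen a' b' = pen (c * a + e * a') (c * b + e * b').
Proof. by rewrite !penE !scalerDr !scalerA !scalerDl addrACA. Qed.

(** Two different smooth members [g] and [h] exist, since only finitely many
    members are excluded. In the frame attached to [g], [p] and [q], the form [h]
    also has the shape axz + by^2, because it has the same tangents as [g] at [p] and
    [q]. The pencil is spanned by [g] and [h]. *)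
Lemma bitangent_normal_form (q1 q2 : S) p q : bitangent_pencil q1 q2 p q ->
  exists M N : 'M[K]_3, [/\ M *m N = 1%:M, mulv N (ept 0) =1 p, mulv N (ept 2) =1 q &
    forall g, pencil_member q1 q2 g -> exists a b, g = sub M (pen a b)].
Proof.
move=> [[hq1 hq2 ind] [s sP] [pp qp npq] tg].
pose ts n := [seq (i%:R : K) | i <- iota 0 n].
have uts n : uniq (ts n).
  by rewrite map_inj_uniq ?iota_uniq // => i j /eqP; rewrite eqr_nat => /eqP.
have mem t : pencil_member q1 q2 (q1 + t *: q2).
  split; last by exists 1, t; rewrite scale1r.
  by apply/eqP => e; have [|/eqP] := ind 1 t; rewrite ?scale1r // oner_eq0.
have smooth_of t : (forall h, h \in s -> ~ same_curve (q1 + t *: q2) h) ->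
    smooth_conic (q1 + t *: q2).
  by move=> H; case: (sP _ (mem t)) => // -[h /H nh /nh].
have [t1 _ t1P] : exists2 t, t \in ts (size s).+1 &
    forall h, h \in s -> ~ same_curve (q1 + t *: q2) h.
  by apply: pencil_avoid; rewrite ?size_map ?size_iota.
pose g := q1 + t1 *: q2; have gsm : smooth_conic g by apply: smooth_of.
have [t2 _ t2P] : exists2 t, t \in ts (size s).+2 &
    forall h, h \in g :: s -> ~ same_curve (q1 + t *: q2) h.
  by apply: pencil_avoid; rewrite ?size_map ?size_iota.
pose h := q1 + t2 *: q2; have hsm : smooth_conic h.
  by apply: smooth_of => k ks; apply: t2P; rewrite inE ks orbT.
have hg : ~ same_curve h g by apply: t2P; rewrite mem_head.
have t12 : t2 - t1 != 0.
  by rewrite subr_eq0; apply/eqP => e; apply: hg; rewrite /h e; exists 1; rewrite ?oner_neq0 ?scale1r.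
have [pts [tp _] [tq _]] := tg h g (mem t2) (mem t1) hsm gsm hg.
have [hp gp] : h.@[p] = 0 /\ g.@[p] = 0.
  by apply/(pts p pp); left; exists 1; rewrite ?oner_neq0 // => i; rewrite mul1r.
have [hq gq] : h.@[q] = 0 /\ g.@[q] = 0.
  by apply/(pts q qp); right; exists 1; rewrite ?oner_neq0 // => i; rewrite mul1r.
have [M [N [MN Np Nq gr gr']]] := conic_frame gsm pp qp npq gp gq.
have [hg2 _] := gsm; have [hh2 _] := hsm.
have tgE G u v : G \is 2.-homog -> \sum_i G^`M(i).@[u] * v i = polar G u v.
  by move=> hG; rewrite polar_sym /polar; apply: eq_bigr => i _; rewrite meval_deriv2 // mulrC.
pose r := mulv N (ept 1).
have hr : polar h p r = 0 by rewrite -tgE //; apply/tp; rewrite tgE.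
have hr' : polar h q r = 0 by rewrite -tgE //; apply/tq; rewrite tgE.
have fr G : G \is 2.-homog -> G.@[p] = 0 -> G.@[q] = 0 -> polar G p r = 0 -> polar G q r = 0 ->
    exists a b, sub N G = pen a b.
  move=> hG Gp Gq Gpr Gqr; apply: conic_frame_pen => //.
  - by rewrite (meval_eq _ Np).
  - by rewrite (meval_eq _ Nq).
  - by rewrite -[RHS]Gpr; apply: eq_polar.
  by rewrite -[RHS]Gqr; apply: eq_polar.
have [a1 [b1 gE]] := fr g hg2 gp gq gr gr'.
have [a2 [b2 hE]] := fr h hh2 hp hq hr hr'.
exists M, N; split=> // g0 [_ [a [b ->]]].
have q2E : q2 = (t2 - t1)^-1 *: (h - g).
  by rewrite /h /g opprD addrACA subrr add0r -scalerBl scalerA mulVf // scale1r.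
have q1E : q1 = g - t1 *: q2 by rewrite /g addrK.
have N2 : sub N q2 = pen ((t2 - t1)^-1 * a2 + - (t2 - t1)^-1 * a1) ((t2 - t1)^-1 * b2 + - (t2 - t1)^-1 * b1).
  by rewrite -pen_comb -hE -gE scaleNr q2E subZ subB scalerBr.
have [e [e' N1]] : exists e e', sub N q1 = pen e e'.
  by rewrite q1E subB subZ N2 gE -scaleNr -[pen a1 b1]scale1r pen_comb; eexists; eexists.
have [c [c' E]] : exists c c', sub N (a *: q1 + b *: q2) = pen c c'.
  by rewrite subD !subZ N2 N1 pen_comb; eexists; eexists.
by exists c, c'; rewrite -E (subK _ (mulmx1C MN)).
Qed.

Lemma torus_pen a b : dot (torus K) (grad (pen a b)) = 0.
Proof.
by rewrite dotE /torus /vec3 /= /grad !deriv_pen -!mul_mpolyC; ring.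
Qed.

(** The form [l] is either a constant or the line joining the bitangency points;
    the last two hypotheses are what the two cases have in common. *)
Lemma pencil_union_tjurina d f (l : S) M N (m : nat) (g : 'I_m -> S) (c : K) :
  (6 <= d)%N -> f \is d.-homog -> reduced_poly f -> M *m N = 1%:M ->
  (forall i, (exists a b, g i = sub M (pen a b)) /\ smooth_conic (g i)) ->
  c != 0 -> f = l * (c *: \prod_i g i) ->
  (exists2 e, (e <= 1)%N & l \is e.-homog) ->
  dot (torus K) (grad (sub N l)) = 0 -> (sub N l).@[ept 1] != 0 ->
  total_tjurina f (d ^ 2 - 3 * d + 2)%N.
Proof.
move=> d6 hf fr MN gP c0 fE [e e1 le] tl l1; have NM := mulmx1C MN.
have gE i : exists ab : K * K, sub N (g i) = pen ab.1 ab.2 /\ ab.2 != 0.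
  have [[a [b ->]] sm] := gP i; exists (a, b); rewrite (subK _ MN); split=> //.
  by have := sub_smooth NM sm; rewrite (subK _ MN) => /smooth_pen [].
have FE : sub N f = sub N l * (c *: \prod_i sub N (g i)).
  by rewrite fE subM subZ rmorph_prod.
have tp : dot (torus K) (grad (\prod_i sub N (g i))) = 0.
  rewrite -(big_map (fun i => sub N (g i)) xpredT id); apply: field_prod0 => _ /mapP [i _ ->].
  by have [[a b] /= [-> _]] := gE i; apply: torus_pen.
have p1 : (\prod_i sub N (g i)).@[ept 1] != 0.
  rewrite (rmorph_prod (meval (ept 1))) /=; apply/prodf_neq0 => i _.
  have [[a b] /= [-> b0]] := gE i.
  by rewrite meval_pen /ept /= mulr0 mulr0 add0r expr1n mulr1.
rewrite -(subK f NM); apply: (sub_tjurina MN).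
case: m g gP fE gE FE tp p1 => [|m] g gP fE gE FE tp p1.
  have f0 : f != 0 by case: fr.
  have : f \is e.-homog by rewrite fE big_ord0 -scalerAr mulr1 dhomogZ.
  by move/(dhomog_uniq f0 hf) => de; move: d6 e1; rewrite de; lia.
have [[a b] /= [E _]] := gE ord0.
apply: (@nearly_free_tjurina _ d _ a b (sub N l * (c *: \prod_(i < m) sub N (g (lift ord0 i))))).
- by lia.
- exact: sub_homog.
- exact: (sub_reduced NM).
- by rewrite FE field_mul field_scale tl tp scaler0 mul0r mulr0 addr0.
- by rewrite FE big_ord_recl E -!mul_mpolyC; move: (\prod_(i < m) _) (pen a b) (sub N l) => *; ring.
by rewrite FE mevalM mevalZ !mulf_neq0.
Qed.

Theorem bitangent_union_tjurina d f : (6 <= d)%N -> f \is d.-homog -> conic_line_arrangement f ->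
  type_C2 f \/ type_CL6 f -> total_tjurina f (d ^ 2 - 3 * d + 2)%N.
Proof.
move=> d6 hf [fr _] [|].
  move=> [q1 [q2 [p [q [bt [m [g [c [gP _ [c0 fE]]]]]]]]]].
  have [M [N [MN _ _ memE]]] := bitangent_normal_form bt.
  apply: (@pencil_union_tjurina d f 1 M N m g c) => //.
  - by move=> i; have [/memE ? ?] := gP i.
  - by rewrite mul1r.
  - by exists 0%N => //; rewrite dhomog1.
  - by rewrite (rmorph1 (sub N)) -(mpolyC1 3) field_const.
  by rewrite (rmorph1 (sub N)) meval1 oner_neq0.
move=> [q1 [q2 [p [q [l [h [bt [m [g [c [gP _ [c0 hE]]]]] [[l0 lh] [lp lq]] fE]]]]]]].
have [M [N [MN Np Nq memE]]] := bitangent_normal_form bt.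
have lN : sub N l = (sub N l)@_(U_(1%R)) *: y.
  rewrite [LHS]linear_formE; last exact: sub_homog.
  rewrite sum3; have L i : (sub N l)@_(U_(i)) = (sub N l).@[ept i].
    by rewrite (meval_ept i (sub_homog N lh)) mulm1n.
  by rewrite (L 0) (L 2) !meval_sub (meval_eq l Np) (meval_eq l Nq) lp lq !scale0r add0r addr0.
have u0 : (sub N l)@_(U_(1%R)) != 0.
  apply/eqP => e; move: l0; rewrite -(sub_eq0 (mulmx1C MN)) lN e scale0r eqxx //.
apply: (@pencil_union_tjurina d f l M N m g c) => //.
- by move=> i; have [/memE ? ?] := gP i.
- by rewrite fE hE.
- by exists 1%N.
- by rewrite lN field_scale dotE /torus /vec3 /= /grad !mderivX1 /= !mpolyC0 !ring01 scaler0.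
by rewrite lN mevalZ mevalXU /ept mulr1.
Qed.

(** * Linear vector fields tangent to an arrangement *)

Definition act A g : S := dot (lform A) (grad g).

Lemma actM A f g : act A (f * g) = act A f * g + f * act A g.
Proof. exact: field_mul. Qed.

Lemma actZ A c f : act A (c *: f) = c *: act A f.
Proof. exact: field_scale. Qed.

Lemma act_scalar A c f d : f \is d.-homog -> act (A - c%:M) f = act A f - (c * d%:R) *: f.
Proof.
move=> hf; rewrite -scalerA -(euler hf) /act.
have E i : lform (A - c%:M) i = lform A i - c *: 'X_i.
  rewrite /lform -[c *: 'X_i]/(c *: 'X_i); under eq_bigr => j _ do rewrite !mxE scalerBl.
  rewrite sumrB; congr (_ - _); rewrite (bigD1 i) //= eqxx big1 ?addr0 ?mulr1n // => j ji.
  by rewrite eq_sym (negPf ji) mulr0n scale0r.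
by rewrite !dotE !E -!mul_mpolyC; ring.
Qed.

Lemma act_homog A m g : (0 < m)%N -> g \is m.-homog -> act A g \is m.-homog.
Proof.
move=> m0 hg; apply: rpred_sum => i _.
by have := dhomogM (lform_homog A i) (deriv_homog i hg); rewrite add1n prednK.
Qed.

Lemma act_sub M N A g : M *m N = 1%:M -> sub N (act A g) = act (M *m A *m N) (sub N g).
Proof.
move=> MN; have NM := mulmx1C MN.
rewrite /act /dot raddf_sum /= /grad.
under [RHS]eq_bigr => j _ do rewrite deriv_sub mulr_sumr.
rewrite exchange_big /=; apply: eq_bigr => i _.
under eq_bigr => j _ do rewrite -scalerAr scalerAl.
rewrite -mulr_suml subM sub_lform; congr (_ * _).
have -> : A *m N = N *m (M *m A *m N) by rewrite -mulmxA mulmxA NM mul1mx.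
rewrite -sub_lform {1}/lform raddf_sum; apply: eq_bigr => j _.
by rewrite /= subZ subX.
Qed.

Lemma actX A i : act A 'X_i = lform A i.
Proof.
rewrite /act /dot (bigD1 i) //= /grad mderivX1 eqxx mpolyC1 mulr1 big1 ?addr0 // => m mi.
by rewrite mderivX1 eq_sym (negPf mi) mpolyC0 mulr0.
Qed.

(** The second derivatives of the eigenvalue equation: A^T B + B A = lam B for the
    Hessian [B]. *)
Lemma act_hess A lam Q i j : Q \is 2.-homog -> act A Q = lam *: Q ->
  \sum_k (A k i * hess Q k j + A k j * hess Q k i) = lam * hess Q i j.
Proof.
move=> hQ e; rewrite [hess Q i j]mxE -mcoeffZ -mderivZ -e /act /dot [in RHS](raddf_sum (mderiv i)) /= raddf_sum.
apply: eq_bigr => k _; rewrite /= /grad (grad_hess k hQ) mderivM !deriv_lform mcoeffD mcoeffCM.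
by rewrite mulrC [lform A k * _]mulrC mcoeffCM !mcoeff_lform; ring.
Qed.

Lemma decomp_perm f c s t : perm_eq s t -> decomp f c s -> decomp f c t.
Proof.
move=> st [c0 fE sP sD]; split=> //.
- by rewrite fE (perm_big _ st).
- by move=> g; rewrite -(perm_mem st); apply: sP.
by move=> g t' tt; apply: sD; apply: perm_trans tt.
Qed.

Lemma sub_dvdr M f g : dvdr f g -> dvdr (sub M f) (sub M g).
Proof. by case=> e ->; exists (sub M e); rewrite subM. Qed.

Lemma decomp_sub M N f c s : M *m N = 1%:M -> decomp f c s -> decomp (sub M f) c (map (sub M) s).
Proof.
move=> MN [c0 fE sP sD]; have NM := mulmx1C MN.
have inj : injective (sub M) by move=> g h e; rewrite -(subK g MN) e subK.
split=> //; first by rewrite fE subZ sub_prod.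
  move=> _ /mapP [g /sP [gP gL] ->]; split.
    exact/irreducible_prime/(sub_irreducible MN)/prime_irreducible.
  by case: gL => [/(sub_is_line MN)|/(sub_smooth MN)]; [left|right].
move=> g t st h ht dv.
have [g' g's gE] : exists2 g', g' \in s & g = sub M g'.
  by apply/mapP; rewrite (perm_mem st) mem_head.
have st' : perm_eq (map (sub M) (rem g' s)) t.
  rewrite -(perm_cons g); apply: perm_trans st; rewrite gE -map_cons perm_map //.
  by rewrite perm_sym perm_to_rem.
have [h' h's hE] : exists2 h', h' \in rem g' s & h = sub M h'.
  by apply/mapP; rewrite (perm_mem st').
apply: (sD g' _ (perm_to_rem g's) h' h's).
by rewrite -(subK g' MN) -(subK h' MN) -gE -hE; apply: sub_dvdr.
Qed.

Lemma decomp_uniq f c s : decomp f c s -> uniq s.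
Proof.
move=> [_ _ _ sD]; elim: s sD => // g s IH sD /=; apply/andP; split.
  apply/negP => gs; apply: (sD g s (perm_refl _) g gs).
  by exists 1; rewrite mulr1.
apply: IH => h t st k kt; apply: (sD h (g :: t)); last by rewrite inE kt orbT.
apply: (@perm_trans _ (g :: h :: t)); first by rewrite perm_cons.
exact: (permEl (perm_catCA [:: g] [:: h] t)).
Qed.

Lemma decomp_two f c s g h : decomp f c s -> g \in s -> h \in s -> g != h ->
  exists t, perm_eq s [:: g, h & t].
Proof.
move=> D gs hs gh; exists (rem h (rem g s)).
have hr : h \in rem g s by rewrite mem_rem_uniq ?(decomp_uniq D) // inE eq_sym gh.
by apply: (perm_trans (perm_to_rem gs)); rewrite perm_cons perm_to_rem.
Qed.

Lemma decomp_ndvd f c s g h : decomp f c s -> g \in s -> h \in s -> g != h -> ~ dvdr g h.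
Proof.
move=> D gs hs gh; have [t st] := decomp_two D gs hs gh; have [_ _ _ sD] := D.
by apply: (sD _ _ st); rewrite mem_head.
Qed.

(** The product rule makes [g] divide the product of its derivative with the other
    components, hence its derivative, which has the same degree. *)
Lemma component_eigen A f e c s g : decomp f c s -> act A f = e *: f -> g \in s ->
  exists lam, act A g = lam *: g.
Proof.
move=> [c0 fE sP sD] Af gs; have [[g0 gU gP] gL] := sP g gs.
pose H := \prod_(h <- rem g s) h.
have fH : f = c *: (g * H) by rewrite fE (perm_big _ (perm_to_rem gs)) big_cons.
have dv : dvdr g (act A g * H).
  exists (e *: H - act A H); apply: (scalerI c0); rewrite mulrBr scalerBr.
  have := Af; rewrite fH actZ actM scalerDr => /(canRL (addrK _)) ->.
  by rewrite -!mul_mpolyC; ring.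
case: (gP _ _ dv) => [[q qE]|/prime_dvd_prod [//|h hr gh]]; last first.
  by case: (sD g _ (perm_to_rem gs) h hr).
have [m [m0 _ hg]] := component_deg gL.
have ha := act_homog A m0 hg.
have [a0|a0] := eqVneq (act A g) 0; first by exists 0; rewrite a0 scale0r.
have q0 : q != 0 by apply: contraNneq a0; rewrite qE => ->; rewrite mulr0.
have sa : msize (act A g) = m.+1 by apply: homog_msize.
have sg : msize g = m.+1 by apply: homog_msize.
exists q@_0%MM; rewrite qE -mul_mpolyC mulrC; congr (_ * _).
apply: msize1_polyC; move: sa; rewrite qE msizeM // sg.
by move: (msize q) => n; lia.
Qed.

Lemma line_row L : is_line L -> exists u, is_pt u /\ forall i, L^`M(i) = (u i)%:MP.
Proof.
move=> [L0 hL]; exists (fun j => L@_(U_(j))%MM); split.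
  apply: exists_neq0 => z; case/eqP: L0; rewrite (linear_formE hL) big1 // => j _.
  by rewrite z scale0r.
move=> i; have := deriv_lform (\matrix_(_, j) L@_(U_(j))) i i; rewrite mxE => <-.
by rewrite [in LHS](linear_formE hL) /lform; congr (_^`M(_)); apply: eq_bigr => j _; rewrite mxE.
Qed.

Lemma line_of_row L u : L \is 1.-homog -> (forall i, L^`M(i) = (u i)%:MP) ->
  L = u 0 *: x + u 1 *: y + u 2 *: z.
Proof.
move=> hL uE; have := euler hL; rewrite scale1r => <-.
by rewrite dotE /grad !uE -!mul_mpolyC; ring.
Qed.

Lemma act_row A lam L u : (forall i, L^`M(i) = (u i)%:MP) -> act A L = lam *: L ->
  forall j, \sum_i u i * A i j = lam * u j.
Proof.
move=> uE e j; apply/eqP; rewrite -(mpolyC_eq 3) mpolyCM -uE mul_mpolyC -mderivZ -e /act /dot.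
apply/eqP; rewrite !raddf_sum; apply: eq_bigr => i _.
by rewrite /= /grad uE mulrC [lform A i * _]mulrC mul_mpolyC mderivZ deriv_lform -mul_mpolyC -mpolyCM mulrC.
Qed.

(** A constant syzygy becomes linear after multiplication by x. A scalar matrix
    acts on [f] as a multiple of the degree, so it does not kill [f] unless it is
    zero. *)
Lemma linear_field d f (r : nat) rho : (r <= 1)%N -> syz_data d f r rho ->
  exists A, (forall c, A != c%:M) /\ act A f = 0.
Proof.
move=> r1 sd; have [d0 hf fr [[k rk] _] rh rs] := sd.
suff [A [A0 Af]] : exists A, A != 0 /\ act A f = 0.
  exists A; split=> // c; apply: contra A0 => /eqP AE; have := act_scalar A c hf.
  rewrite Af sub0r AE subrr.
  have -> : act 0 f = 0.
    by rewrite /act dotE /lform !big1 ?mul0r ?addr0 // => j _; rewrite mxE scale0r.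
  move/eqP; rewrite eq_sym oppr_eq0 scaler_eq0 mulf_eq0 pnatr_eq0 -leqn0 leqNgt d0 orbF.
  by case: fr => /negPf -> _; rewrite orbF => /eqP ->; rewrite -scalemx1 scale0r.
case: r r1 rh sd => [|[|//]] _ rh sd.
  exists (\matrix_(i, j) ((rho i)@_0%MM *+ (j == 0))); split.
    apply: (contraNneq _ rk) => A0; have := congr1 (fun A : 'M[K]_3 => A k 0) A0.
    rewrite /= !mxE eqxx mulr1n => e; rewrite (msize1_polyC (p := rho k)) ?e ?mpolyC0 //.
    by rewrite (homog_msize (rh k)).
  transitivity (x * dot rho (grad f)); last by rewrite [dot _ _]rs mulr0.
  have E i : lform (\matrix_(i, j) ((rho i)@_0%MM *+ (j == 0))) i = x * rho i.
    rewrite /lform sum3 !mxE /= mulr1n !mulr0n !scale0r !addr0 -mul_mpolyC mulrC; congr (_ * _).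
    rewrite -(msize1_polyC (p := rho i)) //; have [->|ri] := eqVneq (rho i) 0; first by rewrite msize0.
    by rewrite (homog_msize (rh i)).
  by rewrite /act !dotE !E; ring.
exists (\matrix_(i, j) (rho i)@_(U_(j))%MM); split.
  apply: contraNneq rk => A0; rewrite (linear_formE (rh k)) big1 // => j _.
  have := congr1 (fun A : 'M[K]_3 => A k j) A0; rewrite /= !mxE => ->.
  by rewrite scale0r.
rewrite -[RHS]rs /act; apply: eq_bigr => i _; congr (_ * _).
by rewrite [RHS](linear_formE (rh i)); apply: eq_bigr => j _; rewrite mxE.
Qed.

(** * Arrangements of lines *)

Lemma deriv_prod0 i (s : seq S) : (forall g, g \in s -> g^`M(i) = 0) ->
  (\prod_(g <- s) g)^`M(i) = 0.
Proof.
elim: s => [|g s IH] H; first by rewrite big_nil -(mpolyC1 3) mderivC.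
rewrite big_cons mderivM H ?mem_head // IH ?mul0r ?mulr0 ?addr0 // => h hs.
by apply: H; rewrite inE hs orbT.
Qed.

(** A leading coefficient serves to define the eigenvalue as a function of [g]. *)
Definition eigval A g : K := (act A g)@_(mlead g) / g@_(mlead g).

Lemma eigvalE A g lam : g != 0 -> act A g = lam *: g -> eigval A g = lam.
Proof. by move=> g0 e; rewrite /eigval e mcoeffZ mulfK // mleadc_eq0. Qed.

Lemma line_eigenvalue A L lam : is_line L -> act A L = lam *: L -> eigenvalue A lam.
Proof.
move=> hL e; have [u [[i ui] uE]] := line_row hL; have [_ hL1] := hL.
apply/eigenvalueP; exists (\row_i u i); last first.
  by apply: contraNneq ui => /rowP /(_ i); rewrite !mxE => ->.
by apply/rowP => j; rewrite !mxE -(act_row uE e); apply: eq_bigr => k _; rewrite mxE.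
Qed.

(** The eigenvalues of the lines are roots of a characteristic polynomial of degree
    3. *)
Lemma two_same_eigenvalue f e A c (s : seq S) : decomp f c s -> act A f = e *: f ->
  (forall g, g \in s -> is_line g) -> (3 < size s)%N ->
  exists g h lam, [/\ g \in s, h \in s, g != h, act A g = lam *: g & act A h = lam *: h].
Proof.
move=> D Af sL sz; have eg g : g \in s -> exists lam, act A g = lam *: g.
  exact: component_eigen D Af.
have g0 g : g \in s -> g != 0 by move/sL => [].
have ev g : g \in s -> act A g = eigval A g *: g.
  by move=> gs; have [lam e1] := eg g gs; rewrite (eigvalE (g0 g gs) e1).
have : ~~ uniq (map (eigval A) s).
  apply/negP => U; have := max_poly_roots (p := char_poly A) _ _ U.
  rewrite size_char_poly size_map ltnNge sz /= => H; apply: notF; apply: H.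
    by rewrite -size_poly_eq0 size_char_poly.
  apply/allP => _ /mapP [g gs ->]; rewrite -eigenvalue_root_char.
  exact: (line_eigenvalue (sL g gs) (ev g gs)).
case/(uniqPn 0) => i [j [ij]]; rewrite size_map => js.
have is' : (i < size s)%N by apply: ltn_trans js.
rewrite !(nth_map 0) // => eE; exists s`_i, s`_j, (eigval A s`_i).
split; rewrite ?mem_nth //; [|by rewrite -ev // mem_nth|by rewrite eE -ev // mem_nth].
by rewrite nth_uniq ?(decomp_uniq D) // ltn_eqF.
Qed.

Lemma line_frame u v w : dot w (cross u v) != 0 -> exists M N : 'M[K]_3,
  [/\ M *m N = 1%:M, forall j, M 0 j = u j, forall j, M 1 j = v j & forall j, M 2 j = w j].
Proof.
move=> /dual_frame [M [N [MN Nu Nv Nw]]]; exists N^T, M^T.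
by split; [rewrite -trmx_mul MN trmx1 | move=> j; rewrite mxE..].
Qed.

Lemma row_lform L u M i : L \is 1.-homog -> (forall j, L^`M(j) = (u j)%:MP) ->
  (forall j, M i j = u j) -> L = lform M i.
Proof. by move=> hL uE ME; rewrite (line_of_row hL uE) /lform sum3 !ME. Qed.

(** The field acts as a scalar on the span of two lines [g] and [h] with the same
    eigenvalue. If all the lines lie in this span, they are concurrent ([no_cone]). If
    a line [l] does not, it has another eigenvalue, because the field is not scalar.
    Any further line is an eigenvector and not a multiple of [l], hence lies in the
    span of [g] and [h] ([no_near_cone]). *)
Theorem not_all_lines d f A c (s : seq S) : extremal d f -> (forall e, A != e%:M) -> act A f = 0 ->
  decomp f c s -> (3 < size s)%N -> (forall g, g \in s -> is_line g) -> False.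
Proof.
move=> ex Ans Af D sz sL.
have Af0 : act A f = 0 *: f by rewrite scale0r.
have [g [h [lam [gs hs gh Ag Ah]]]] := two_same_eigenvalue D Af0 sL sz.
have [u [up uE]] := line_row (sL g gs); have [v [vp vE]] := line_row (sL h hs).
have [g0 hg] := sL g gs; have [h0 hh] := sL h hs.
have [k wk] : exists k, cross u v k != 0.
  apply: exists_neq0 => z; have : same_pt u v by apply: same_pt_cross.
  case=> e e0 uv; apply: (decomp_ndvd D gs hs gh); exists (e^-1)%:MP.
  rewrite mulrC mul_mpolyC (line_of_row hg uE) (line_of_row hh vE) !uv !scalerDr !scalerA !mulKf //.
have sub_line M N L w : M *m N = 1%:M -> L \is 1.-homog -> (forall j, (sub N L)^`M(j) = (w j)%:MP) ->
    L = w 0 *: lform M 0 + w 1 *: lform M 1 + w 2 *: lform M 2.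
  move=> MN hL wE; have NM := mulmx1C MN.
  rewrite -(subK L NM) {1}(line_of_row (sub_homog N hL) wE) !subD !subZ !subX //.
have [[l [ls [w [wE wD]]]]|no] := classic (exists l, l \in s /\
    exists w, (forall j, l^`M(j) = (w j)%:MP) /\ dot w (cross u v) != 0); last first.
  (* Concurrent lines: in coordinates with g = x and h = y no line involves z. *)
  have D0 : dot (ept k) (cross u v) != 0.
    have -> : dot (ept k) (cross u v) = cross u v k.
      by move: k {wk}; elim/ord3P; rewrite dotE /ept /= !ring01.
    by [].
  have [M [N [MN M0 M1 M2]]] := line_frame D0; have NM := mulmx1C MN.
  have [c0 fE sP sD] := decomp_sub NM D.
  apply/negP: (no_cone (extremal_sub NM ex)).
  rewrite negbK fE mderivZ deriv_prod0 ?scaler0 // => _ /mapP [l ls ->].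
  have [w [wp wE]] := line_row (sub_is_line NM (sL l ls)).
  have [_ hl] := sL l ls; have lE := sub_line M N l w MN hl wE.
  rewrite wE; apply/eqP; rewrite mpolyC_eq0; apply: contraT => w2.
  case: no; exists l; split=> //; have [w' [_ w'E]] := line_row (sL l ls); exists w'; split=> //.
  have w'j j : w' j = w 0 * u j + w 1 * v j + w 2 * ept k j.
    have e1 : lform M 0 = g by rewrite -(row_lform hg uE M0).
    have e2 : lform M 1 = h by rewrite -(row_lform hh vE M1).
    apply/eqP; rewrite -(mpolyC_eq 3); apply/eqP.
    rewrite -w'E lE e1 e2 !mderivD !mderivZ uE vE -!mul_mpolyC !mpolyCD !mpolyCM; congr (_ + _ * _).
    by rewrite deriv_lform M2.
  have -> : dot w' (cross u v) = w 2 * dot (ept k) (cross u v).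
    transitivity (dot (fun j => w 0 * u j + w 1 * v j + w 2 * ept k j) (cross u v)).
      by rewrite !dotE !w'j.
    by rewrite !dotE !crossE; ring.
  by rewrite mulf_neq0.
have [M [N [MN M0 M1 M2]]] := line_frame wD; have NM := mulmx1C MN.
have [_ hl] := sL l ls.
have gE : lform M 0 = g by rewrite -(row_lform hg uE M0).
have hE : lform M 1 = h by rewrite -(row_lform hh vE M1).
have lE : lform M 2 = l by rewrite -(row_lform hl wE M2).
have sg : sub N g = x by rewrite -gE -subX subK.
have sh : sub N h = y by rewrite -hE -subX subK.
have sl : sub N l = z by rewrite -lE -subX subK.
have [mu Al] := component_eigen D Af0 ls.
pose A' := M *m A *m N.
have actE (k' : S) e : act A k' = e *: k' -> act A' (sub N k') = e *: sub N k'.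
  by move=> e1; rewrite -(act_sub _ _ MN) e1 subZ.
have A0 : act A' x = lam *: x by rewrite -sg; apply: actE.
have A1 : act A' y = lam *: y by rewrite -sh; apply: actE.
have A2 : act A' z = mu *: z by rewrite -sl; apply: actE.
have AE i j : A' i j = (if i == 2 then mu else lam) *+ (i == j).
  have e1 : act A' 'X_i = (if i == 2 then mu else lam) *: 'X_i by elim/ord3P: i.
  have := congr1 (mcoeff U_(j)%MM) e1.
  by rewrite actX mcoeff_lform mcoeffZ mcoeffXU => ->; rewrite mulr_natr.
have lm : lam != mu.
  apply/eqP => e; case/eqP: (Ans lam); transitivity (N *m A' *m M).
    by rewrite /A' !mulmxA NM mul1mx -mulmxA NM mulmx1.
  have -> : A' = lam%:M by apply/matrixP => i j; rewrite AE mxE e if_same.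
  by rewrite mul_mx_scalar -scalemxAl NM scalemx1.
have [t st] : exists t, perm_eq s (l :: t) by exists (rem l s); apply: perm_to_rem.
have [c0 fE sP sD] := decomp_perm st D.
pose G := c *: \prod_(k <- t) sub N k.
have FE : sub N f = z * G by rewrite fE subZ big_cons subM sl /G sub_prod big_map scalerAr.
apply/negP: (no_near_cone (extremal_sub NM ex) FE).
rewrite negbK /G mderivZ -(big_map (sub N) xpredT id) deriv_prod0 ?scaler0 // => _ /mapP [k' kt ->].
have ks : k' \in s by rewrite (perm_mem st) inE kt orbT.
have [w' [w'p w'E]] := line_row (sub_is_line NM (sL k' ks)).
rewrite w'E; apply/eqP; rewrite mpolyC_eq0; apply: contraT => w2.
have [e Ak] := component_eigen D Af0 ks.
have [_ hk] := sL k' ks.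
have kE := line_of_row (sub_homog N hk) w'E.
have H := act_row w'E (actE _ _ Ak).
have := (H 0, H 1, H 2); rewrite !sum3 !AE /= ?mulr1n ?mulr0n !ring01 => -[[H0 H1] H2].
have e2 : e = mu by apply: (mulIf w2); rewrite -H2 mulrC.
have z0 i : w' i * lam = e * w' i -> w' i = 0.
  rewrite e2 mulrC => /eqP; rewrite -subr_eq0 -mulrBl mulf_eq0 subr_eq0 (negPf lm) => /eqP //.
have w0 := z0 _ H0; have w1 := z0 _ H1.
exfalso; apply: (sD l t (perm_refl _) k' kt).
rewrite -(subK l NM) -(subK k' NM); apply: sub_dvdr.
by exists (w' 2)%:MP; rewrite kE w0 w1 !scale0r !add0r sl mulrC mul_mpolyC.
Qed.

(** * Lines and conics tangent to the semisimple and nilpotent fields *)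

Lemma factor_eq0 c e : e * c = 0 -> c != 0 -> e = 0.
Proof. by move=> /eqP; rewrite mulf_eq0 => /orP[/eqP ->|/eqP -> /eqP]. Qed.

Lemma dot_lform (rho : 'I_3 -> S) A : lform A =1 rho -> forall G, act A G = dot rho (grad G).
Proof. by move=> h G; apply: eq_bigr => i _; rewrite h. Qed.

Definition torus_mx : 'M[K]_3 := \matrix_(i, j) (vec3 1 0 (-1) i *+ (i == j)).

Lemma act_torus_mx G : act torus_mx G = dot (torus K) (grad G).
Proof.
apply: dot_lform; elim/ord3P; rewrite /lform sum3 !mxE /torus /vec3 /= ?mulr1n ?mulr0n.
- by rewrite !scale0r scale1r !addr0.
- by rewrite !scale0r !addr0.
by rewrite !scale0r scaleN1r !add0r.
Qed.

(** The field 2by d/dx - az d/dy. It kills z and axz + by^2; for nonzero [a] and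
    [b] its only zero is (1:0:0). *)
Definition nilpotent a b : 'I_3 -> S := vec3 ((b *+ 2) *: y) ((- a) *: z) 0.
Definition nilpotent_mx a b : 'M[K]_3 := \matrix_(i, j) vec3 (vec3 0 (b *+ 2) 0 j) (vec3 0 0 (- a) j) 0 i.

Lemma act_nilpotent_mx a b G : act (nilpotent_mx a b) G = dot (nilpotent a b) (grad G).
Proof.
apply: dot_lform; elim/ord3P; rewrite /lform sum3 !mxE /nilpotent /vec3 /=.
- by rewrite !scale0r add0r addr0.
- by rewrite !scale0r !add0r.
by rewrite !scale0r !addr0.
Qed.

Lemma conic_hess_neq0 Q i : smooth_conic Q -> exists j, hess Q j i != 0.
Proof.
move=> sm; have [|j] := smooth_nondeg sm (v := ept i); first by exists i; rewrite eptE eqxx oner_neq0.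
by rewrite mulv_ept => h; exists j.
Qed.

(** With weights t = (1, 0, -1), [act_hess] says that (t_i + t_j - lam) B_ij = 0.
    For lam = 0 this leaves the entries of xz and y^2, and for any other lam some
    column of [B] would vanish. *)
Lemma torus_eigen_conic lam Q : smooth_conic Q -> dot (torus K) (grad Q) = lam *: Q ->
  exists a b, Q = pen a b.
Proof.
move=> sm; rewrite -act_torus_mx => e; have [hQ _] := sm.
pose B := hess Q; pose t : 'I_3 -> K := vec3 1 0 (-1).
have s i j : B j i = 0 -> B i j = 0 by rewrite /B hess_sym.
have z i j : t i + t j != lam -> B i j = 0.
  have tE k l : torus_mx k l = t k *+ (k == l) by rewrite mxE.
  have tS k l : \sum_m torus_mx m k * B m l = t k * B k l.
    rewrite (bigD1 k) //= tE eqxx mulr1n big1 ?addr0 // => m mk.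
    by rewrite tE (negPf mk) mul0r.
  move=> ne; have := act_hess i j hQ e; rewrite big_split -/B /= !tS /B (hess_sym Q j i) -mulrDl => /eqP.
  by rewrite -subr_eq0 -mulrBl mulf_eq0 subr_eq0 (negPf ne) => /eqP.
have n1 : (1 : K) != -1 by rewrite -subr_eq0 opprK -mulr2n pnatr_eq0.
have [l0|l0] := eqVneq lam 0.
  exists (B 0 2), (B 1 1 / 2); apply: pen_of_hess => //; apply: z; rewrite l0 /t /vec3 /= ?ring01.
  - by rewrite -mulr2n pnatr_eq0.
  - by rewrite -opprD oppr_eq0 -mulr2n pnatr_eq0.
  - exact: oner_neq0.
  by rewrite oppr_eq0 oner_neq0.
exfalso; have l0' := l0; rewrite eq_sym in l0'.
have B11 : B 1 1 = 0 by apply: z; rewrite /t /vec3 /= addr0.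
have B02 : B 0 2 = 0 by apply: z; rewrite /t /vec3 /= subrr.
have [l1|l1] := eqVneq 1 lam.
  have [j] := conic_hess_neq0 2 sm; case/eqP; move: j; elim/ord3P => //; apply: z; rewrite -l1 /t /vec3 /=.
    by rewrite add0r eq_sym.
  by rewrite -opprD -subr_eq0 -opprD oppr_eq0 -[1]/(1%:R) -!natrD pnatr_eq0.
have B01 : B 0 1 = 0 by apply: z; rewrite /t /vec3 /= addr0.
have [lN|lN] := eqVneq (-1) lam; last first.
  have [j] := conic_hess_neq0 1 sm; case/eqP; move: j; elim/ord3P => //.
  by apply/s/z; rewrite /t /vec3 /= add0r.
have [j] := conic_hess_neq0 0 sm; case/eqP; move: j; elim/ord3P; [|exact: s|exact: s].
by apply: z; rewrite -lN /t /vec3 /= -subr_eq0 opprK -[1]/(1%:R) -!natrD pnatr_eq0.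
Qed.

Lemma nilpotent_eigen_conic a b lam Q : a != 0 -> b != 0 -> smooth_conic Q ->
  dot (nilpotent a b) (grad Q) = lam *: Q ->
  lam = 0 /\ exists a1 b1, a1 != 0 /\ Q = hyperpen a b a1 b1.
Proof.
move=> a0 b0 sm; rewrite -act_nilpotent_mx => e; have [hQ _] := sm; have n2 := two_neq0.
have zl c t : c * t = 0 -> c != 0 -> t = 0.
  by move=> /eqP; rewrite mulf_eq0 => /orP[/eqP -> /eqP|/eqP].
have bb0 : b *+ 2 != 0 by rewrite mulrn_eq0.
pose B := hess Q.
have s10 : B 1 0 = B 0 1 := hess_sym Q 1 0.
have s20 : B 2 0 = B 0 2 := hess_sym Q 2 0.
have s21 : B 2 1 = B 1 2 := hess_sym Q 2 1.
have H i j := act_hess i j hQ e.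
have nE k l : nilpotent_mx a b k l = vec3 (vec3 0 (b *+ 2) 0 l) (vec3 0 0 (- a) l) 0 k by rewrite mxE.
have := (H 0 0, H 0 1, H 0 2, (H 1 1, H 1 2, H 2 2)).
rewrite !sum3 !nE /vec3 /= -/B !ring01 s10 => -[[[E00 E01] E02] [[E11 E12] E22]].
have nz : ~ (B 0 0 = 0 /\ B 0 1 = 0 /\ B 0 2 = 0).
  move=> [B00 [B01 B02]]; have [j] := conic_hess_neq0 0 sm.
  by case/eqP; move: j; elim/ord3P; rewrite // -/B ?s10 ?s20.
have na0 : - a != 0 by rewrite oppr_eq0.
have l0 : lam = 0.
  apply/eqP; apply: contraT => l0.
  have B00 : B 0 0 = 0 by apply: (zl lam).
  have B01 : B 0 1 = 0 by apply: (zl lam) => //; rewrite -E01 B00 mulr0.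
  by case: nz; do 2!split=> //; apply: (zl lam) => //; rewrite -E02 B01 mulr0.
split=> //; rewrite l0 !mul0r in E01 E02 E12 E22.
have B00 : B 0 0 = 0 := zl _ _ E01 bb0.
have B01 : B 0 1 = 0 := zl _ _ E02 na0.
have B12 : B 1 2 = 0.
  by apply: (zl (- a + - a)); rewrite ?mulrDl // -mulr2n mulrn_eq0.
pose al := B 0 2 / a; pose be := B 2 2 / 2.
have B02 : B 0 2 = a * al by rewrite mulrC divfK.
have B22 : B 2 2 = 2 * be by rewrite mulrC divfK.
have B11 : B 1 1 = 2 * b * al.
  apply: (mulfI a0); apply/eqP; rewrite eq_sym -subr_eq0 -E12 B02; apply/eqP; ring.
exists al, be; split.
  by apply/eqP => al0; apply: nz; rewrite B02 al0 mulr0.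
apply: (scalerI n2); rewrite quad_hess // !sum3 -/B s10 s20 s21 B00 B01 B12 B11 B02 B22 !scale0r.
clearbody al be.
by rewrite /hyperpen penE -!mul_mpolyC !mpolyCM !mpolyC_nat; ring.
Qed.

Lemma torus_eigen_line lam L : is_line L -> dot (torus K) (grad L) = lam *: L ->
  exists c, c != 0 /\ (L = c *: x \/ L = c *: y \/ L = c *: z).
Proof.
move=> hL; rewrite -act_torus_mx => e; have [u [up uE]] := line_row hL; have [_ hL1] := hL.
have LE := line_of_row hL1 uE; have H := act_row uE e.
have := (H 0, H 1, H 2); rewrite !sum3 !mxE /vec3 /= ?mulr1n ?mulr0n !ring01.
move=> [[E0 E1] E2].
have [u0|u0] := eqVneq (u 0) 0; last first.
  have l1 : lam = 1 by apply: (mulIf u0); rewrite -E0 mul1r.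
  have u1 : u 1 = 0 by rewrite -(mul1r (u 1)) -l1 -E1.
  have u2 : u 2 = 0.
    apply: (mulfI (two_neq0)); transitivity (lam * u 2 - u 2 * -1); first by rewrite l1; ring.
    by rewrite E2 subrr mulr0.
  by exists (u 0); split=> //; left; rewrite LE u1 u2 !scale0r !addr0.
have [u1|u1] := eqVneq (u 1) 0.
  exists (u 2); split; last by right; right; rewrite LE u0 u1 !scale0r !add0r.
  by apply/eqP => u2; case: up => j; move: j; elim/ord3P; rewrite ?u0 ?u1 ?u2 eqxx.
have l0 : lam = 0 by apply: (mulIf u1); rewrite -E1 mul0r.
have u2 : u 2 = 0 by apply/eqP; rewrite -oppr_eq0 -mulrN1 E2 l0 mul0r.
by exists (u 1); split=> //; right; left; rewrite LE u0 u2 !scale0r add0r addr0.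
Qed.

Lemma nilpotent_eigen_line a b lam L : a != 0 -> b != 0 -> is_line L ->
  dot (nilpotent a b) (grad L) = lam *: L -> lam = 0 /\ exists c, c != 0 /\ L = c *: z.
Proof.
move=> a0 b0 hL; rewrite -act_nilpotent_mx => e; have [u [up uE]] := line_row hL; have [_ hL1] := hL.
have LE := line_of_row hL1 uE; have H := act_row uE e.
have := (H 0, H 1, H 2); rewrite !sum3 !mxE /vec3 /= !ring01.
move=> [[E0 E1] E2].
have bb0 : b *+ 2 != 0 by rewrite mulrn_eq0.
have na0 : - a != 0 by rewrite oppr_eq0.
have nz : u 0 = 0 -> u 1 = 0 -> u 2 != 0.
  by move=> u0 u1; apply/eqP => u2; case: up => j; move: j; elim/ord3P; rewrite ?u0 ?u1 ?u2 eqxx.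
have l0 : lam = 0.
  apply/eqP; apply: contraT => l0.
  have u0 : u 0 = 0 by apply: (mulfI l0); rewrite -E0 mulr0.
  have u1 : u 1 = 0 by apply: (mulfI l0); rewrite -E1 u0 mul0r mulr0.
  by case/eqP: (nz u0 u1); apply: (mulfI l0); rewrite -E2 u1 mul0r mulr0.
have u0 : u 0 = 0 by apply: (mulIf bb0); rewrite E1 l0 !mul0r.
have u1 : u 1 = 0 by apply: (mulIf na0); rewrite E2 l0 !mul0r.
by split=> //; exists (u 2); split; [exact: nz | rewrite LE u0 u1 !scale0r !add0r].
Qed.

Lemma act_scale A c G : act (c *: A) G = c *: act A G.
Proof.
rewrite /act /dot scaler_sumr; apply: eq_bigr => i _; rewrite scalerAl; congr (_ * _).
by rewrite /lform scaler_sumr; apply: eq_bigr => j _; rewrite mxE scalerA.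
Qed.

Lemma hess_pen a b i j :
  hess (pen a b) i j = vec3 (vec3 0 0 a j) (vec3 0 (b *+ 2) 0 j) (vec3 a 0 0 j) i.
Proof.
rewrite mxE; elim/ord3P: i; rewrite deriv_pen mcoeffZ mcoeffXU; elim/ord3P: j;
  by rewrite /vec3 /= ?mulr1 ?mulr0.
Qed.

Lemma tangent_entries A a b : act A (pen a b) = 0 -> forall i j,
  \sum_k (A k i * hess (pen a b) k j + A k j * hess (pen a b) k i) = 0.
Proof.
move=> e i j; rewrite (act_hess (lam := 0) _ _ (pen_homog a b)) ?mul0r //.
by rewrite e scale0r.
Qed.

(** A field that kills axz + by^2 and vanishes at (0:1:0) is determined by the
    relation A^T B + B A = 0 for the Hessian [B] of the conic. *)
Lemma torus_field A a b : a != 0 -> b != 0 -> act A (pen a b) = 0 -> (forall i, A i 1 = 0) ->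
  A = A 0 0 *: torus_mx.
Proof.
move=> a0 b0 /tangent_entries H c1.
have bb0 : b *+ 2 != 0 by rewrite mulrn_eq0.
have aa0 : a + a != 0 by rewrite -mulr2n mulrn_eq0.
have := (H 0 0, H 0 1, H 0 2, (H 1 2, H 2 2)).
rewrite !sum3 !hess_pen /vec3 /= !c1 !ring01 -!mulrDr -!mulrDl.
move=> [[[E00 E01] E02] [E12 E22]].

have A22 : A 2 2 = - A 0 0.
  by apply/eqP; rewrite -addr_eq0 addrC; apply/eqP/(factor_eq0 E02).
apply/matrixP => i j; rewrite !mxE; elim/ord3P: i; elim/ord3P: j;
  rewrite /vec3 /= ?mulr1n ?mulr0n ?mulr0 ?mulr1 ?mulrN1 ?c1 //.
- exact: factor_eq0 E22 aa0.
- exact: factor_eq0 E01 bb0.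
- exact: factor_eq0 E12 bb0.
exact: factor_eq0 E00 aa0.
Qed.

Lemma nilpotent_field A a b : a != 0 -> b != 0 -> act A (pen a b) = 0 -> (forall i, A i 0 = 0) ->
  A = (- (A 1 2 / a)) *: nilpotent_mx a b.
Proof.
move=> a0 b0 /tangent_entries H c0.
have bb0 : b *+ 2 != 0 by rewrite mulrn_eq0.
have aa0 : a + a != 0 by rewrite -mulr2n mulrn_eq0.
have := (H 0 1, H 0 2, H 1 1, (H 1 2, H 2 2)).
rewrite !sum3 !hess_pen /vec3 /= !c0 !ring01 -!mulrDr -?mulrDl.
move=> [[[E01 E02] E11] [E12 E22]].

have bbb0 : b *+ 2 + b *+ 2 != 0 by rewrite -mulr2n mulrn_eq0.
apply/matrixP => i j; rewrite !mxE; elim/ord3P: i; elim/ord3P: j;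
  rewrite /vec3 /= ?mulr0 ?c0 //.
- apply: (mulIf a0); apply/eqP; rewrite -subr_eq0 -E12; apply/eqP; by field.
- exact: factor_eq0 E22 aa0.
- exact: factor_eq0 E11 bbb0.
- by rewrite mulNr mulrN opprK divfK.
- exact: factor_eq0 E01 a0.
exact: factor_eq0 E02 a0.
Qed.

(** * The two types of tangent field *)

Lemma conj_neq0 M N A : M *m N = 1%:M -> A != 0 -> M *m A *m N != 0.
Proof.
move=> MN; have NM := mulmx1C MN; apply: contraNneq => e.
have -> : A = N *m (M *m A *m N) *m M by rewrite !mulmxA NM mul1mx -mulmxA NM mulmx1.
by rewrite e mulmx0 mul0mx.
Qed.

Lemma line_neq_conic c (i : 'I_3) a b : c != 0 -> a != 0 -> c *: 'X_i != pen a b.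
Proof.
move=> c0 a0; apply/eqP => E.
have n0 : c *: 'X_i != 0 :> S by rewrite scaler_eq0 negb_or c0 -msize_poly_eq0 msizeX.
have h1 : c *: 'X_i \is 1.-homog by apply/dhomogZ/homogX1.
by have := dhomog_uniq n0 h1; rewrite E => /(_ 2%N (pen_homog a b)).
Qed.

Lemma decomp_split2 f c s g h : decomp f c s -> g \in s -> h \in s -> g != h ->
  exists H, f = g * h * H.
Proof.
move=> D gs hs gh; have [t st] := decomp_two D gs hs gh; have [_ fE _ _] := D.
exists (c *: \prod_(k <- t) k); rewrite fE (perm_big _ st) !big_cons -!mul_mpolyC /=; ring.
Qed.

(** The lines x and z are excluded by [no_tangent_x] and [no_tangent_z], so that the
    components are conics of the pencil and possibly the line y. *)
Lemma torus_case d f c (s : seq S) A e M N Q a b : extremal d f -> decomp f c s -> act A f = e *: f ->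
  A != 0 -> M *m N = 1%:M -> Q \in s -> sub N Q = pen a b -> a != 0 -> b != 0 ->
  act A Q = 0 -> (forall i, (M *m A *m N) i 1 = 0) -> type_C2 f \/ type_CL6 f.
Proof.
move=> ex D Af A0 MN Qs QE a0 b0 AQ col1; have NM := mulmx1C MN.
pose A' := M *m A *m N; pose al := A' 0 0.
have A'0 : A' != 0 := conj_neq0 MN A0.
have A'pen : act A' (pen a b) = 0 by rewrite -QE -(act_sub _ _ MN) AQ raddf0.
have AE := torus_field a0 b0 A'pen col1; rewrite -/al in AE.
have tor G : act A' G = al *: dot (torus K) (grad G) by rewrite AE act_scale act_torus_mx.
have al0 : al != 0.
  by apply: contraNneq A'0 => z0; rewrite AE z0 scale0r.
have torE G lam : act A' G = lam *: G -> dot (torus K) (grad G) = (lam / al) *: G.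
  by rewrite tor => h; apply: (scalerI al0); rewrite h scalerA mulrC divfK.
have D' := decomp_sub NM D; set s' := map (sub N) s in D'.
have A'F : act A' (sub N f) = e *: sub N f by rewrite -(act_sub _ _ MN) Af subZ.
have exF := extremal_sub NM ex.
have tF := torE _ _ A'F.
have Qs' : pen a b \in s' by rewrite -QE map_f.
have [c0 fE sP sD] := D; have [_ _ sP' _] := D'.
have lineE g : g \in s -> is_line g -> exists2 c', c' != 0 & sub N g = c' *: y.
  move=> gs gl; have gs' : sub N g \in s' by rewrite map_f.
  have [lam ge] := component_eigen D' A'F gs'.
  have [c' [c'0 H]] := torus_eigen_line (sub_is_line NM gl) (torE _ _ ge).
  case: H => [gE|[gE|gE]]; last first; [|by exists c'|].
    rewrite gE in gs'; have [H FE] := decomp_split2 D' gs' Qs' (line_neq_conic 2 b c'0 a0).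
    case: (@no_tangent_z _ d (sub N f) (e / al) a b (c' *: H) exF tF).
    by rewrite FE -!mul_mpolyC; ring.
  rewrite gE in gs'; have [H FE] := decomp_split2 D' gs' Qs' (line_neq_conic 0 b c'0 a0).
  case: (@no_tangent_x _ d (sub N f) (e / al) a b (c' *: H) exF tF).
  by rewrite FE -!mul_mpolyC; ring.
have conE g : g \in s -> smooth_conic g -> exists a' b', g = sub M (pen a' b').
  move=> gs gc; have gs' : sub N g \in s' by rewrite map_f.
  have [lam ge] := component_eigen D' A'F gs'.
  have [a' [b' gE]] := torus_eigen_conic (sub_smooth NM gc) (torE _ _ ge).
  by exists a', b'; rewrite -gE subK.
have nsame t : (forall g t', perm_eq t (g :: t') -> forall h, h \in t' -> ~ dvdr g h) ->
    forall g t', perm_eq t (g :: t') -> forall h, h \in t' -> ~ same_curve g h.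
  move=> H g t' tt h ht [k k0 gh]; apply: (H g t' tt h ht).
  by exists (k^-1)%:MP; rewrite gh mulrC mul_mpolyC scalerA mulVf // scale1r.
have bt := bitangent_standard MN.
have [[l [ls ll]]|no] := classic (exists l, l \in s /\ is_line l); last first.
  left; exists (sub M ('X_0 * 'X_2)), (sub M ('X_1 ^+ 2)), (mulv N (ept 0)), (mulv N (ept 2)).
  split=> //; rewrite fE; apply: pencil_union_of_seq => //; last exact: nsame.
  move=> g gs; have [_ [gl|gc]] := sP g gs; first by case: no; exists g.
  by split=> //; apply: conE.
right; pose t := rem l s; have st : perm_eq s (l :: t) by apply: perm_to_rem.
have Dt := decomp_perm st D; have [_ ftE tP tD] := Dt.
have [cl cl0 lE] := lineE l ls ll.
exists (sub M ('X_0 * 'X_2)), (sub M ('X_1 ^+ 2)), (mulv N (ept 0)), (mulv N (ept 2)), l.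
exists (c *: \prod_(g <- t) g); split=> //.
- apply: pencil_union_of_seq => //.
    move=> g gt; have gs : g \in s by rewrite (perm_mem st) inE gt orbT.
    have [_ [gl|gc]] := sP g gs; last by split=> //; apply: conE.
    have [cg cg0 gE] := lineE g gs gl.
    case: (tD l t (perm_refl _) g gt); rewrite -(subK l NM) -(subK g NM); apply: sub_dvdr.
    exists (cg / cl)%:MP; rewrite lE gE mulrC mul_mpolyC scalerA divfK //.
  apply: nsame => g t' tt h ht; apply: (tD g (l :: t')); last by rewrite inE ht orbT.
  apply: (@perm_trans _ (l :: g :: t')); first by rewrite perm_cons.
  exact: (permEl (perm_catCA [:: l] [:: g] t')).
- split=> //; rewrite -(subK l NM) lE !meval_sub.
  have ev i : i != 1 -> (cl *: y).@[mulv M (mulv N (ept i))] = 0.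
    move=> i1; rewrite (meval_eq _ (mulvK _ MN)) mevalZ mevalXU !eptE (negPf i1) mulr0 //.
  by rewrite !ev.
by rewrite ftE big_cons -scalerAr.
Qed.

(** All the components are z or hyperosculating conics. Any two of them, one being
    the conic [Q], already give a trivial Bourbaki ideal. *)
Lemma nilpotent_case d f c (s : seq S) A e M N Q a b : extremal d f -> decomp f c s -> act A f = e *: f ->
  A != 0 -> M *m N = 1%:M -> Q \in s -> sub N Q = pen a b -> a != 0 -> b != 0 ->
  act A Q = 0 -> (forall i, (M *m A *m N) i 0 = 0) -> (1 < size s)%N -> False.
Proof.
move=> ex D Af A0 MN Qs QE a0 b0 AQ col0 sz; have NM := mulmx1C MN.
pose A' := M *m A *m N; pose al := - (A' 1 2 / a).
have A'0 : A' != 0 := conj_neq0 MN A0.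
have A'pen : act A' (pen a b) = 0 by rewrite -QE -(act_sub _ _ MN) AQ raddf0.
have AE := nilpotent_field a0 b0 A'pen col0; rewrite -/al in AE.
have tor G : act A' G = al *: dot (nilpotent a b) (grad G) by rewrite AE act_scale act_nilpotent_mx.
have al0 : al != 0.
  by apply: contraNneq A'0 => z0; rewrite AE z0 scale0r.
have torE G lam : act A' G = lam *: G -> dot (nilpotent a b) (grad G) = (lam / al) *: G.
  by rewrite tor => h; apply: (scalerI al0); rewrite h scalerA mulrC divfK.
have D' := decomp_sub NM D; set s' := map (sub N) s in D'.
have A'F : act A' (sub N f) = e *: sub N f by rewrite -(act_sub _ _ MN) Af subZ.
have exF := extremal_sub NM ex.
have Qs' : pen a b \in s' by rewrite -QE map_f.
have [c0 FE sP' _] := D'.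
have kind k : k \in s' -> dot (nilpotent a b) (grad k) = 0 /\
    ((exists2 c', c' != 0 & k = c' *: z) \/ (exists a1 b1, k = hyperpen a b a1 b1)).
  move=> ks; have [lam ke] := component_eigen D' A'F ks; have te := torE _ _ ke.
  have [_ [kl|kc]] := sP' k ks.
    have [l0 [c' [c'0 kE]]] := nilpotent_eigen_line a0 b0 kl te.
    by split; [rewrite te l0 scale0r | left; exists c'].
  have [l0 [a1 [b1 [_ kE]]]] := nilpotent_eigen_conic a0 b0 kc te.
  by split; [rewrite te l0 scale0r | right; exists a1, b1].
have syzF : syz (sub N f) (nilpotent a b).
  by rewrite FE /syz field_scale field_prod0 ?scaler0 // => k /kind [].
have QE' : pen a b = hyperpen a b 1 0 by rewrite /hyperpen scale1r scale0r addr0.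
have [k ks kQ] : exists2 k, k \in s' & k != pen a b.
  have sz' : (0 < size (rem (pen a b) s'))%N by rewrite size_rem // size_map -ltnS prednK // ltnW.
  case: (rem (pen a b) s') (mem_rem_uniq (pen a b) (decomp_uniq D')) sz' => [//|k t] H _.
  by exists k; have := H k; rewrite mem_head inE => /esym /andP[].
have [H fE] := decomp_split2 D' ks Qs' kQ.
have [_ [[c' c'0 kE]|[a1 [b1 kE]]]] := kind k ks.
  apply: (no_hyperosculating_line exF a0 b0 (oner_neq0 _) syzF (b1 := 0) (H := c' *: H)).
  by rewrite -QE' fE kE -!mul_mpolyC; ring.
apply: (no_hyperosculating_conics exF a0 b0 (oner_neq0 _) syzF (b1 := 0) (a2 := a1) (b2 := b1) (H := H)).
by rewrite -QE' fE kE (mulrC (hyperpen _ _ _ _)).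
Qed.
End TangentFields.

(** * The fixed points of the tangent field *)

Section Final.
Variable K : numClosedFieldType.
Local Notation S := {mpoly K[3]}.
Implicit Types (f g h F G L Q : S) (M N A : 'M[K]_3) (a b c e : K) (p q u v w : 'I_3 -> K).
Local Notation ept := (@ept K).
Local Notation pen := (@pen K).

Lemma quad_form_zero a b c : exists s t : K,
  (s != 0 \/ t != 0) /\ a * s ^+ 2 + b * s * t + c * t ^+ 2 = 0.
Proof.
have [->|a0] := eqVneq a 0.
  by exists 1, 0; split; [left; rewrite oner_neq0 | rewrite expr0n /= !mulr0 mul0r !addr0].
pose D := sqrtC (b ^+ 2 - 4%:R * a * c).
have D2 : D ^+ 2 = b ^+ 2 - 4%:R * a * c by rewrite sqrtCK.
exists (D - b), (2 * a); split; first by right; rewrite mulf_neq0 // two_neq0.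
transitivity (a * (D ^+ 2 - (b ^+ 2 - 4%:R * a * c))); first by ring.
by rewrite D2 subrr mulr0.
Qed.

Lemma polarDl Q u v w a b : polar Q (fun i => a * u i + b * v i) w = a * polar Q u w + b * polar Q v w.
Proof. by rewrite /polar !dotE; ring. Qed.

Lemma polarDr Q u v w a b : polar Q w (fun i => a * u i + b * v i) = a * polar Q w u + b * polar Q w v.
Proof. by rewrite polar_sym polarDl !(polar_sym Q w). Qed.

Lemma polar_ept Q w i : polar Q (ept i) w = mulv (hess Q) w i.
Proof.
rewrite /polar /dot (bigD1 i) //= !eptE eqxx mul1r big1 ?addr0 // => j ji.
by rewrite eptE eq_sym (negPf ji) mul0r.
Qed.

(** The line joining [p] and [u] meets the conic in a second point, because [u]
    does not lie on the tangent line at [p]. *)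
Lemma second_isotropic Q p u : Q \is 2.-homog -> Q.@[p] = 0 -> polar Q p u != 0 -> is_pt p ->
  exists q, [/\ Q.@[q] = 0, is_pt q, ~ same_pt p q & exists t, forall i, q i = u i - t * p i].
Proof.
move=> hQ Qp pu pp; have n2 := two_neq0 K.
pose t := Q.@[u] / polar Q p u; pose q i := 1 * u i + (- t) * p i.
have Bpp : polar Q p p = 0 by rewrite polar_quad // Qp mulr0.
have Bpq : polar Q p q = polar Q p u by rewrite polarDr Bpp mulr0 addr0 mul1r.
exists q; split.
- apply: (mulfI n2); rewrite mulr0 -polar_quad // polarDl !polarDr Bpp (polar_sym Q u p) polar_quad // /t.
  by field.
- apply: exists_neq0 => z; case/eqP: pu; rewrite -Bpq /polar.
  by rewrite dotE !mulv3 !z !mulr0 !addr0 !mulr0 !addr0.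
- case=> k k0 pq; case/eqP: pu; rewrite -Bpq; apply: (mulfI k0); rewrite mulr0 -[RHS]Bpp.
  have pq' : p =1 (fun i => k * q i + 0 * q i) by move=> i; rewrite mul0r addr0 pq.
  by rewrite (eq_polar Q (v := p) (fun=> erefl) pq') (polarDr Q q q p k 0) mul0r addr0.
by exists t => i; rewrite /q mul1r mulNr.
Qed.

(** The polar line of [w] meets the conic: restricted to this line, [Q] is a binary
    quadratic form. *)
Lemma polar_isotropic Q w : smooth_conic Q -> is_pt w ->
  exists p, [/\ is_pt p, polar Q p w = 0 & Q.@[p] = 0].
Proof.
move=> sm wp; have [hQ _] := sm; have n2 := two_neq0 K.
have [k Pk] := smooth_nondeg sm wp; pose P := mulv (hess Q) w.
pose m (s t : K) : 'I_3 -> K := fun j => s * ept (k + 1) j + t * ept (k + 2) j.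
pose n s t := cross P (m s t).
have nP s t : polar Q (n s t) w = 0.
  by rewrite /polar -/P -[RHS](dot_crossl P (m s t)) /n !dotE; ring.
have n1 s t : n s t (k + 1) = - (P k * t).
  by rewrite /n /m /cross; move: (k); elim/ord3P; rewrite ?add0r ?ord3_add ?add0r !eptE /=; ring.
have n2' s t : n s t (k + 2) = P k * s.
  by rewrite /n /m /cross; move: (k); elim/ord3P; rewrite ?add0r ?ord3_add ?add0r !eptE /=; ring.
have nE s t i : n s t i = s * n 1 0 i + t * n 0 1 i.
  by rewrite /n /m /cross; ring.
have [s [t [st e]]] := quad_form_zero (polar Q (n 1 0) (n 1 0)) (2 * polar Q (n 1 0) (n 0 1)) (polar Q (n 0 1) (n 0 1)).
exists (n s t); split=> //.
  case: st => nz; [exists (k + 2); rewrite n2' | exists (k + 1); rewrite n1 oppr_eq0];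
  by rewrite mulf_neq0.
apply: (mulfI n2); rewrite mulr0 -polar_quad //.
rewrite (eq_polar Q (nE s t) (nE s t)) polarDl !polarDr (polar_sym Q (n 0 1) (n 1 0)) -[RHS]e; ring.
Qed.

(** For the Hessian [B], the matrix [C = B *m A] is antisymmetric, so it is the
    vector product with some [w] and kills [w]. *)
Lemma kernel_vector Q A : smooth_conic Q -> act A Q = 0 -> A != 0 ->
  exists w, is_pt w /\ mulv A w =1 (fun=> 0).
Proof.
move=> sm e A0; have [hQ _] := sm.
have nd v : (forall i, mulv (hess Q) v i = 0) -> forall i, v i = 0.
  move=> Bv i; apply/eqP; apply: contraT => vi.
  by have [|j] := smooth_nondeg sm (v := v); [exists i | rewrite Bv eqxx].
pose C := hess Q *m A.
have Ca i j : C i j = - C j i.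
  apply/eqP; rewrite -addr_eq0 -[X in _ == X](mul0r (hess Q j i)); apply/eqP.
  rewrite -(act_hess j i hQ (A := A)) ?scale0r // !mxE -big_split; apply: eq_bigr => k _ /=.
  by rewrite (hess_sym Q i k) (hess_sym Q j k); ring.
have C0 i : C i i = 0.
  by apply: (mulfI (two_neq0 K)); rewrite mulr0 mulr_natl mulr2n {1}Ca addNr.
pose w := vec3 (- C 1 2) (C 0 2) (- C 0 1).
exists w; split; last first.
  apply: nd => i; rewrite mulvA -/C mulv3 /w /vec3 /=; move: i; elim/ord3P.
  - by rewrite C0; ring.
  - by rewrite (Ca 1 0) C0; ring.
  by rewrite (Ca 2 0) (Ca 2 1) C0; ring.
apply: exists_neq0 => wz.
have C12 : C 1 2 = 0 by have /eqP := wz 0; rewrite oppr_eq0 => /eqP.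
have C02 : C 0 2 = 0 := wz 1.
have C01 : C 0 1 = 0 by have /eqP := wz 2; rewrite oppr_eq0 => /eqP.
case/eqP: A0; apply/matrixP => i j; rewrite mxE -mulv_ept; apply: nd => k.
rewrite mulvA -/C mulv_ept; move: j; elim/ord3P; move: k; elim/ord3P;
  by rewrite // ?(Ca 1 0) ?(Ca 2) ?C0 ?C01 ?C02 ?C12 ?oppr0.
Qed.

(** After a scalar is subtracted from [A], the field kills [Q] and vanishes at some
    point [w]. If [w] lies on the conic, a frame with first vector [w] exhibits a
    nilpotent field. If not, the polar line of [w] meets the conic in two points, and
    together with [w] they form a frame in which the field is diagonal. *)
Theorem conic_case d f c (s : seq S) A Q : extremal d f -> decomp f c s ->
  (forall e, A != e%:M) -> act A f = 0 -> (1 < size s)%N -> Q \in s -> smooth_conic Q ->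
  type_C2 f \/ type_CL6 f.
Proof.
move=> ex D Ans Af sz Qs sm; have [_ hf _ _] := ex; have [hQ _] := sm; have n2 := two_neq0 K.
have Af0 : act A f = 0 *: f by rewrite scale0r.
have [lam AQ] := component_eigen D Af0 Qs.
pose A' := A - (lam / 2)%:M.
have A'0 : A' != 0 by rewrite subr_eq0.
have A'Q : act A' Q = 0 by rewrite (act_scalar _ _ hQ) AQ divfK // subrr.
have A'f : act A' f = (- (lam / 2 * d%:R)) *: f.
  by rewrite (act_scalar _ _ hf) Af sub0r scaleNr.
have [w [wp Aw]] := kernel_vector sm A'Q A'0.
have colE M N i j : (M *m A' *m N) i j = mulv M (mulv A' (mulv N (ept j))) i.
  by rewrite -mulv_ept -mulvA; apply: esym; rewrite -mulvA.
have mulv0 M v : v =1 (fun=> 0) -> mulv M v =1 (fun=> 0).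
  by move=> v0 i; rewrite mulv3 !v0 !mulr0 !addr0.
have fin M N : M *m N = 1%:M -> (exists a b, sub N Q = pen a b) ->
    exists a b, [/\ sub N Q = pen a b, a != 0 & b != 0].
  move=> MN [a [b E]]; have := sub_smooth (mulmx1C MN) sm; rewrite E => /smooth_pen [a0 b0].
  by exists a, b.
have [Qw|Qw] := eqVneq Q.@[w] 0.
  have [k wk] := smooth_nondeg sm wp.
  have wu : polar Q w (ept k) != 0 by rewrite polar_sym polar_ept.
  have [q [Qq qp nwq _]] := second_isotropic hQ Qw wu wp.
  have [M [N [MN Nw Nq wr qr]]] := conic_frame sm wp qp nwq Qw Qq.
  have [a [b [QE a0 b0]]] : exists a b, [/\ sub N Q = pen a b, a != 0 & b != 0].
    apply: (fin M N MN); apply: conic_frame_pen => //.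
    - by rewrite (meval_eq _ Nw).
    - by rewrite (meval_eq _ Nq).
    - by rewrite -[RHS]wr; apply: eq_polar.
    by rewrite -[RHS]qr; apply: eq_polar.
  case: (nilpotent_case ex D A'f A'0 MN Qs QE a0 b0 A'Q _ sz) => i.
  rewrite colE; apply: mulv0 => j; rewrite -[RHS](Aw j); exact: mulv_eq.
have [p [pp pw Qp]] := polar_isotropic sm wp.
have [k pk] := smooth_nondeg sm pp.
have Bww : polar Q w w != 0 by rewrite polar_quad // mulf_neq0.
pose u i := 1 * ept k i + (- (polar Q w (ept k) / polar Q w w)) * w i.
have pu : polar Q p u != 0.
  by rewrite /u polarDr pw mulr0 addr0 mul1r polar_sym polar_ept.
have wu : polar Q w u = 0 by rewrite /u polarDr mul1r mulNr divfK // subrr.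
have [q [Qq qp npq [t qE]]] := second_isotropic hQ Qp pu pp.
have wq : polar Q q w = 0.
  have qE' : q =1 (fun i => 1 * u i + (- t) * p i) by move=> i; rewrite qE mul1r mulNr.
  by rewrite (eq_polar Q qE' (fun=> erefl)) polarDl pw mulr0 addr0 mul1r polar_sym.
have [M [N [MN Np Nq pr qr]]] := conic_frame sm pp qp npq Qp Qq.
have [a [b [QE a0 b0]]] : exists a b, [/\ sub N Q = pen a b, a != 0 & b != 0].
  apply: (fin M N MN); apply: conic_frame_pen => //.
  - by rewrite (meval_eq _ Np).
  - by rewrite (meval_eq _ Nq).
  - by rewrite -[RHS]pr; apply: eq_polar.
  by rewrite -[RHS]qr; apply: eq_polar.
apply: (torus_case ex D A'f A'0 MN Qs QE a0 b0 A'Q) => i.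
have NM := mulmx1C MN; pose v := mulv M w; pose r := mulv N (ept 1).
have wE : w =1 (fun i => 1 * (v 0 * p i + v 2 * q i) + v 1 * r i).
  by move=> j; rewrite -[LHS](mulvK w NM) -/v -Np -Nq /r !mulv_ept mulv3; ring.
have Bpq : polar Q p q != 0.
  have -> : polar Q p q = polar Q p u.
    have qE' : q =1 (fun i => 1 * u i + (- t) * p i) by move=> j; rewrite qE mul1r mulNr.
    by rewrite (eq_polar Q (fun=> erefl) qE') polarDr polar_quad // Qp !mulr0 addr0 mul1r.
  by [].
have v2 : v 2 = 0.
  apply: (mulIf Bpq); rewrite mul0r -[RHS]pw (eq_polar Q (fun=> erefl) wE) !polarDr.
  by rewrite polar_quad // Qp pr; ring.
have v0 : v 0 = 0.
  apply: (mulIf Bpq); rewrite mul0r -[RHS]wq (eq_polar Q (fun=> erefl) wE) !polarDr.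
  by rewrite (polar_quad q hQ) Qq qr polar_sym; ring.
have wr j : w j = v 1 * r j by rewrite wE v0 v2; ring.
have v1 : v 1 != 0.
  by case: wp => j; rewrite wr; apply: contraNneq => ->; rewrite mul0r.
rewrite colE; apply: mulv0 => j; apply: (mulfI v1); rewrite mulr0 -[RHS](Aw j).
by rewrite -mulvZ; apply: mulv_eq => l; rewrite wr.
Qed.

Theorem tjurina_classification d f : (6 <= d)%N -> f \is d.-homog -> conic_line_arrangement f ->
  total_tjurina f (d ^ 2 - 3 * d + 2)%N -> type_C2 f \/ type_CL6 f.
Proof.
move=> d6 hf fC tau; have [fr _] := fC; have f0 : f != 0 by case: fr.
have ex : extremal d f by [].
have [r [rho [r1 sd]]] := linear_syzygy d6 hf fC tau.
have [A [Ans Af]] := linear_field r1 sd.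
have [s [c D]] := arrangement_factors fC; have [c0 fE sP _] := D.
have [n ns hn] : exists2 n, (n <= 2 * size s)%N & \prod_(g <- s) g \is n.-homog.
  by apply: prod_homog => g /sP [].
have nd : n = d by apply: (dhomog_uniq (mf := mdeg) f0) => //; rewrite fE; apply: dhomogZ.
have [[Q [Qs sm]]|no] := classic (exists Q, Q \in s /\ smooth_conic Q).
  apply: (conic_case ex D Ans Af _ Qs sm).
  by move: (size s) ns => k; rewrite nd; lia.
have sL g : g \in s -> is_line g.
  by move=> gs; have [_ [//|gc]] := sP g gs; case: no; exists g.
have ds : d = size s.
  apply: (dhomog_uniq (mf := mdeg) f0) => //; rewrite fE; apply: dhomogZ.
  move: sL; elim: (s) => [|g t IH] H; first by rewrite big_nil dhomog1.
  rewrite big_cons; apply: (dhomogM (d := 1) (e := size t)).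
    by have [] := H g (mem_head _ _).
  by apply: IH => h ht; apply: H; rewrite inE ht orbT.
by case: (not_all_lines ex Ans Af D _ sL); lia.
Qed.
End Final.

Theorem theorem2 (R : realType) (d : nat) (f : {mpoly R[i][3]})
    (hd : (6 <= d)%N) (hf : f \is d.-homog) (hC : conic_line_arrangement f) :
  total_tjurina f (d ^ 2 - 3 * d + 2)%N <-> type_C2 f \/ type_CL6 f.
Proof. by split; [exact: tjurina_classification | exact: bitangent_union_tjurina]. Qed.
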